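(* There is an algorithm that, given a graph $G$ with $n$ nodes and $m$ edges, decides in time $\mathcal O(n^2m^2)$ whether $G$ contains a propeller as an induced subgraph (outputting YES if $G$ contains no propeller as an induced subgraph, and NO otherwise).
   Context: All graphs are finite, simple and undirected. A propeller $(C,x)$ is a graph consisting of a chordless cycle $C$ (the rim) and a node $x\notin V(C)$ (the center) that has at least two neighbors on $C$. *)

(* Defs.v *)
From mathcomp Require Import all_boot.
Set Implicit Arguments. Unset Strict Implicit. Unset Printing Implicit Defensive.

(** * Graphs and propellers *)

Record sgraph := SGraph {
  vertex :> finType;
  adj : rel vertex;
  adj_sym : symmetric adj;
  adj_irr : irreflexive adj }.

Definition edges (G : sgraph) : {set {set G}} :=
  [set e | [exists x : G, exists y : G, adj x y && (e == [set x; y])]].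

Section Induced.
Variables (G : sgraph) (S : {set G}).

Definition induced_adj : rel {x : G | x \in S} :=
  fun u v => adj (val u) (val v).

Lemma induced_adj_sym : symmetric induced_adj.
Proof. by move=> u v; apply: adj_sym. Qed.

Lemma induced_adj_irr : irreflexive induced_adj.
Proof. by move=> u; apply: adj_irr. Qed.

Definition induced : sgraph := SGraph induced_adj_sym induced_adj_irr.
End Induced.

(** Triangles count as chordless cycles. *)
Definition chordless_cycle (G : sgraph) (c : seq G) : Prop :=
  [/\ 3 <= size c, uniq c, cycle (@adj G) c &
      {in c &, forall u v, adj u v -> v = next c u \/ u = next c v}].

(** [H] itself is a propeller: its vertices are those of the rim [c] together
    with the center [x]. *)
Definition propeller (H : sgraph) : Prop :=
  exists (c : seq H) (x : H),
    [/\ chordless_cycle c, x \notin c, 2 <= count (adj x) c &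
        forall v : H, v = x \/ v \in c].

Definition contains_propeller (G : sgraph) : Prop :=
  exists S : {set G}, propeller (induced S).

(** * Word RAM

    Structured programs over finitely many registers and a random access
    memory.  Each operation, literal, register or memory access takes one time
    unit.  To keep the unit cost criterion honest, all values have to stay
    below a word bound [W]; a program that computes a larger value is stuck. *)

Inductive binop := OpAdd | OpSub | OpMul | OpDiv | OpEq | OpLt.

(** Subtraction is truncated and division by zero gives zero. *)
Definition binop_sem (o : binop) (a b : nat) : nat :=
  match o with
  | OpAdd => a + b
  | OpSub => a - b
  | OpMul => a * b
  | OpDiv => a %/ b
  | OpEq => a == b
  | OpLt => a < b
  end.

Inductive expr :=
  | Lit of nat
  | Reg of nat
  | Read of expr
  | Op of binop & expr & expr.

Inductive cmd :=
  | Skip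
  | Assign of nat & expr           (* register := expression *)
  | Write of expr & expr           (* memory[address] := value *)
  | Seq of cmd & cmd
  | If of expr & cmd & cmd         (* nonzero means true *)
  | While of expr & cmd.

Record state := State { reg : nat -> nat; mem : nat -> nat }.

Definition upd (f : nat -> nat) (i v : nat) : nat -> nat :=
  fun j => if j == i then v else f j.

Definition word (W v : nat) : option nat := if v < W then Some v else None.

Fixpoint eval (W : nat) (s : state) (e : expr) : option nat :=
  match e with
  | Lit v => word W v
  | Reg r => word W (reg s r)
  | Read e1 => obind (fun a => word W (mem s a)) (eval W s e1)
  | Op o e1 e2 =>
      obind (fun a => obind (fun b => word W (binop_sem o a b)) (eval W s e2))
            (eval W s e1)
  end.

Fixpoint cost (e : expr) : nat :=
  match e with
  | Lit _ | Reg _ => 1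
  | Read e1 => (cost e1).+1
  | Op _ e1 e2 => (cost e1 + cost e2).+1
  end.

(** [exec W p s t s']: started in [s], [p] terminates in [s'] after [t] time
    units. *)
Inductive exec (W : nat) : cmd -> state -> nat -> state -> Prop :=
  | ExecSkip s : exec W Skip s 1 s
  | ExecAssign r e s v : eval W s e = Some v ->
      exec W (Assign r e) s (cost e).+1 (State (upd (reg s) r v) (mem s))
  | ExecWrite e1 e2 s a v : eval W s e1 = Some a -> eval W s e2 = Some v ->
      exec W (Write e1 e2) s (cost e1 + cost e2).+1
           (State (reg s) (upd (mem s) a v))
  | ExecSeq p q s t s1 t' s2 :
      exec W p s t s1 -> exec W q s1 t' s2 -> exec W (Seq p q) s (t + t') s2
  | ExecIf e p q s v t s1 : eval W s e = Some v ->
      exec W (if v != 0 then p else q) s t s1 ->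
      exec W (If e p q) s ((cost e).+1 + t) s1
  | ExecWhileFalse e p s : eval W s e = Some 0 ->
      exec W (While e p) s (cost e).+1 s
  | ExecWhileTrue e p s v t s1 t' s2 : eval W s e = Some v -> v != 0 ->
      exec W p s t s1 -> exec W (While e p) s1 t' s2 ->
      exec W (While e p) s ((cost e).+1 + t + t') s2.

Lemma exec_det W p s t1 s1 t2 s2 :
  exec W p s t1 s1 -> exec W p s t2 s2 -> t1 = t2 /\ s1 = s2.
Proof.
move=> H; elim: H t2 s2 => {p s t1 s1};
  try by intros; match goal with h : exec _ _ _ _ _ |- _ => inversion h end;
         subst; split; congruence.
- move=> p q s t s1 t' s2 _ IH1 _ IH2 t2 s3 H; inversion H; subst.
  match goal with h1 : exec W p _ _ _, h2 : exec W q _ _ _ |- _ =>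
    have [? ?] := IH1 _ _ h1; subst; by have [-> ->] := IH2 _ _ h2 end.
- move=> e p q s v t s1 ev _ IH t2 s2 H; inversion H; subst.
  match goal with h1 : eval _ _ _ = Some ?x, h2 : exec _ (if ?x != 0 then _ else _) _ _ _ |- _ =>
    have ? : x = v by congruence end; subst.
  match goal with h2 : exec _ (if v != 0 then _ else _) _ _ _ |- _ =>
    by have [-> ->] := IH _ _ h2 end.
- move=> e p s ev t2 s2 H; inversion H; subst => //.
  match goal with h1 : eval _ _ _ = Some ?x, h2 : is_true (?x != 0) |- _ =>
    have E : x = 0 by congruence end.
  by subst.
- move=> e p s v t s1 t' s2 ev v0 _ IH1 _ IH2 t2 s3 H; inversion H; subst.
    have E : v = 0 by congruence.
    by rewrite E in v0.
  match goal with h1 : exec W p _ _ _, h2 : exec W (While _ _) ?z _ s3 |- _ =>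
    have [? ?] := IH1 _ _ h1; subst; by have [-> ->] := IH2 _ _ h2 end.
Qed.

(** The input occupies the first memory cells, everything else is initially
    zero, and the answer is left in register 0. *)
Definition initial (w : seq nat) : state := State (fun=> 0) (nth 0 w).

Definition runs_to (W : nat) (p : cmd) (w : seq nat) (t ans : nat) : Prop :=
  exists2 s : state, exec W p (initial w) t s & reg s 0 = ans.

Definition YES : nat := 1.
Definition NO : nat := 0.

(** * Input format

    A graph is given by [n], [m] and the list of its edges, in any order and
    with either orientation, for an arbitrary numbering of its vertices. *)
Definition graph_code (G : sgraph) (w : seq nat) : Prop :=
  exists (num : G -> 'I_#|G|) (es : seq (G * G)),
    [/\ bijective num,
        perm_eq [seq [set e.1; e.2] | e <- es] (enum (edges G)) &
        w = #|G| :: #|edges G| ::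
              flatten [seq [:: val (num e.1); val (num e.2)] | e <- es]].

(* Main.v *)
Require Import Defs.
From mathcomp Require Import all_boot zify.
Set Implicit Arguments. Unset Strict Implicit. Unset Printing Implicit Defensive.

(** A propeller with center [x] whose rim contains the neighbors [y], [z] of [x]
    exists only if [y] and [z] are not separated in [G - x] by the removal of a
    vertex, of the two ends of an edge, or of one edge, because a rim survives
    each of these removals.  Conversely, if some [y], [z] are separated by none
    of them, then [G] contains a propeller, possibly a different one.  Adjacent
    [y], [z] are joined by a shortest path avoiding the edge [yz].  Otherwise
    assume that [G] has no propeller, let [Z] be the component of [z] after
    deleting [y] and all vertices lying on a common hole with [y], and let [A]
    be the set of vertices outside [Z] with a neighbor in [Z].  Each vertex of
    [A] lies on a hole through [y].  Any two of them are adjacent: otherwise the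
    two holes through [y] and [A], joined through [Z], contain either a propeller
    or a hole through [y] that meets [Z].  So [A] is a clique, it has at most two
    vertices since there is no propeller, and it separates [y] from [z].

    The algorithm runs through all [x] and all edges [pq], computes in time
    [O(nm)] the components of the three graphs obtained from [G - x], and marks
    the separated pairs.  It answers NO when an unmarked pair is left. *)

(** * Induced paths and holes *)

(** The delicate point is the adjacency of two attachments [w1], [w2] of [Z] that lie on different
    holes through [y]. The hole of [w2] is followed from [w2] both ways until it reaches the hole of
    [w1], and then cut down to a piece, an ear, whose inner vertices have no neighbor there. Since
    no vertex outside a hole sees two of its vertices, each end of the ear has exactly one neighbor,
    a foot, on the hole of [w1]. The positions of the feet, of [y] and of [w1] leave finitely many
    cases. Most give two walks without an edge between them, each containing a neighbor of [y] and
    an attachment; the others give a rerouted hole with a foot or [w1] as center.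

    All new holes come from one construction: a shortest path between two disjoint classes that
    together form the neighborhood of the root.

    On the machine, [n * 2m] rounds leave [O(nm)] for each, which naive relabelling achieves. A
    separated pair is stored by a dart, that is a center with one neighbor, and a vertex, so that
    the final comparison takes time [O(m^2)]. *)

Section Lists.
Variable T : eqType.
Implicit Types (s : seq T) (P : pred T).

Lemma split_last P s : has P s ->
  exists s1 v s2, [/\ s = s1 ++ v :: s2, P v & ~~ has P s2].
Proof.
elim: s => //= x s IH; case: (boolP (has P s)) => [/IH [s1 [v [s2 [-> Pv Ps2]]]] _|nPs].
  by exists (x :: s1), v, s2.
by rewrite orbF => Px; exists [::], x, s.
Qed.

Lemma split_first P s : has P s ->
  exists s1 v s2, [/\ s = s1 ++ v :: s2, P v & ~~ has P s1].
Proof.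
elim: s => //= x s IH; case: (boolP (P x)) => [Px _|nPx /= /IH [s1 [v [s2 [-> Pv Ps1]]]]].
  by exists [::], x, s.
by exists (x :: s1), v, s2; rewrite /= negb_or nPx.
Qed.

Lemma split_mem s v : v \in s -> exists s1 s2, s = s1 ++ v :: s2.
Proof. by case/splitPr => s1 s2; exists s1, s2. Qed.

Lemma mem_tail x s v : v \in s -> v \in x :: s.
Proof. by rewrite inE orbC => ->. Qed.

End Lists.

Section InducedPaths.
Variables (T : finType) (e : rel T).
Hypotheses (e_sym : symmetric e) (e_irr : irreflexive e).
Implicit Types (s : seq T) (X U : pred T).

(** Non-adjacency is required only from a vertex to those beyond its successor; symmetry of [e]
    supplies the other direction. *)
Fixpoint ipath s :=
  if s is x :: s1 then
    [&& (if s1 is y :: s2 then e x y && all (fun z => ~~ e x z) s2 else true),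
        x \notin s1 & ipath s1]
  else true.

(** The closed sequence [y :: s] is a chordless cycle, seen from its vertex [y]. *)
Definition hole y s :=
  [&& 1 < size s, ipath s, y \notin s &
      all (fun v => e y v == (v == head y s) || (v == last y s)) s].

(** Vertices are deleted from the relation and not from the type, so that sequences need no
    transport between subgraphs. *)
Definition restr X : rel T := fun u v => [&& e u v, X u & X v].

Definition linked_set X := forall u v, X u -> X v -> connect (restr X) u v.

Lemma restr_sym X : connect_sym (restr X).
Proof.
apply: symmetric_from_pre => u v /connectP [p pp ->].
apply/connectP; exists (rev (belast u p)).
  rewrite rev_path; apply: sub_path pp => a b /and3P [eab Xa Xb].
  by rewrite /restr e_sym eab Xa Xb.
by case: p pp => //= a p _; rewrite rev_cons last_rcons.
Qed.

Lemma connect_restr X X' : (forall v, X v -> X' v) ->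
  forall u v, connect (restr X) u v -> connect (restr X') u v.
Proof.
move=> XX; apply: connect_sub => u v /and3P [euv Xu Xv].
by apply: connect1; rewrite /restr euv !XX.
Qed.

Lemma ipath_sorted s : ipath s -> sorted e s.
Proof.
elim: s => //= x [|y s] IH //= /and3P [/andP [exy _] _ /IH /= ->].
by rewrite exy.
Qed.

(** [u] and [v] serve as their own default values; a list with a member is nonempty, so the defaults
    are never returned. *)
Lemma ipath_cat s1 s2 : ipath (s1 ++ s2) ->
  [/\ ipath s1, ipath s2 &
      forall u v, u \in s1 -> v \in s2 -> u != v /\
        (e u v -> u = last u s1 /\ v = head v s2)].
Proof.
elim: s1 => [|x s1 IH] /=; first by move=> ?; split.
case/and3P => H1 H2 /IH [i1 i2 H]; split=> //.
  apply/and3P; split => //; last by move: H2; rewrite mem_cat; case/norP.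
  case: {IH i1 H2 H} s1 H1 => //= y s1 /andP [-> /=].
  by rewrite all_cat => /andP [].
move=> u v; rewrite inE => /orP [/eqP -> vs2|us1 vs2]; last first.
  have [-> Hl] := H u v us1 vs2; split=> // euv.
  have [Hu Hv] := Hl euv; split => //.
  by rewrite {1}Hu; case: (s1) us1.
split.
  by apply: contraNneq H2 => ->; rewrite mem_cat vs2 orbT.
move=> exv; case: s1 {IH H i1} H1 H2 => /=.
  case: s2 vs2 {i2} => //= y s2; rewrite inE => /orP [/eqP -> //|vs2].
  by case/andP => _ /allP /(_ v vs2); rewrite exv.
by move=> y s1 /andP [_]; rewrite all_cat => /andP [_ /allP /(_ v vs2)]; rewrite exv.
Qed.

Lemma ipath_far s1 s2 s3 u v : ipath (s1 ++ s2 ++ s3) -> s2 != [::] ->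
  u \in s1 -> v \in s3 -> ~~ e u v.
Proof.
move=> i12 n2 us vs; have [_ i23 H] := ipath_cat i12.
have v23 : v \in s2 ++ s3 by rewrite mem_cat vs orbT.
have [_ H1] := H _ _ us v23; apply/negP => /H1 [_].
have [_ _ H2] := ipath_cat i23.
case: s2 n2 H2 {i12 i23 H H1 v23} => //= a s2 _ H2 va.
by have [/eqP] := H2 a v (mem_head _ _) vs; rewrite va.
Qed.

Lemma ipath_link s1 s2 u v : ipath (s1 ++ s2) -> u \in s1 -> v \in s2 ->
  e u v -> u = last u s1 /\ v = head v s2.
Proof. by case/ipath_cat => _ _ H us vs; case: (H u v us vs). Qed.

Lemma ipath_uniq s : ipath s -> uniq s.
Proof. by elim: s => //= x s IH /and3P [_ -> /IH ->]. Qed.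


Lemma cat_ipath s1 s2 : ipath s1 -> ipath s2 ->
  (forall u v, u \in s1 -> v \in s2 -> u != v /\
     e u v = (u == last u s1) && (v == head v s2)) -> ipath (s1 ++ s2).
Proof.
elim: s1 => [|x s1 IH] //= /and3P [H1 H2 i1] i2 H; apply/and3P; split.
- case: s1 H1 H2 {IH i1} H => [|y s1] /=.
    case: s2 i2 => //= y s2 /and3P [_ ys2 _] _ _ H.
    have [_ ->] := H x y (mem_head _ _) (mem_head _ _); rewrite !eqxx /=.
    apply/allP => z zs; have [_ ->] := H x z (mem_head _ _) (mem_tail _ zs).
    by rewrite eqxx /=; apply: contraNneq ys2 => <-.
  case/andP => -> H1 H2 H; rewrite all_cat H1 /=; apply/allP => z zs.
  have [_ ->] := H x z (mem_head _ _) zs.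
  suff /negPf -> : x != last y s1 by [].
  by apply: contraNneq H2 => ->; rewrite mem_last.
- rewrite mem_cat negb_or H2; apply/negP => xs2.
  by have [/eqP] := H x x (mem_head _ _) xs2.
- apply: IH => // u v us vs; have [-> ->] := H u v (mem_tail _ us) vs.
  by split => //; case: (s1) us.
Qed.

Lemma ipath_rev s : ipath s -> ipath (rev s).
Proof.
elim: s => //= x s IH /and3P [H1 H2 /[dup] is1 /IH i1]; rewrite rev_cons -cats1.
apply: cat_ipath => // u v; rewrite mem_rev inE => us /eqP -> /=.
split; first by apply: contraNneq H2 => <-.
rewrite eqxx andbT e_sym; case: s H1 H2 us is1 {IH i1} => //= y s /andP [exy xs] _.
rewrite rev_cons last_rcons inE => /orP [/eqP -> |us /and3P [_ ys _]]; first by rewrite eqxx.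
rewrite (negPf (allP xs _ us)); apply/esym/negbTE.
by apply: contraNneq ys => <-.
Qed.

Lemma head_rev (y : T) s : head y (rev s) = last y s.
Proof. by case/lastP: s => //= s x; rewrite rev_rcons last_rcons. Qed.

Lemma last_rev (y : T) s : last y (rev s) = head y s.
Proof. by case: s => //= x s; rewrite rev_cons last_rcons. Qed.

Lemma hole_rev y s : hole y s -> hole y (rev s).
Proof.
case/and4P => s1 is1 ys /allP H; apply/and4P; split.
- by rewrite size_rev.
- exact: ipath_rev.
- by rewrite mem_rev.
- apply/allP => v; rewrite mem_rev head_rev last_rev => /H /eqP ->.
  by rewrite orbC.
Qed.

Lemma connect_sorted X s u v : sorted e s -> {subset s <= X} ->
  u \in s -> v \in s -> connect (restr X) u v.
Proof.
have aux x p w : path e x p -> {subset x :: p <= X} -> w \in x :: p ->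
    connect (restr X) x w.
  elim: p x => [|y p IH] x /=; first by move=> _ _; rewrite inE => /eqP ->.
  case/andP => exy py sX; rewrite inE => /orP [/eqP -> // | wp].
  have Xx : X x by apply: sX; rewrite mem_head.
  have Xy : X y by apply: sX; rewrite !inE eqxx orbT.
  apply: (connect_trans (y := y)); first by apply: connect1; rewrite /restr exy Xx.
  by apply: IH => // z zs; apply: sX; rewrite inE zs orbT.
case: s => //= x p px sX us vs; apply: (connect_trans (y := x)).
  by rewrite restr_sym; apply: aux us.
exact: aux vs.
Qed.

(** A tool to read off the course of a hole known only to exist: the edge found here shows where it
    leaves a given arc. *)
Lemma exit_sorted X s x : sorted e (x :: s) -> X x -> ~~ X (last x s) ->
  exists u v, [/\ u \in x :: s, v \in x :: s, X u, ~~ X v & e u v].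
Proof.
elim: s x => [|y s IH] x /=; first by move=> _ ->.
case/andP => exy pys Xx nX; case: (boolP (X y)) => Xy.
  have [u [v [us vs Xu Xv euv]]] := IH y pys Xy nX.
  by exists u, v; split=> //; rewrite inE ?us ?vs orbT.
by exists x, y; split => //; rewrite !inE eqxx ?orbT.
Qed.

Lemma exit_connect X U a b : connect (restr U) a b -> X a -> ~~ X b ->
  exists u v, [/\ U u, U v, X u, ~~ X v & e u v].
Proof.
case/connectP => p pp -> {b}; elim: p a pp => [|y p IH] a /=; first by move=> _ ->.
case/andP => /and3P [eay Ua Uy] pp Xa nX; case: (boolP (X y)) => Xy.
  exact: IH pp Xy nX.
by exists a, y.
Qed.

(** A walk fails to be induced by a chord or a repeated vertex; cutting out what lies between drops
    at least one vertex and keeps both ends. *)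
Lemma shorten_sorted x s : sorted e (x :: s) -> ~~ ipath (x :: s) ->
  exists s', [/\ sorted e (x :: s'), size s' < size s, last x s' = last x s &
    {subset s' <= s}].
Proof.
elim: s x => [|y s IH] x // pxys; have /andP [exy pys] : e x y && path e y s := pxys.
move=> nip; case: (boolP (ipath (y :: s))) => iys; last first.
  have [s' [H1 H2 H3 H4]] := IH y pys iys; exists (y :: s') => /=; split=> //.
    by rewrite exy.
  by move=> z; rewrite !inE => /orP [-> //|/H4 ->]; rewrite orbT.
have [nall|xs] : ~~ all (fun z => ~~ e x z) s \/ x \in y :: s.
- case: (boolP (all _ s)) => [al|]; [right | by left].
  by apply: contraNT nip => xs; apply/and3P; split; rewrite ?exy.
  have /hasP [v vs exv] : has (e x) s by move: nall; rewrite -has_predC; under eq_has do rewrite /= negbK.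
  case: (split_mem vs) pys => s1 [s2 ->]; rewrite cat_path /= => /and3P [_ _ p2].
  exists (v :: s2); rewrite /= exv last_cat size_cat /=; split => //; first lia.
  by move=> z zs; rewrite inE mem_cat zs !orbT.
have : path e x (y :: s) by rewrite /= exy.
case: (split_mem xs) => s1 [s2 ->]; rewrite cat_path => /= /and3P [_ _ p2].
exists s2; rewrite size_cat last_cat /=; split=> //; first lia.
by move=> z zs; rewrite mem_cat inE zs !orbT.
Qed.

(** Induction on the length of a walk from [N1] to [N2] inside [U]: a shortcut, a later start in
    [N1] or an earlier end in [N2] would each make it shorter. *)
Lemma shortest_path U (N1 N2 : pred T) a b : N1 a -> N2 b -> U a -> connect (restr U) a b ->
  exists x s, [/\ ipath (x :: s), {subset x :: s <= U}, N1 x /\ N2 (last x s),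
    {in s, forall v, ~~ N1 v} & {in belast x s, forall v, ~~ N2 v}].
Proof.
move=> N1a N2b Ua /connectP [p pp pb].
have : exists s, [/\ sorted e (a :: s), {subset a :: s <= U} & N2 (last a s)].
  exists p; rewrite -pb; split=> // {pb b N2b}.
    by move: pp => /=; apply: sub_path => u v /and3P [].
  elim: p a pp Ua {N1a} => [|y p IH] a /=; first by move=> _ Ua z; rewrite inE => /eqP ->.
  by case/andP => /and3P [_ _ Uy] pp Ua z; rewrite inE => /orP [/eqP -> //|]; apply: IH.
case=> s {p pp pb b N2b Ua}.
have [n] := ubnP (size s); elim: n => // n IH in a s N1a *; rewrite ltnS => sn [ss sU N2l].
case: (boolP (ipath (a :: s))) => [is1|/(shorten_sorted ss) [s' [H1 H2 H3 H4]]]; last first.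
  apply: (IH a s' N1a); first by lia.
  split; rewrite ?H3 //.
  by move=> z; rewrite inE => /orP [/eqP -> |/H4 zs]; apply: sU; rewrite inE ?eqxx ?zs ?orbT.
case: (boolP (has N1 s)) => [/hasP [v vs N1v]|/hasPn h1].
  case: (split_mem vs) ss sU sn N2l => s1 [s2 ->] /=.
  rewrite cat_path last_cat size_cat /= => /and3P [_ _ p2] sU sn N2l.
  apply: (IH v s2) => //; first by lia.
  by split=> // z zs; apply: sU; rewrite inE mem_cat zs !orbT.
case: (boolP (has N2 (belast a s))) => [/hasP [v vs N2v]|/hasPn h2]; last by exists a, s.
case: (split_mem vs) => s1 [s2 def].
have defs : a :: s = s1 ++ v :: rcons s2 (last a s).
  by rewrite lastI def rcons_cat.
case: s1 def defs => [|c s1] def [ea es].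
  subst v; apply: (IH a [::]) => //=; last by split=> // z; rewrite inE => /eqP ->; apply: sU; rewrite mem_head.
  by move: sn; rewrite es size_rcons; lia.
subst c; apply: (IH a (rcons s1 v)) => //.
  by move: sn; rewrite es size_cat /= !size_rcons; lia.
split.
- by move: ss; rewrite es /= -cat_rcons cat_path => /andP [].
- move=> z zs; apply: sU; move: zs; rewrite es -cat_rcons !inE mem_cat.
  by case/orP => ->; rewrite ?orbT.
- by rewrite last_rcons.
Qed.

(** Only the ends of a shortest path from [N1] to [N2] are neighbors of [y], so it closes up with
    [y] without a chord; disjointness of the two classes gives it a second vertex. *)
Lemma hole_through y U (N1 N2 : pred T) a b : ~~ U y -> {in U, forall v, e y v = N1 v || N2 v} ->
  (forall v, N1 v -> ~~ N2 v) -> N1 a -> N2 b -> U a -> connect (restr U) a b ->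
  exists x s, [/\ hole y (x :: s), {subset x :: s <= U}, N1 x & N2 (last x s)].
Proof.
move=> nUy HU dis N1a N2b Ua cab.
have [x [s [is1 sU [N1x N2l] n1 n2]]] := shortest_path N1a N2b Ua cab.
exists x, s; split => //; apply/and4P; split => //.
- by case: s {is1 sU n1 n2} N2l => //= N2x; rewrite (negPf (dis _ N1x)) in N2x.
- by apply: contra nUy => /sU.
- apply/allP => v vs; rewrite HU ?sU //=; apply/eqP.
  case: (eqVneq v x) => [-> |vx]; first by rewrite N1x.
  case: (eqVneq v (last x s)) => [-> |vl]; first by rewrite N2l orbT.
  move: vs; rewrite inE (negPf vx) /= => vs.
  rewrite (negPf (n1 _ vs)) /=; apply/negbTE/n2.
  have : v \in rcons (belast x s) (last x s) by rewrite -lastI inE vs orbT.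
  by rewrite mem_rcons inE (negPf vl).
Qed.

End InducedPaths.

(** * Holes through two vertices of a propeller-free graph *)

Lemma sorted_join (T : eqType) (e : rel T) s1 u v s2 :
  sorted e (rcons s1 u) -> sorted e (v :: s2) -> e u v ->
  sorted e (rcons s1 u ++ v :: s2).
Proof.
case: s1 => [|a s1] /=; first by move=> _ -> ->.
by rewrite cat_path last_rcons /= => -> -> ->.
Qed.

Lemma uniq_mid (T : eqType) (s1 s2 : seq T) x :
  uniq (s1 ++ x :: s2) -> x \notin s1 /\ x \notin s2.
Proof.
by rewrite -cat_rcons cat_uniq rcons_uniq => /and3P [/andP [-> _]] /hasPn H _;
  split=> //; apply/negP => /H; rewrite mem_rcons mem_head.
Qed.

Section HoleFacts.
Variables (T : finType) (e : rel T).
Hypotheses (e_sym : symmetric e) (e_irr : irreflexive e).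

Lemma hole_size y s : hole e y s -> 1 < size s.
Proof. by case/and4P. Qed.

Lemma holeE y s v : hole e y s -> v \in s ->
  e y v = (v == head y s) || (v == last y s).
Proof. by case/and4P => _ _ _ /allP H /H /eqP. Qed.

Lemma hole_ipath y s : hole e y s -> ipath e s.
Proof. by case/and4P. Qed.

Lemma hole_root y s : hole e y s -> y \notin s.
Proof. by case/and4P. Qed.

Lemma hole_head y s : hole e y s -> e y (head y s).
Proof.
move=> h; case: s h => [|x s] h; first by have := hole_size h.
by rewrite (holeE h) ?mem_head ?eqxx.
Qed.

Lemma hole_last y s : hole e y s -> e y (last y s).
Proof.
move=> h; case: s h => [|x s] h; first by have := hole_size h.
by rewrite (holeE h) /= ?mem_last ?eqxx ?orbT.
Qed.

Lemma hole_sorted y s : hole e y s -> sorted e (y :: s).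
Proof.
move=> h; move: (hole_head h) (ipath_sorted (hole_ipath h)).
by case: s {h} => //= x s -> ->.
Qed.

Lemma hole_sorted_rcons y s : hole e y s -> sorted e (rcons s y).
Proof.
move=> h; move: (hole_last h) (ipath_sorted (hole_ipath h)).
case: s {h} => //= x s eyx pxs; by rewrite rcons_path pxs e_sym.
Qed.

Lemma ipath_neq s1 s2 u v : ipath e (s1 ++ s2) -> u \in s1 -> v \in s2 -> u != v.
Proof. by case/ipath_cat => _ _ H us vs; case: (H u v us vs). Qed.

End HoleFacts.

Section NoPropeller.
Variables (T : finType) (e : rel T).
Hypotheses (e_sym : symmetric e) (e_irr : irreflexive e).
(** Stated for a relation and not for a graph, because it will be applied to [G - x] with [x] kept
    as an isolated vertex. *)
Hypothesis noprop : forall y s c u v, hole e y s -> c \notin y :: s ->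
  u \in y :: s -> v \in y :: s -> u != v -> e c u -> e c v -> False.

(** * Attachments of a component on one hole *)

Section Component.
Variables (y : T) (Z : pred T).
Hypotheses (Z_linked : linked_set e Z) (Z_y : forall v, Z v -> ~~ e y v)
  (y_Z : ~~ Z y) (Z_hole : forall s v, hole e y s -> v \in s -> ~~ Z v).

Definition attach v := [exists z, Z z && e v z].

(** Otherwise a shortest path from [t1] to [t2] through [Z] would close up with
    [y] to a hole meeting [Z]. *)
Lemma no_bypass t1 t2 a1 a2 u1 u2 :
  sorted e t1 -> sorted e t2 -> y \notin t1 -> y \notin t2 ->
  a1 \in t1 -> e y a1 -> a2 \in t2 -> e y a2 ->
  u1 \in t1 -> attach u1 -> u2 \in t2 -> attach u2 ->
  (forall u v, u \in t1 -> v \in t2 -> u != v /\ ~~ e u v) -> False.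
Proof.
move=> st1 st2 y1 y2 a1t ya1 a2t ya2 u1t /existsP [z1 /andP [Zz1 uz1]]
  u2t /existsP [z2 /andP [Zz2 uz2]] anti.
pose U := [pred v | [|| v \in t1, v \in t2 | Z v]].
have U1 : {subset t1 <= U} by move=> v vt; rewrite inE vt.
have U2 : {subset t2 <= U} by move=> v vt; rewrite inE vt orbT.
have UZ v : Z v -> U v by move=> Zv; rewrite /= Zv !orbT.
have cn : connect (restr e U) a1 a2.
  apply: (connect_trans (connect_sorted e_sym st1 U1 a1t u1t)).
  apply: (connect_trans (y := z1)).
    by apply: connect1; rewrite /restr uz1 (UZ _ Zz1) (U1 _ u1t : U u1).
  apply: (connect_trans (connect_restr UZ (Z_linked Zz1 Zz2))).
  apply: (connect_trans _ (connect_sorted e_sym st2 U2 u2t a2t)).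
  by apply: connect1; rewrite /restr e_sym uz2 (UZ _ Zz2) (U2 _ u2t : U u2).
(* The neighbors of [y] in [U] lie on [t1] or [t2], since [y] has none in [Z]. *)
have [||||||x [s [h sU /andP [xt1 _] /andP [lt2 _]]]] := @hole_through _ e y U
  [pred v | (v \in t1) && e y v] [pred v | (v \in t2) && e y v] a1 a2 _ _ _ _ _ _ cn.
- by rewrite /= (negPf y1) (negPf y2).
- move=> v /or3P [] /= vt; rewrite ?vt /=.
  + by case: (v \in t2); rewrite ?orbb ?orbF.
  + by case: (v \in t1); rewrite ?orbb ?orbF.
  + by rewrite (negPf (Z_y vt)) !andbF.
- move=> v /andP [v1 _]; apply/negP => /andP [v2 _].
  by have [/eqP] := anti v v v1 v2.
- by rewrite /= a1t.
- by rewrite /= a2t.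
- exact: U1.
(* The hole starts on [t1] and ends on [t2]; as there is no edge between them, it can leave [t1]
   only into [Z]. *)
have [|u [v [us vs ut1 vt1 euv]]] := exit_sorted (X := mem t1) (ipath_sorted (hole_ipath h)) xt1.
  by apply/negP => lt1; have [/eqP] := anti _ _ lt1 lt2.
have := sU v vs; rewrite inE; case/or3P => vX.
- by rewrite /= vX in vt1.
- by have [_] := anti u v ut1 vX; rewrite euv.
- by rewrite (negPf (Z_hole h vs)) in vX.
Qed.

(** If [a] and [b] are not consecutive on the hole, its arcs from [y] to the first and from the
    second back to [y] have no edge between them, as [no_bypass] requires. *)
Lemma attach_clique s a b : hole e y s -> a \in s -> b \in s -> attach a -> attach b ->
  a != b -> e a b.
Proof.
move=> h; wlog [s1 [s2 [s3 es]]] : a b / exists s1 s2 s3, s = s1 ++ a :: s2 ++ b :: s3.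
  move=> W as_ bs Aa Ab nab; case: (split_mem as_) => s1 [s2 es].
  move: (bs); rewrite es mem_cat inE eq_sym (negPf nab) /= => /orP [] /split_mem [s3 [s4 e']].
    rewrite e_sym; apply: W; rewrite // 1?eq_sym //.
    by exists s3, s4, s2; rewrite es e' -catA.
  by apply: W => //; exists s1, s3, s4; rewrite es e'.
move=> _ _ Aa Ab nab; subst s; case: s2 h => [|c s2] h.
  by have /ipath_sorted /cat_sorted2 [_ /= /andP [->]] := hole_ipath h.
have ip := hole_ipath h.
exfalso; apply: (@no_bypass (rcons s1 a) (b :: s3) (head y (rcons s1 a)) (last b s3) a b).
- by have /ipath_sorted := ip; rewrite -cat_rcons => /cat_sorted2 [].
- by have /ipath_sorted := ip; rewrite -cat_cons catA => /cat_sorted2 [].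
- by apply: contra (hole_root h); rewrite -cat_rcons mem_cat => ->.
- by apply: contra (hole_root h); rewrite -cat_cons catA mem_cat => ->; rewrite orbT.
- by case: (s1) => [|? ?] /=; rewrite inE eqxx.
- by have := hole_head h; rewrite -cat_rcons; case: (s1).
- exact: mem_last.
- by have := hole_last h; rewrite -cat_cons !last_cat.
- by rewrite mem_rcons mem_head.
- by [].
- exact: mem_head.
- by [].
move: ip; rewrite -cat_rcons => ip u v us vs.
by rewrite (ipath_far ip _ us vs) // (ipath_neq ip us) // mem_cat vs orbT.
Qed.

(** The path [l :: rcons m r] is joined to the hole [y :: s] by the edges [cl l]
    and [cr r] only. *)
Record ear (s : seq T) (l : T) (m : seq T) (r cl cr : T) : Prop := Ear {
  ear_ipath : ipath e (l :: rcons m r);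
  ear_out : {in l :: rcons m r, forall v, v \notin y :: s};
  ear_Z : {in l :: rcons m r, forall v, ~~ Z v};
  ear_l : e cl l;
  ear_r : e cr r;
  ear_touch : forall u v, u \in y :: s -> v \in l :: rcons m r -> e u v ->
     v = l /\ u = cl \/ v = r /\ u = cr }.

Lemma ear_rev s l m r cl cr : ear s l m r cl cr -> ear s r (rev m) l cr cl.
Proof.
have E : r :: rcons (rev m) l = rev (l :: rcons m r) by rewrite rev_cons rev_rcons.
case=> H1 H2 H3 H4 H5 H6; split=> //; rewrite ?E.
- exact: ipath_rev.
- by move=> v; rewrite mem_rev; apply: H2.
- by move=> v; rewrite mem_rev; apply: H3.
- by move=> u v us; rewrite mem_rev => vs /(H6 u v us vs) [|]; [right|left].
Qed.

Lemma ear_rev_base s l m r cl cr : ear s l m r cl cr -> ear (rev s) l m r cl cr.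
Proof.
have E v : (v \in y :: rev s) = (v \in y :: s) by rewrite !inE mem_rev.
by case=> H1 H2 H3 H4 H5 H6; split=> // [v /H2|u v]; rewrite E //; apply: H6.
Qed.

(** * Ears over a hole *)

Section WithEar.
Variables (s : seq T) (l : T) (m : seq T) (r cl cr : T).
Hypotheses (h : hole e y s) (E : ear s l m r cl cr).

Lemma ear_neq : l != r.
Proof.
have := ipath_uniq (ear_ipath E); rewrite /= mem_rcons inE negb_or.
by case/andP => /andP [].
Qed.

(** One walk is the arc [P], the other follows the ear along [J] to [r] and then the hole from [cr]
    along [R] back to [y]. The nonempty [P'] keeps [cr] away from [P], so only the edge from [cl] to
    [l] could join them, which the condition on [l] excludes. *)
Lemma ear_far P P' R J w1 w2 : s = P ++ P' ++ cr :: R -> P' != [::] ->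
  sorted e (rcons J r) -> {subset rcons J r <= l :: rcons m r} ->
  (l \in rcons J r -> cl \notin P) ->
  w1 \in P -> attach w1 -> w2 \in rcons J r -> attach w2 -> False.
Proof.
move=> es nP' sJ subJ lP w1P A1 w2J A2.
have ip : ipath e (P ++ P' ++ cr :: R) by rewrite -es (hole_ipath h).
have nP : P != [::] by apply: contraTneq w1P => ->.
have Ps v : v \in P -> v \in s by rewrite es mem_cat => ->.
have Rs v : v \in cr :: R -> v \in s by rewrite es !mem_cat => ->; rewrite !orbT.
apply: (@no_bypass P (rcons J r ++ cr :: R) (head y P) (last cr R) w1 w2) => //.
- by have /ipath_sorted /cat_sorted2 [] := ip.
- apply: sorted_join => //; last by rewrite e_sym (ear_r E).
  by have /ipath_sorted := ip; rewrite catA => /cat_sorted2 [].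
- by apply: contra (hole_root h) => /Ps.
- rewrite mem_cat negb_or; apply/andP; split.
    by apply: contraTN (mem_head y s) => /subJ /(ear_out E).
  by apply: contra (hole_root h) => /Rs.
- by case: (P) nP => // a P0 _; rewrite mem_head.
- by have := hole_head h; rewrite es; case: (P) nP.
- by rewrite mem_cat mem_last orbT.
- by have := hole_last h; rewrite es !last_cat.
- by rewrite mem_cat w2J.
move=> u v uP; rewrite mem_cat => /orP [vJ|vR]; last first.
  by rewrite (ipath_far ip nP' uP vR) (ipath_neq ip uP) // mem_cat vR orbT.
have us : u \in y :: s by rewrite mem_tail ?Ps.
split; first by apply: contraNneq (ear_out E (subJ _ vJ)) => <-.
apply/negP => /(ear_touch E us (subJ _ vJ)) [[vl ucl]|[_ ucr]].
  by subst; have := lP vJ; rewrite uP.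
by subst; have := ipath_neq (v := cr) ip uP; rewrite mem_cat mem_head orbT eqxx => /(_ isT).
Qed.

(** As [l] is a neighbor of [y], the ear can be one of the walks and the arc from [y] to [cr] the
    other. The edge between [cr] and [r] must disappear: if [w2] is [r], then [w1] is not [cr] and
    [cr] is dropped; otherwise [r] is dropped. *)
Lemma ear_at_root W R w1 w2 : cl = y -> s = W ++ cr :: R -> R != [::] -> W != [::] ->
  w1 \in rcons W cr -> attach w1 -> w2 \in l :: rcons m r -> attach w2 ->
  ~~ e w1 w2 -> False.
Proof.
move=> ecl es nR nW w1W A1 w2I A2 n12.
have ip : ipath e (W ++ cr :: R) by rewrite -es (hole_ipath h).
have Ws v : v \in rcons W cr -> v \in s.
  by rewrite es -cat_rcons mem_cat => ->.
have yl : e y l by rewrite -ecl (ear_l E).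
have sI := ipath_sorted (ear_ipath E).
have hW : e y (head y W) by have := hole_head h; rewrite es; case: (W) nW.
have Wh : head y W \in W by case: (W) nW => // a P0 _; rewrite mem_head.
have yW : y \notin rcons W cr by apply: contra (hole_root h) => /Ws.
have lu u v : u \in rcons W cr -> v \in l :: rcons m r -> u != v /\ (e u v -> v = r /\ u = cr).
  move=> uW vI; have us := mem_tail y (Ws _ uW); split.
    by apply: contraNneq (ear_out E vI) => <-.
  case/(ear_touch E us vI) => [[_ uy]|//].
  by move: yW; rewrite -ecl -uy uW.
have rm : r \notin l :: m.
  by have := ipath_uniq (ear_ipath E); rewrite -rcons_cons rcons_uniq => /andP [].
have [e2r|n2r] := eqVneq w2 r.
- have w1W' : w1 \in W.
    move: w1W; rewrite mem_rcons inE => /orP [/eqP e1|//].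
    by move: n12; rewrite e1 e2r (ear_r E).
  apply: (@no_bypass W (l :: rcons m r) (head y W) l w1 w2) => //.
  + by have /ipath_sorted /cat_sorted2 [] := ip.
  + by apply: contra yW; rewrite mem_rcons inE orbC => ->.
  + by apply: contraTN (mem_head y s) => /(ear_out E).
  + exact: mem_head.
  move=> u v uW vI; have [|-> H] := lu u v _ vI; first by rewrite mem_rcons inE uW orbT.
  split=> //; apply/negP => /H [_ uc].
  by have := ipath_neq (v := cr) ip uW; rewrite uc mem_head eqxx => /(_ isT).
have lm_I v : v \in l :: m -> v \in l :: rcons m r.
  by rewrite -rcons_cons mem_rcons [in X in _ -> X]inE orbC => ->.
apply: (@no_bypass (rcons W cr) (l :: m) (head y W) l w1 w2) => //.
- by have /ipath_sorted := ip; rewrite -cat_rcons => /cat_sorted2 [].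
- by move: sI; rewrite -rcons_cons -cats1 => /cat_sorted2 [].
- by apply: contraTN (mem_head y s) => /lm_I /(ear_out E).
- by rewrite mem_rcons inE Wh orbT.
- exact: mem_head.
- by move: w2I; rewrite -rcons_cons mem_rcons inE (negPf n2r).
move=> u v uW vI; have [-> H] := lu u v uW (lm_I _ vI).
by split=> //; apply/negP => /H [vr _]; move: rm; rewrite -vr vI.
Qed.


Lemma ear_uniq_r : r \notin l :: m.
Proof. by have := ipath_uniq (ear_ipath E); rewrite -rcons_cons rcons_uniq => /andP []. Qed.

Lemma ear_uniq_l : l \notin rcons m r.
Proof. by have := ipath_uniq (ear_ipath E) => /= /andP []. Qed.

(** Rerouting [cl w1 cr] along the ear gives a hole for the center [w1]. *)
Lemma ear_triangle L w1 R : s = L ++ cl :: w1 :: cr :: R -> False.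
Proof.
move=> es; have ip := hole_ipath h.
have us := ipath_uniq ip; have ys := hole_root h.
(* The rim with the detour over [w1] replaced by the ear, opened at [cl]. *)
pose t := rcons (l :: m) r ++ cr :: R ++ y :: L.
have st : sorted e t.
  apply: sorted_join; [exact: ipath_sorted (ear_ipath E)| | by rewrite e_sym (ear_r E)].
  have s1 := hole_sorted_rcons e_sym h; have s2 := hole_sorted h.
  rewrite -cat_cons; have -> : cr :: R = rcons (belast cr R) (last cr R) by rewrite -lastI.
  apply: sorted_join.
  - rewrite -lastI; move: (ipath_sorted ip); rewrite es.
    by rewrite -2!cat_rcons => /cat_sorted2 [].
  - by move: s2; rewrite es -cat_cons => /cat_sorted2 [].
  - by have := hole_last h; rewrite e_sym es last_cat.
have tI v : v \in l :: rcons m r -> v \notin y :: s by move/(ear_out E).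
have [w1cl w1cr] : e w1 cl /\ e w1 cr.
  have := ipath_sorted ip; rewrite es => /cat_sorted2 [_ /= /and3P [H1 H2 _]].
  by rewrite e_sym.
have [clL clR] : cl \notin L /\ cl \notin w1 :: cr :: R by apply: uniq_mid; rewrite -es.
have [w1L w1R] : w1 \notin rcons L cl /\ w1 \notin cr :: R.
  by apply: uniq_mid; rewrite cat_rcons -es.
have clcr : cl != cr by move: clR; rewrite !inE !negb_or => /and3P [].
have cls : cl \in s by rewrite es mem_cat mem_head orbT.
have w1s : w1 \in s by rewrite es mem_cat !inE eqxx !orbT.
have yn v : v \in s -> v != y by move=> vs; apply: contraNneq ys => <-.
have clI : cl \notin rcons (l :: m) r by apply: contraTN (mem_tail y cls) => /tI.
have w1I : w1 \notin rcons (l :: m) r by apply: contraTN (mem_tail y w1s) => /tI.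
have clt : cl \notin t.
  rewrite /t mem_cat (negPf clI) inE mem_cat inE (negPf (yn _ cls)) (negPf clL).
  by move: clR; rewrite !inE !negb_or => /and3P [_ /negPf -> /negPf ->].
have w1t : w1 \notin t.
  rewrite /t mem_cat (negPf w1I) -cat_cons mem_cat (negPf w1R) inE (negPf (yn _ w1s)).
  by move: w1L; rewrite mem_rcons inE negb_or => /andP [_ /negPf ->].
have Ls v : v \in y :: L -> v \in y :: s.
  by rewrite es !inE mem_cat => /orP [->|->]; rewrite ?orbT.
have lL : l \notin y :: L by apply: contra (tI l (mem_head _ _)) => /Ls.
have [||||||||x [s' [h' st' /eqP xl /andP [lL' _]]]] := @hole_through _ e cl (mem t)
   (pred1 l) [pred v | (v \in y :: L) && e cl v] l (last y L) _ _ _ _ _ _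
   (connect_sorted e_sym st (fun _ => id) _ _).
- by [].
- move=> v vt; rewrite /=; case: (eqVneq v l) => [->|vl]; first by rewrite (ear_l E).
  case: (boolP (v \in y :: L)) => //= vL; apply/negP => clv.
  have : v \in l :: rcons m r \/ v \in cr :: R.
    have : v \in t := vt; rewrite /t mem_cat => /orP [|]; first by left.
    by rewrite -cat_cons mem_cat (negPf vL) orbF; right.
  case=> [vI|vR].
    have [|[vl' _]|[_ /eqP]] := ear_touch E _ vI clv.
    + exact: mem_tail.
    + by rewrite vl' eqxx in vl.
    + by rewrite (negPf clcr).
  have := @ipath_far _ e (rcons L cl) [:: w1] (cr :: R) cl v.
  rewrite cat_rcons -es => /(_ ip isT _ vR); rewrite mem_rcons mem_head => /(_ isT).
  by rewrite clv.
- by move=> v /eqP ->; apply: contra lL => /andP [].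
- exact: eqxx.
- rewrite /= mem_last /=; have := hole_sorted h; rewrite es.
  rewrite -cat_cons lastI cat_rcons => /cat_sorted2 [_ /= /andP [+ _]].
  by rewrite e_sym.
- by rewrite inE /= mem_cat mem_rcons !inE eqxx ?orbT.
- by rewrite mem_cat mem_rcons !inE eqxx ?orbT.
- by rewrite mem_cat !inE mem_cat mem_last !orbT.
(* The new hole leaves the ear, and as [cl] is its root it can do so only at [cr]. It thus contains
   [cl] and [cr], two neighbors of [w1]. *)
subst x; have [||u [v [us' vs' uI vI euv]]] :=
    exit_sorted (X := mem (l :: rcons m r)) (ipath_sorted (hole_ipath h')).
- exact: mem_head.
- by apply: contraL lL' => lI; apply: contra (tI _ lI) => /Ls.
have vt := st' _ vs'; have vs : v \in y :: s.
  have : v \in cr :: R ++ y :: L.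
    have : v \in t := vt; rewrite /t mem_cat => /orP [vI'|//].
    by case/negP: vI.
  rewrite -cat_cons mem_cat => /orP [vR|/Ls //].
  by rewrite es inE mem_cat -[cl :: w1 :: _]/([:: cl; w1] ++ _) mem_cat vR !orbT.
rewrite e_sym in euv; have [[_ vcl]|[_ vcr]] := ear_touch E vs uI euv.
  by rewrite -vcl vt in clt.
subst v; apply: (noprop h' (c := w1) (u := cl) (v := cr)) => //.
- rewrite inE negb_or; apply/andP; split; last by apply: contra w1t => /st'.
  by apply: contraTneq w1cl => ->; rewrite e_irr.
- exact: mem_head.
- exact: mem_tail.
Qed.


(** Two applications of [ear_far], which differ in the dropped end of the edge from [cl] to [l]: it
    is [l] when [w2] is another vertex, and [cl] when [w2] is [l], since then [w1] is not [cl]. *)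
Lemma ear_left L W R w1 w2 : s = L ++ cl :: W ++ cr :: R -> W != [::] ->
  w1 \in rcons L cl -> attach w1 -> w2 \in l :: rcons m r -> attach w2 ->
  ~~ e w1 w2 -> False.
Proof.
move=> es nW w1L A1 w2I A2 n12.
have sI := ipath_sorted (ear_ipath E).
have [e2l|n2l] := eqVneq w2 l; last first.
  apply: (@ear_far (rcons L cl) W R m w1 w2) => //.
  - by rewrite cat_rcons.
  - by move: sI; rewrite -cat1s => /cat_sorted2 [].
  - by move=> v; apply: mem_tail.
  - by rewrite (negPf ear_uniq_l).
  - by move: w2I; rewrite inE (negPf n2l).
apply: (@ear_far L (cl :: W) R (l :: m) w1 w2) => //.
- by move=> _; have := ipath_uniq (hole_ipath h); rewrite es => /uniq_mid [].
- move: w1L; rewrite mem_rcons inE => /orP [/eqP e1|//].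
  by move: n12; rewrite e1 e2l (ear_l E).
Qed.

End WithEar.

(** The center is [cl]: a hole through [w1] and [l] avoiding [cl] runs along the
    ear and returns through [Z]. *)
Lemma ear_corner s l m r cl cr L w1 b W R :
  hole e y s -> ear s l m r cl cr -> s = L ++ cl :: w1 :: b :: W ++ cr :: R ->
  attach w1 -> attach l -> False.
Proof.
move=> h E es A1 Al; have ip := hole_ipath h; have us := ipath_uniq ip.
have ys := hole_root h.
(* Any attached vertex of the ear other than [l] falls under [ear_far]; the same holds for [b], with
   hole and ear read backwards. *)
have nAr v : v \in rcons m r -> ~~ attach v.
  move=> vI; apply/negP => Av.
  apply: (ear_far (w1 := w1) (w2 := v) (P := L ++ [:: cl; w1]) (P' := b :: W) h E _ _ _ _ _ _ _ vI) => //.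
  - by rewrite -catA es.
  - by have := ipath_sorted (ear_ipath E); rewrite -cat1s => /cat_sorted2 [].
  - by move=> z; apply: mem_tail.
  - by rewrite (negPf (ear_uniq_l E)).
  - by rewrite mem_cat !inE eqxx !orbT.
have nAb : ~~ attach b.
  apply/negP => Ab; have h' := hole_rev e_sym h; have E' := ear_rev (ear_rev_base E).
  apply: (ear_far (w1 := b) (w2 := l) (P := rev (b :: W ++ cr :: R)) (P' := [:: w1]) h' E'
    (R := rev L) (J := rev m)) => //.
  - by rewrite es -cat_rcons -cat_rcons rev_cat 2!rev_rcons -cat1s.
  - have := ipath_sorted (ipath_rev e_sym (ear_ipath E)).
    by rewrite rev_cons rev_rcons => /= /path_sorted.
  - by move=> z; apply: mem_tail.
  - by rewrite (negPf (ear_uniq_l E')).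
  - by rewrite mem_rev mem_head.
  - by rewrite mem_rcons mem_head.
have sJ v : v \in b :: W ++ cr :: R -> v \in s.
  by move=> vJ; rewrite es -cat_rcons -cat_rcons mem_cat vJ orbT.
have w1s : w1 \in s by rewrite es -cat_rcons mem_cat !inE eqxx !orbT.
have cls : cl \in s by rewrite es mem_cat mem_head !orbT.
have crs : cr \in s by rewrite sJ // -cat_cons mem_cat mem_head orbT.
have [clL clR] : cl \notin L /\ cl \notin w1 :: b :: W ++ cr :: R.
  by apply: uniq_mid; rewrite -es.
have [w1L w1R] : w1 \notin rcons L cl /\ w1 \notin b :: W ++ cr :: R.
  by apply: uniq_mid; rewrite cat_rcons -es.
have w1b v : v \in b :: W ++ cr :: R -> e w1 v -> v = b.
  move=> vJ w1v; have := @ipath_link _ e (rcons (rcons L cl) w1) (b :: W ++ cr :: R) w1 v.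
  by rewrite !cat_rcons -es => /(_ ip _ vJ w1v) [|_ //]; rewrite mem_rcons mem_head.
have [w1cl ew1b] : e w1 cl /\ e w1 b.
  have := ipath_sorted ip; rewrite es => /cat_sorted2 [_ /= /and3P [H1 H2 _]].
  by rewrite e_sym.
have nAJ v : v \in b :: rcons W cr -> ~~ attach v.
  move=> vJ; have vR : v \in b :: W ++ cr :: R.
    by rewrite -cat_rcons -cat_cons mem_cat vJ.
  apply/negP => Av; have := attach_clique h w1s (sJ _ vR) A1 Av.
  move=> /(_ _) H; have /H /(w1b _ vR) vb : w1 != v by apply: contraNneq w1R => ->.
  by rewrite -vb Av in nAb.
(* From [b] along the hole to [cr] and back along the ear to [l]; the way on to [w1] leads through
   [Z]. *)
pose t := b :: W ++ cr :: rev (l :: rcons m r).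
pose U := [pred v | (v \in t) || Z v].
have st : sorted e t.
  rewrite /t -cat_rcons -cat_cons -rcons_cons rev_cons rev_rcons.
  apply: sorted_join.
  - have := ipath_sorted ip; rewrite es -cat_rcons -cat_rcons => /cat_sorted2 [_].
    by rewrite -cat_rcons -cat_cons => /cat_sorted2 [].
  - by have := ipath_sorted (ipath_rev e_sym (ear_ipath E)); rewrite rev_cons rev_rcons.
  - exact: ear_r E.
have tU : {subset t <= U} by move=> v vt; rewrite inE vt.
have ZU v : Z v -> U v by move=> Zv; rewrite /= Zv orbT.
have tE v : v \in t -> v \in b :: rcons W cr \/ v \in l :: rcons m r.
  by rewrite /t -cat_rcons -cat_cons mem_cat mem_rev => /orP.
have IU v : v \in l :: rcons m r -> v \in t.
  by rewrite /t -cat_rcons -cat_cons mem_cat mem_rev orbC => ->.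
have JR v : v \in b :: rcons W cr -> v \in b :: W ++ cr :: R.
  by rewrite -cat_rcons -cat_cons mem_cat => ->.
have tZ v : v \in t -> ~~ Z v.
  by case/tE => [/JR /sJ /(Z_hole h)|/(ear_Z E)].
have nt c : c \in s -> c \notin b :: W ++ cr :: R -> ~~ U c.
  move=> cs cR; rewrite /U /= negb_or (Z_hole h cs) andbT.
  apply/negP => /tE [/JR|]; first by apply/negP.
  by move/(ear_out E); rewrite mem_tail.
have nUw1 := nt _ w1s w1R.
have nUcl : ~~ U cl by apply: nt => //; apply: contra clR => H; rewrite inE H orbT.
case/existsP: A1 => z1 /andP [Zz1 wz1]; case/existsP: (Al) => z2 /andP [Zz2 lz2].
have cn : connect (restr e U) b z1.
  apply: (connect_trans (y := l)).
    by apply: (connect_sorted e_sym st tU); [rewrite mem_head | apply: IU; rewrite mem_head].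
  apply: (connect_trans (y := z2)); last by apply: connect_restr (Z_linked Zz2 Zz1).
  by apply: connect1; rewrite /restr lz2 (ZU _ Zz2) (tU l (IU _ (mem_head _ _)) : U l).
have [|||||x [s' [h' sU /eqP xb /andP [Zl _]]]] := @hole_through _ e w1 U
   (pred1 b) [pred v | Z v && e w1 v] b z1 nUw1 _ _ _ _ _ cn.
- move=> v /orP [] /= vU.
    rewrite (negPf (tZ _ vU)) /= orbF; apply/idP/eqP => [w1v|->]; last exact: ew1b.
    case/tE: vU => vU; first exact: w1b (JR _ vU) w1v.
    have [[_ ec]|[_ ec]] := ear_touch E (mem_tail y w1s) vU w1v.
      by rewrite ec e_irr in w1cl.
    by move: w1R; rewrite ec -cat_cons mem_cat mem_head orbT.
  by rewrite vU /=; case: (v =P b) vU => // -> Zb; have := tZ b; rewrite mem_head Zb => /(_ isT).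
- by move=> v /eqP ->; rewrite /= negb_and tZ ?mem_head.
- exact: eqxx.
- by rewrite /= Zz1.
- by apply: tU; rewrite mem_head.
(* [J] is the walk without its last vertex [l]. None of its vertices is attached, so the new hole
   reaches [Z] only over [l], and [cl] sees both [w1] and [l] on it. *)
subst x; pose J := [pred v | (v \in b :: rcons W cr) || (v \in rcons m r)].
have Jt v : J v -> v \in t.
  case/orP => [vJ|vI]; last by apply: IU; apply: mem_tail.
  by rewrite /t -cat_rcons -cat_cons mem_cat vJ.
have [||u [v [us' vs' uJ vJ euv]]] := exit_sorted (X := J) (ipath_sorted (hole_ipath h')).
- by rewrite /= mem_head.
- by apply: contraL Zl => /Jt /tZ.
have : v \in U := sU _ vs'; rewrite inE => /orP [vt|Zv]; last first.
  have : attach u by apply/existsP; exists v; rewrite Zv.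
  by case/orP: uJ => [/nAJ|/nAr] /negPf ->.
have vl : v = l.
  apply: contraNeq vJ => nvl /=; case/tE: vt => [-> //|].
  by rewrite inE (negPf nvl) /= => ->; rewrite orbT.
subst v; apply: (noprop h' (c := cl) (u := w1) (v := l)) => //.
- rewrite inE negb_or; apply/andP; split; last by apply: contra nUcl => /sU.
  by apply: contraTneq w1cl => ->; rewrite e_irr.
- exact: mem_head.
- exact: mem_tail.
- by apply: contraNneq nUw1 => ->; apply: tU.
- by rewrite e_sym.
- exact: ear_l E.
Qed.

(** The arc ending at [w1] and the ear without [l] are far apart, because [Wb] lies between [w1] and
    [cr]. The attachment [l] itself is left to [ear_corner], which needs [w1] next to [cl]. *)
Lemma ear_mid_half s l m r cl cr L Wa w1 Wb R w2 :
  hole e y s -> ear s l m r cl cr -> s = L ++ cl :: Wa ++ w1 :: Wb ++ cr :: R ->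
  Wb != [::] -> (w2 != l) || (Wa == [::]) ->
  attach w1 -> w2 \in l :: rcons m r -> attach w2 -> False.
Proof.
move=> h E es nWb; case: (eqVneq w2 l) => [-> /= /eqP eWa|n2l _] A1 w2I A2.
  by case: Wb es nWb => // b W es _; subst Wa; apply: (ear_corner h E es).
apply: (ear_far (w1 := w1) (w2 := w2) (P := rcons (L ++ cl :: Wa) w1) (P' := Wb)
  (J := m) (R := R) h E) => //.
- by rewrite es cat_rcons -catA.
- by have := ipath_sorted (ear_ipath E) => /= /path_sorted.
- by move=> z; apply: mem_tail.
- by rewrite (negPf (ear_uniq_l E)).
- by rewrite mem_rcons mem_head.
- by move: w2I; rewrite inE (negPf n2l).
Qed.

Lemma rev_nil (s : seq T) : (rev s == [::]) = (s == [::]).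
Proof. by rewrite -!size_eq0 size_rev. Qed.

Lemma ear_mid s l m r cl cr L W R w1 w2 :
  hole e y s -> ear s l m r cl cr -> s = L ++ cl :: W ++ cr :: R ->
  w1 \in W -> attach w1 -> w2 \in l :: rcons m r -> attach w2 -> False.
Proof.
move=> h E es /split_mem [Wa [Wb eW]] A1 w2I A2.
have {}es : s = L ++ cl :: Wa ++ w1 :: Wb ++ cr :: R by rewrite es eW -catA.
have es' : rev s = rev R ++ cr :: rev Wb ++ w1 :: rev Wa ++ cl :: rev L.
  by rewrite es !(rev_cat, rev_cons) -!cats1 -!catA.
have w2I' : w2 \in r :: rcons (rev m) l.
  by have := w2I; rewrite !(inE, mem_rcons, mem_rev) orbCA.
case: (boolP ((Wb != [::]) && ((w2 != l) || (Wa == [::])))) => [/andP [H1 H2]|N1].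
  exact: (ear_mid_half h E es H1 H2).
case: (boolP ((Wa != [::]) && ((w2 != r) || (Wb == [::])))) => [/andP [H1 H2]|N2].
  apply: (ear_mid_half (hole_rev e_sym h) (ear_rev (ear_rev_base E)) es' (w2 := w2)) => //.
    by rewrite rev_nil.
  by rewrite rev_nil.
(* Neither direction applies: either [w1] lies directly between [cl] and [cr], or [w2] would equal
   both [l] and [r]. *)
have lr := ear_neq E.
case: (eqVneq Wb [::]) N1 N2 => [eb _|nb] /=.
  rewrite orbT andbT negbK => /eqP ea; subst Wa Wb.
  exact: (ear_triangle h E es).
rewrite negb_or negbK => /andP [/eqP -> na]; rewrite na lr; by [].
Qed.

Lemma ear_order s l m r cl cr L W R w1 w2 :
  hole e y s -> ear s l m r cl cr -> s = L ++ cl :: W ++ cr :: R -> ~~ e cl cr ->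
  w1 \in s -> attach w1 -> w2 \in l :: rcons m r -> attach w2 -> ~~ e w1 w2 -> False.
Proof.
move=> h E es nclcr w1s A1 w2I A2 n12.
have nW : W != [::].
  apply: contraNneq nclcr => W0; have := ipath_sorted (hole_ipath h).
  by rewrite es W0 => /cat_sorted2 [_ /= /andP []].
have es' : rev s = rev R ++ cr :: rev W ++ cl :: rev L.
  by rewrite es rev_cat rev_cons rev_cat rev_cons cat_rcons -!catA cat_rcons.
have w2I' : w2 \in r :: rcons (rev m) l.
  have := w2I; by rewrite !(inE, mem_rcons, mem_rev) orbCA.
have := w1s; rewrite es -cat_rcons !mem_cat => /or3P [w1L|w1W|w1R].
- exact: (ear_left h E es nW w1L A1 w2I A2).
- exact: (ear_mid h E es w1W A1 w2I A2).
- apply: (ear_left (hole_rev e_sym h) (ear_rev (ear_rev_base E)) es' _ _ A1 w2I' A2) => //.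
    by rewrite rev_nil.
  by rewrite mem_rcons inE mem_rev.
Qed.

Lemma ear_root s l m r cr w1 w2 :
  hole e y s -> ear s l m r y cr -> cr \in s -> ~~ e y cr ->
  w1 \in s -> attach w1 -> w2 \in l :: rcons m r -> attach w2 -> ~~ e w1 w2 -> False.
Proof.
move=> h E /split_mem [W [R es]] nycr w1s A1 w2I A2 n12.
have nW : W != [::].
  by apply: contraNneq nycr => W0; have := hole_head h; rewrite es W0.
have nR : R != [::].
  by apply: contraNneq nycr => R0; have := hole_last h; rewrite es R0 last_cat.
have es' : rev s = rev R ++ cr :: rev W by rewrite es rev_cat rev_cons cat_rcons.
have := w1s; rewrite es -cat_rcons mem_cat => /orP [w1W|w1R].
  exact: (ear_at_root h E _ es nR nW w1W A1 w2I A2).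
apply: (ear_at_root (hole_rev e_sym h) (ear_rev_base E) _ es' _ _ (w1 := w1) (w2 := w2)) => //.
- by rewrite rev_nil.
- by rewrite rev_nil.
- by rewrite mem_rcons inE mem_rev w1R orbT.
Qed.

(** Reading the hole or the ear backwards leaves two configurations: [cl] is the root, or [cl]
    precedes [cr] on [s]. *)
Lemma ear_false s l m r cl cr w1 w2 :
  hole e y s -> ear s l m r cl cr -> cl \in y :: s -> cr \in y :: s ->
  cl != cr -> ~~ e cl cr ->
  w1 \in s -> attach w1 -> w2 \in l :: rcons m r -> attach w2 -> ~~ e w1 w2 -> False.
Proof.
move=> h E cls crs clcr nclcr w1s A1 w2I A2 n12.
have w2I' : w2 \in r :: rcons (rev m) l.
  have := w2I; by rewrite !(inE, mem_rcons, mem_rev) orbCA.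
move: cls; rewrite inE => /orP [/eqP cly|cls].
  subst cl; move: crs; rewrite inE eq_sym (negPf clcr) /= => crs.
  exact: (ear_root h E crs nclcr w1s A1 w2I A2).
move: crs; rewrite inE => /orP [/eqP cry|crs].
  by subst cr; apply: (ear_root h (ear_rev E) cls _ w1s A1 w2I' A2); rewrite // e_sym.
case: (split_mem cls) => L [R es]; move: crs.
rewrite es mem_cat inE eq_sym (negPf clcr) /= => /orP [] /split_mem [W1 [W2 e']].
  apply: (ear_order h (ear_rev E) (L := W1) (W := W2) (R := R) _ _ w1s A1 w2I' A2) => //.
    by rewrite es e' -catA.
  by rewrite e_sym.
apply: (ear_order h E (L := L) (W := W1) (R := W2) _ _ w1s A1 w2I A2) => //.
by rewrite es e'.
Qed.

Lemma attach_y : ~~ attach y.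
Proof. by apply/existsP => -[z /andP [Zz]]; rewrite (negPf (Z_y Zz)). Qed.

(** * An ear cut out of a second hole *)

Section TwoHoles.
Variables (s1 s2 : seq T) (w1 w2 : T).
Hypotheses (h1 : hole e y s1) (h2 : hole e y s2) (w1s : w1 \in s1) (w2s : w2 \in s2)
  (A1 : attach w1) (A2 : attach w2) (w12 : w1 != w2) (n12 : ~~ e w1 w2).

Lemma w2_out : w2 \notin y :: s1.
Proof.
rewrite inE negb_or; apply/andP; split; first by apply: contraTneq A2 => ->; apply: attach_y.
by apply: contraNN n12 => w2s1; apply: attach_clique w1s w2s1 A1 A2 w12.
Qed.

Lemma w1_out : w1 \notin s2.
Proof. by apply: contraNN n12 => w1s2; apply: attach_clique w1s2 w2s A1 A2 w12. Qed.

Definition touch v := has (e v) (y :: s1).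

Definition segment sa l m r sb :=
  [/\ s2 = sa ++ (l :: rcons m r) ++ sb, w2 \in l :: rcons m r,
     {in l :: rcons m r, forall v, v \notin y :: s1}, touch l & touch r].

(** Cutting at an inner vertex that touches the first hole and keeping a half with [w2] shortens the
    segment. *)
Lemma segment_shrink sa l m r sb : segment sa l m r sb ->
  exists sa l m r sb, segment sa l m r sb /\ ~~ has touch m.
Proof.
have [n] := ubnP (size m); elim: n => // n IH in sa l m r sb *; rewrite ltnS => mn S.
case: (boolP (has touch m)) => [/hasP [t tm tt]|nt]; last by exists sa, l, m, r, sb.
case: S => es w2I out tl tr; case: (split_mem tm) => m1 [m2 em].
have eI : l :: rcons m r = (l :: m1) ++ t :: rcons m2 r by rewrite em rcons_cat.
have eI' : l :: rcons m r = (l :: rcons m1 t) ++ rcons m2 r by rewrite eI /= cat_rcons.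
have szm : size m = size m1 + (size m2).+1 by rewrite em size_cat.
have [w2l|w2r] : w2 \in l :: rcons m1 t \/ w2 \in t :: rcons m2 r.
  move: w2I; rewrite eI' mem_cat => /orP [|H]; first by left.
  by right; apply: mem_tail.
- apply: (IH sa l m1 t (rcons m2 r ++ sb)).
    by apply: leq_trans mn; rewrite szm -addSnnS leq_addr.
  split=> //; first by rewrite es eI' -!catA.
  by move=> v vI; apply: out; rewrite eI' mem_cat vI.
- apply: (IH (sa ++ l :: m1) t m2 r sb).
    by apply: leq_trans mn; rewrite szm leq_addl.
  split=> //; first by rewrite es eI -!catA.
  by move=> v vI; apply: out; rewrite eI mem_cat vI orbT.
Qed.

(** The second hole is followed from [w2] both ways up to the first hole, which is met at [y] at the
    latest. What lies between the two hits has at least two vertices, since [w2] alone would be the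
    center of a propeller. *)
Lemma segment_exists : exists sa l m r sb, segment sa l m r sb.
Proof.
have [p [q es]] := split_mem w2s.
have [|p1 [c [p2 [ep cC np2]]]] := @split_last _ (mem (y :: s1)) (y :: p).
  by rewrite /= mem_head.
have [|q1 [c' [q2 [eq c'C nq1]]]] := @split_first _ (mem (y :: s1)) (rcons q y).
  by apply/hasP; exists y; rewrite ?mem_rcons //= mem_head.
have sp : sorted e (y :: rcons p w2).
  have := hole_sorted h2; rewrite es -cat_rcons -cat_cons => /cat_sorted2 [] //.
have sq : sorted e (w2 :: rcons q y).
  by have := hole_sorted_rcons e_sym h2; rewrite es rcons_cat => /cat_sorted2 [].
have {}sp : sorted e (c :: rcons p2 w2).
  by move: sp; rewrite -[y :: _]rcons_cons ep rcons_cat => /cat_sorted2 [].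
have {}sq : sorted e (rcons (w2 :: q1) c').
  by move: sq; rewrite eq -cat_rcons -[w2 :: _ ++ _]cat_cons => /cat_sorted2 [].
have [sa ea] : exists sa, p = sa ++ p2.
  case: (p1) ep => [|y' p1'] [_ ->]; first by exists [::].
  by exists (rcons p1' c); rewrite cat_rcons.
have [sb eb] : exists sb, q = q1 ++ sb.
  case/lastP: (q2) eq => [|q2' y'].
    by rewrite cats1 => /rcons_inj [-> _]; exists [::]; rewrite cats0.
  by rewrite -rcons_cons -rcons_cat => /rcons_inj [-> _]; exists (c' :: q2').
have out v : v \in p2 ++ w2 :: q1 -> v \notin y :: s1.
  rewrite mem_cat inE => /or3P [vp|/eqP ->|vq]; last by move/hasPn: nq1 => /(_ _ vq).
    by move/hasPn: np2 => /(_ _ vp).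
  exact: w2_out.
have ccT v u : u \in y :: s1 -> e v u -> touch v by move=> us euv; apply/hasP; exists u.
have main l m r : p2 ++ w2 :: q1 = l :: rcons m r -> e l c -> e r c' ->
    exists sa l m r sb, segment sa l m r sb.
  move=> eI elc erc; exists sa, l, m, r, sb; split; rewrite -?eI //.
  - by rewrite es ea eb -!catA.
  - by rewrite mem_cat mem_head orbT.
  - exact: ccT elc.
  - exact: ccT erc.
case: p2 => [|l p2] in ep np2 sp ea out main *.
  move: sp => /= /andP [cw2 _]; case/lastP: q1 => [|q1 r] in eq nq1 sq eb out main *.
    move: sq => /= /andP [w2c' _]; exfalso.
    apply: (noprop h1 w2_out cC c'C) => //; last by rewrite e_sym.
    (* Here [c] and [c'] are the two neighbors of [w2] on its own hole, which has at least three
       vertices, so they differ. *)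
    have := hole_size h2; have := ipath_uniq (hole_ipath h2); have := hole_root h2.
    have -> : c = last y p by have := congr1 (last y) ep; rewrite last_cat.
    have -> : c' = head y (rcons q y) by rewrite eq.
    rewrite es mem_cat inE !negb_or => /and3P [yp _ yq] us sz.
    case: (q) yq us sz => [|a q'] /=.
      case/lastP: (p) yp => // p' x; rewrite last_rcons mem_rcons inE negb_or eq_sym.
      by case/andP.
    rewrite inE negb_or => /andP [ya _]; case/lastP: (p) => [|p' x] /=; first by rewrite ya.
    rewrite last_rcons cat_rcons => /uniq_mid [_]; rewrite !inE !negb_or.
    by case/and3P.
  move: sq; rewrite /= !rcons_path last_rcons => /andP [_ rc'].
  by apply: (main w2 q1 r) => //; rewrite e_sym.
move: sp => /= /andP [cl _].
case/lastP: q1 => [|q1 r] in eq nq1 sq eb out main *.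
  move: sq => /= /andP [w2c' _]; apply: (main l p2 w2) => //; last by rewrite e_sym.
  by rewrite cats1.
move: sq; rewrite /= !rcons_path last_rcons => /andP [_ rc'].
by apply: (main l (p2 ++ w2 :: q1) r) => //; rewrite 1?e_sym // rcons_cat.
Qed.

Lemma segment_ear : exists sa l m r sb cl cr,
  [/\ s2 = sa ++ (l :: rcons m r) ++ sb, w2 \in l :: rcons m r, ear s1 l m r cl cr,
      cl \in y :: s1 & cr \in y :: s1].
Proof.
have [sa [l [m [r [sb]]]]] := segment_exists.
move/segment_shrink => [sa' [l' [m' [r' [sb' [[es w2I out]]]]]]].
case/hasP => cl cls ecl /hasP [cr crs ecr] nt.
exists sa', l', m', r', sb', cl, cr; split=> //; split=> //.
- by have := hole_ipath h2; rewrite es => /ipath_cat [_ /ipath_cat []].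
- by move=> v vI; apply: (Z_hole h2); rewrite es !mem_cat vI orbT.
- by rewrite e_sym.
- by rewrite e_sym.
(* No vertex outside the first hole has two neighbors on it, so the feet are unique. *)
have un c c' v : v \in l' :: rcons m' r' -> c \in y :: s1 -> c' \in y :: s1 ->
    e v c -> e v c' -> c = c'.
  move=> vI cs cs' ec ec'; apply/eqP/negPn/negP => ncc.
  exact: (noprop h1 (out _ vI) cs cs' ncc).
move=> u v us vI; rewrite e_sym => evu.
have rI : r' \in l' :: rcons m' r' by rewrite -rcons_cons mem_rcons mem_head.
move: (vI); rewrite inE mem_rcons inE => /or3P [/eqP ev|/eqP ev|vm].
- by left; subst v; split=> //; apply: un evu ecl => //; rewrite mem_head.
- by right; subst v; split=> //; apply: un evu ecr.
- by move/hasPn: nt => /(_ v vm); case/negP; apply/hasP; exists u.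
Qed.

(** An arc avoiding both feet has no edge to the ear, and each of the two contains a neighbor of [y]
    and an attachment. *)
Lemma ear_apart s l m r cl cr t a :
  ear s l m r cl cr -> w2 \in l :: rcons m r -> sorted e t -> {subset t <= s} ->
  y \notin t -> a \in t -> e y a -> w1 \in t -> cl \notin t -> cr \notin t ->
  e y l -> False.
Proof.
move=> E w2I st ts yt at_ ya w1t clt crt yl.
apply: (@no_bypass t (l :: rcons m r) a l w1 w2) => //.
- exact: ipath_sorted (ear_ipath E).
- by apply: contraTN (mem_head y s) => /(ear_out E).
- exact: mem_head.
move=> u v ut vI; have us := mem_tail y (ts _ ut); split.
  by apply: contraNneq (ear_out E vI) => <-.
by apply/negP => /(ear_touch E us vI) [[_ ec]|[_ ec]]; subst; rewrite ut in clt crt.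
Qed.

(** As a neighbor of [y], the foot [cr] is the first or last vertex of [s1]. Removing it leaves a
    single arc, which still contains [w1] because [w1] is not on [s2]. *)
Lemma ear_apart_edge l m r cr : ear s1 l m r y cr -> w2 \in l :: rcons m r ->
  cr \in s1 -> cr \in s2 -> e y cr -> False.
Proof.
move=> E w2I crs crs2 ycr; have yl := ear_l E; have us := ipath_uniq (hole_ipath h1).
have w1cr : w1 != cr by apply: contraNneq w1_out => ->.
have ys := hole_root h1; have ss := ipath_sorted (hole_ipath h1).
have sz := hole_size h1; have hh := hole_head h1; have hl := hole_last h1.
have := holeE h1 crs; rewrite ycr => /esym /orP [/eqP ec|/eqP ec].
  case es1 : s1 crs sz => [|a [|b t]] //= _ _; move: ec; rewrite es1 /= => ec; subst a.
  apply: (@ear_apart s1 l m r y cr (b :: t) (last b t)) => //.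
  - by move: ss; rewrite es1 /= => /andP [].
  - by move=> v vt; rewrite es1; apply: mem_tail.
  - by apply: contra ys => H; rewrite es1 mem_tail.
  - exact: mem_last.
  - by move: hl; rewrite es1.
  - by move: w1s; rewrite es1 inE (negPf w1cr).
  - by apply: contra ys => H; rewrite es1 mem_tail.
  - by move: us; rewrite es1 /= => /andP [].
case/lastP es1 : s1 crs sz => [|t a] // _; move: ec; rewrite es1 last_rcons => ec; subst a.
case: t es1 => [|b t] //= es1 _.
have ts v : v \in b :: t -> v \in s1 by rewrite es1 -rcons_cons mem_rcons inE orbC => ->.
apply: (@ear_apart s1 l m r y cr (b :: t) b) => //.
- by move: ss; rewrite es1 -rcons_cons -cats1 => /cat_sorted2 [].
- by apply: contra ys => /ts.
- exact: mem_head.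
- by move: hh; rewrite es1.
- by move: w1s; rewrite es1 -rcons_cons mem_rcons inE (negPf w1cr).
- by apply: contra ys => /ts.
- by move: us; rewrite es1 -rcons_cons rcons_uniq => /andP [].
Qed.

End TwoHoles.

(** The center is [cl]: a hole through [l] and [cr] avoiding [cl] runs along the
    ear and returns through [y]. *)
Lemma ear_square s1 s2 sa l m r sb cl cr :
  hole e y s1 -> hole e y s2 -> ear s1 l m r cl cr ->
  s2 = sa ++ (l :: rcons m r) ++ sb -> cl \in s1 -> cr \in s1 -> cl \notin y :: s2 ->
  cr \notin y :: s2 -> e cl cr -> False.
Proof.
move=> h1 h2 E e2 cls crs clo cro clcr.
have nclcr : cr != cl by apply: contraTneq clcr => ->; rewrite e_irr.
wlog [P [Q [e1 crQ]]] : s1 h1 cls crs E / exists P Q, s1 = P ++ cl :: Q /\ cr \in Q.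
  move=> W; case: (split_mem cls) => P [Q e1]; have := crs.
  rewrite e1 mem_cat inE (negPf nclcr) /= => /orP [crP|crQ]; last first.
    by apply: (W s1) => //; exists P, Q.
  apply: (W (rev s1)); rewrite ?mem_rev //.
  - exact: hole_rev.
  - exact: ear_rev_base.
  - by exists (rev Q), (rev P); rewrite e1 rev_cat rev_cons cat_rcons mem_rev.
have ip := hole_ipath h1; have ip2 := hole_ipath h2; have us2 := ipath_uniq ip2.
have ys := hole_root h1.
have [Q' eQ] : exists Q', Q = cr :: Q'.
  have := @ipath_link _ e (rcons P cl) Q cl cr.
  rewrite cat_rcons -e1 => /(_ ip _ crQ clcr) [|_]; first by rewrite mem_rcons mem_head.
  by case: (Q) crQ => // a Q' _ /= ->; exists Q'.
subst Q; have [clP clQ] : cl \notin P /\ cl \notin cr :: Q'.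
  by apply: uniq_mid; rewrite -e1 (ipath_uniq ip).
have Qs v : v \in cr :: Q' -> v \in s1.
  by move=> vQ; rewrite e1 -cat_rcons mem_cat vQ orbT.
(* Backwards along the ear from the vertex before [r] to [l], along [sa] to [y], and backwards along
   the first hole to [cr]; the root [r] closes this walk. *)
pose t := rev (l :: m) ++ rev (y :: sa) ++ rev (cr :: Q').
have tE v : v \in t -> [\/ v \in l :: m, v = y, v \in sa | v \in cr :: Q'].
  rewrite /t !mem_cat !mem_rev [v \in y :: sa]inE => /or3P [H|/orP [/eqP H|H]|H].
  - by constructor 1.
  - by constructor 2.
  - by constructor 3.
  - by constructor 4.
have lmI v : v \in l :: m -> v \in l :: rcons m r.
  by rewrite -rcons_cons mem_rcons [in X in _ -> X]inE orbC => ->.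
have st : sorted e t.
  rewrite /t -rev_cat -rev_cat rev_sorted.
  have st' : sorted e ((cr :: Q') ++ (y :: sa) ++ l :: m).
    rewrite [cr :: Q']lastI; apply: sorted_join.
    - by rewrite -lastI; have := ipath_sorted ip; rewrite e1 -cat_rcons => /cat_sorted2 [].
    - have := hole_sorted h2.
      have -> : y :: s2 = ((y :: sa) ++ l :: m) ++ r :: sb by rewrite e2 -catA /= cat_rcons.
      by case/cat_sorted2.
    - by have := hole_last h1; rewrite e1 last_cat /= e_sym.
  by rewrite -catA; apply: sub_sorted st' => u v; rewrite /= e_sym.
have rI : r \in l :: rcons m r by rewrite -rcons_cons mem_rcons mem_head.
have ro := ear_out E rI; have lo := ear_out E (mem_head _ _).
have rsa v : v \in sa -> v \notin l :: rcons m r.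
  move=> vsa; apply/negP => vI; have := ipath_neq (v := v) (s1 := sa) (s2 := (l :: rcons m r) ++ sb) (e := e) (u := v).
  by rewrite -e2 eqxx mem_cat vI vsa => /(_ ip2 isT isT).
have saI u v : v \in sa -> u \in l :: rcons m r -> e u v -> u = l.
  move=> vsa uI; rewrite e_sym => evu.
  have := @ipath_link _ e sa ((l :: rcons m r) ++ sb) v u.
  by rewrite -e2 mem_cat uI => /(_ ip2 vsa isT evu) [].
have lr := ear_neq E.
have C1E u v : u \in l :: m -> v \in y :: s1 -> e u v -> u = l.
  move=> ul vs; rewrite e_sym => /(ear_touch E vs (lmI _ ul)) [[] //|[ur _]].
  by have := ear_uniq_r E; rewrite -ur ul.
have rC1 v : v \in y :: s1 -> e r v -> v = cr.
  by move=> vs; rewrite e_sym => /(ear_touch E vs rI) [[rl]|[] //]; rewrite rl eqxx in lr.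
have rt : r \notin t.
  apply/negP => /tE [rlm|ry|rs|rQ].
  - by have := ear_uniq_r E; rewrite rlm.
  - by move: ro; rewrite ry mem_head.
  - by have := rsa _ rs; rewrite rI.
  - by move: ro; rewrite inE (Qs _ rQ) orbT.
have cry : cr != y by apply: contraNneq cro => ->; rewrite mem_head.
have crI : cr \notin l :: rcons m r.
  by apply: contraL (mem_tail y crs) => /(ear_out E).
have hI : last l m \in l :: m by rewrite mem_last.
have ehr : e r (last l m).
  by have := ipath_sorted (ear_ipath E); rewrite /= rcons_path e_sym => /andP [].
have [|||||||x [s' [h' sU /andP [xlm _] /eqP el]]] := @hole_through _ e r (mem t)
   [pred v | (v \in l :: m) && e r v] (pred1 cr) (last l m) cr rt _ _ _ _ _
   (connect_sorted e_sym st (fun _ => id) _ _).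
- move=> v vt; apply/idP/orP => [erv|[/andP [] //|/eqP ->]]; last by rewrite e_sym (ear_r E).
  case/tE: vt => [vlm|vy|vs|vQ].
  + by left; rewrite /= vlm.
  + by subst v; have := rC1 y (mem_head _ _) erv => yc; rewrite yc eqxx in cry.
  + by have := saI _ _ vs rI erv => rl; rewrite rl eqxx in lr.
  + by right; apply/eqP; apply: rC1 => //; rewrite mem_tail ?Qs.
- by move=> v /andP [vlm _]; apply: contraNneq crI => <-; apply: lmI.
- by rewrite /= hI.
- exact: eqxx.
- by rewrite inE /t mem_cat mem_rev hI.
- by rewrite /t mem_cat mem_rev hI.
- by rewrite /t !mem_cat !mem_rev mem_head !orbT.
(* The hole through [r] can leave the rest of the ear only at [l], and it ends at [cr]: both are
   neighbors of [cl]. *)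
have [|u [v [us' vs' ulm vlm euv]]] :=
    exit_sorted (X := mem (l :: m)) (ipath_sorted (hole_ipath h')) xlm.
  by rewrite el; apply: contra crI => /lmI.
have ul : u = l.
  have /tE [vl|vy|vs|vQ] := sU _ vs'.
  - by case/negP: vlm.
  - by apply: C1E euv; rewrite ?vy ?mem_head.
  - exact: saI vs (lmI _ ulm) euv.
  - by apply: C1E euv; rewrite // mem_tail ?Qs.
subst u; apply: (noprop h' (c := cl) (u := l) (v := cr)) => //.
- rewrite inE negb_or; apply/andP; split.
    by apply: contraNneq ro => <-; rewrite mem_tail.
  apply/negP => /sU /tE [clm|cly|clsa|clQ'].
  + by have := ear_out E (lmI _ clm); rewrite mem_tail.
  + by move: clo; rewrite cly mem_head.
  + by move: clo; rewrite e2 inE mem_cat clsa orbT.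
  + by rewrite clQ' in clQ.
- exact: mem_tail.
- by rewrite -el mem_tail ?mem_last.
- by apply: contraNneq crI => <-; rewrite mem_head.
- exact: ear_l E.
Qed.

(** The cases are the positions of the feet. A foot off the second hole is a center if it equals the
    other foot, or if it is adjacent to the other foot and that one lies on the second hole. Two
    adjacent feet off the second hole fall under [ear_square]. Feet on the second hole leave little
    room, as vertices of [sa] are not adjacent to [r], nor those of [sb] to [l]. *)
Lemma attach_two s1 s2 w1 w2 : hole e y s1 -> hole e y s2 -> w1 \in s1 -> w2 \in s2 ->
  attach w1 -> attach w2 -> w1 != w2 -> e w1 w2.
Proof.
move=> h1 h2 w1s w2s A1 A2 w12; apply/negPn/negP => n12.
have [sa [l [m [r [sb [cl [cr [e2 w2I E cls crs]]]]]]]] :=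
  segment_ear h1 h2 w1s w2s A1 A2 w12 n12.
have n21 : ~~ e w2 w1 by rewrite e_sym.
have w1o := w1_out h2 w2s A1 A2 w12 n12.
have lI : l \in l :: rcons m r by rewrite mem_head.
have rI : r \in l :: rcons m r by rewrite -rcons_cons mem_rcons mem_head.
have Is v : v \in l :: rcons m r -> v \in y :: s2.
  by move=> vI; rewrite mem_tail // e2 !mem_cat vI orbT.
have lr := ear_neq E; have ip2 := hole_ipath h2.
have nl c : c \in sb -> ~~ e c l.
  move=> csb; rewrite e_sym; apply/negP => elc.
  have := @ipath_link _ e (sa ++ l :: rcons m r) sb l c.
  rewrite -catA -e2 mem_cat lI orbT => /(_ ip2 isT csb elc) [ll _].
  by move: lr; rewrite ll last_cat /= last_rcons eqxx.
have nr c : c \in sa -> ~~ e c r.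
  move=> csa; apply/negP => ecr.
  have := @ipath_link _ e sa ((l :: rcons m r) ++ sb) c r.
  rewrite -e2 mem_cat rI => /(_ ip2 csa isT ecr) [_ rl].
  by move: lr; rewrite rl eqxx.
have s2E c : c \in y :: s1 -> c \in y :: s2 -> [\/ c = y, c \in sa | c \in sb].
  move=> c1; rewrite inE e2 !mem_cat => /orP [/eqP|/or3P [|cI|]].
  - by constructor 1.
  - by constructor 2.
  - by have := ear_out E cI; rewrite c1.
  - by constructor 3.
have lo := ear_out E lI; have ro := ear_out E rI.
have ecl := ear_l E; have ecr := ear_r E.
have [clcr|nclcr] := eqVneq cl cr.
  case: (boolP (cl \in y :: s2)) => [cl2|clo]; last first.
    by apply: (noprop h2 clo (Is _ lI) (Is _ rI) lr); rewrite // clcr.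
  case: (s2E _ cls cl2) => [cly|/nr|/nl]; rewrite -?clcr ?ecl //.
    subst cr; subst cl; have ys := hole_root h1.
    apply: (ear_apart (a := head y s1) A1 A2 E w2I (t := s1)) => //.
    - exact: ipath_sorted (hole_ipath h1).
    - by case: (s1) (hole_size h1) => //= a s _; rewrite mem_head.
    - exact: hole_head.
  by rewrite clcr ecr.
case: (boolP (e cl cr)) => [clcr|nadj]; last first.
  exact: (ear_false h1 E cls crs nclcr nadj w1s A1 w2I A2 n12).
have crcl : e cr cl by rewrite e_sym.
case: (boolP (cl \in y :: s2)) => cl2; case: (boolP (cr \in y :: s2)) => cr2.
- case: (s2E _ cls cl2) => [cly|clsa|/nl]; last by rewrite ecl.
    subst cl; case: (s2E _ crs cr2) => [cry|/nr|crsb]; rewrite ?ecr //.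
      by rewrite cry eqxx in nclcr.
    apply: (ear_apart_edge h1 h2 w1s w2s A1 A2 w12 n12 E w2I) => //.
      by move: crs; rewrite inE eq_sym (negPf nclcr).
    by rewrite e2 !mem_cat crsb !orbT.
  case: (s2E _ crs cr2) => [cry|/nr|crsb]; rewrite ?ecr //.
    subst cr; have w2I' : w2 \in r :: rcons (rev m) l.
      by have := w2I; rewrite !(inE, mem_rcons, mem_rev) orbCA.
    apply: (ear_apart_edge h1 h2 w1s w2s A1 A2 w12 n12 (ear_rev E) w2I') => //.
      by move: cls; rewrite inE (negPf nclcr).
    by rewrite e2 !mem_cat clsa.
  have := ipath_far (s1 := sa) (s2 := l :: rcons m r) (s3 := sb) (e := e) (u := cl) (v := cr).
  by rewrite -e2 clcr => /(_ ip2 isT clsa crsb).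
- apply: (noprop h2 cr2 cl2 (Is _ rI)) => //.
  by apply: contraNneq ro => <-.
- apply: (noprop h2 cl2 cr2 (Is _ lI)) => //.
  by apply: contraNneq lo => <-.
- apply: (ear_square h1 h2 E e2) => //.
    by move: cls cl2; rewrite !inE !negb_or => /orP [->|-> //].
  by move: crs cr2; rewrite !inE !negb_or => /orP [->|-> //].
Qed.

End Component.

(** * Three attachments are impossible *)

Lemma ipath_triangle s a b c : ipath e s -> a \in s -> b \in s -> c \in s ->
  e a b -> e b c -> e a c -> False.
Proof.
have aux x t u v : ipath e (x :: t) -> u \in t -> v \in t -> e x u -> e x v -> e u v -> False.
  move=> ip ut vt xu xv; have L w : w \in t -> e x w -> w = head w t.
    by move=> wt xw; case: (ipath_link (s1 := [:: x]) ip (mem_head _ _) wt xw).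
  rewrite (L u ut xu) (L v vt xv); case: (t) ut => // w t' _ /=.
  by rewrite e_irr.
elim: s => // x s IH ip; rewrite !inE.
have ips : ipath e s by case/and3P: ip.
move=> /orP [/eqP ->|as_] /orP [/eqP ->|bs] /orP [/eqP ->|cs]; rewrite ?e_irr // => ab bc ac.
- exact: (aux x s b c ip bs cs ab ac bc).
- by apply: (aux x s a c ip as_ cs _ bc ac); rewrite e_sym.
- by apply: (aux x s a b ip as_ bs _ _ ab); rewrite e_sym.
- exact: IH ips as_ bs cs ab bc ac.
Qed.

(** Neither [s1] nor [s2] contains a second vertex of the triangle, since the third would be a
    center. So the walk from [a] over [y] to a neighbor of [b] avoids [b] and [c], and yields a hole
    through [a] and [b] with center [c]. *)
Lemma triangle_holes y s1 s2 a b c : hole e y s1 -> hole e y s2 -> a \in s1 -> b \in s2 ->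
  (exists2 s3, hole e y s3 & c \in s3) -> e a b -> e b c -> e a c -> False.
Proof.
move=> h1 h2 as1 bs2 [s3 h3 cs3] ab bc ac.
have no2 u v w s : hole e y s -> u \in s -> w != y -> e u v -> e v w -> e u w -> v \notin s.
  move=> h us wy uv vw uw; apply/negP => vs; case: (boolP (w \in s)) => ws.
    exact: (ipath_triangle (hole_ipath h) us vs ws uv vw uw).
  apply: (noprop h (c := w) (u := u) (v := v)).
  - by rewrite inE negb_or wy.
  - exact: mem_tail.
  - exact: mem_tail.
  - by apply: contraTneq uv => ->; rewrite e_irr.
  - by rewrite e_sym.
  - by rewrite e_sym.
have ney v s : hole e y s -> v \in s -> v != y.
  by move=> h vs; apply: contraNneq (hole_root h) => <-.
have [ay by_ cy] := And3 (ney _ _ h1 as1) (ney _ _ h2 bs2) (ney _ _ h3 cs3).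
have cb : e c b by rewrite e_sym.
have ba : e b a by rewrite e_sym.
have b1 : b \notin s1 by apply: no2 h1 as1 cy ab bc ac.
have c1 : c \notin s1 by apply: no2 h1 as1 by_ ac cb ab.
have a2 : a \notin s2 by apply: no2 h2 bs2 cy ba ac bc.
have c2 : c \notin s2 by apply: (no2 b c a s2) => //; rewrite e_sym.
pose U := [pred v | (v != b) && (v != c)].
have [p [q e2]] := split_mem bs2.
have sp : sorted e (rcons (y :: p) b).
  by have := hole_sorted h2; rewrite e2 -cat_rcons -cat_cons => /cat_sorted2 [].
have pv : e b (last y p) by move: sp; rewrite /= rcons_path e_sym => /andP [].
have pU : {subset y :: p <= U}.
  move=> v; rewrite !inE => /orP [/eqP ->|vp]; first by rewrite eq_sym by_ eq_sym cy.
  have v2 : v \in s2 by rewrite e2 mem_cat vp.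
  have [bp _] : b \notin p /\ b \notin q.
    by apply: uniq_mid; rewrite -e2 (ipath_uniq (hole_ipath h2)).
  by apply/andP; split; [apply: contraNneq bp => <- | apply: contraNneq c2 => <-].
have sU : {subset y :: s1 <= U}.
  move=> v; rewrite !inE => /orP [/eqP ->|vp]; first by rewrite eq_sym by_ eq_sym cy.
  by apply/andP; split; [apply: contraNneq b1 => <- | apply: contraNneq c1 => <-].
have cn : connect (restr e U) a (last y p).
  apply: (connect_trans (y := y)).
    by apply: (connect_sorted e_sym (hole_sorted h1) sU); rewrite ?mem_head // mem_tail.
  apply: (connect_sorted e_sym (s := y :: p)); rewrite ?mem_head ?mem_last //.
  by move: sp; rewrite -cats1 => /cat_sorted2 [].
have Ul : U (last y p) := pU _ (mem_last _ _).
have nl : last y p != a.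
  have : last y p \in y :: p := mem_last _ _.
  rewrite inE => /orP [/eqP ->|lp]; first by rewrite eq_sym.
  by apply: contraNneq a2 => <-; rewrite e2 mem_cat lp.
have [||||||x [s' [h' sU' /eqP ea _]]] := @hole_through _ e b U (pred1 a)
   [pred v | e b v && (v != a)] a (last y p) _ _ _ _ _ _ cn.
- by rewrite /= eqxx.
- by move=> v vU; rewrite /=; case: (v =P a) => [->|]; rewrite ?ba ?andbT.
- by move=> v /eqP ->; rewrite /= eqxx andbF.
- exact: eqxx.
- by rewrite /= pv.
- by apply: sU; rewrite mem_tail.
subst x; apply: (noprop h' (c := c) (u := b) (v := a)) => //.
- rewrite inE negb_or; apply/andP; split; last first.
    by apply/negP => /sU'; rewrite inE eqxx andbF.
  by apply: contraTneq bc => ->; rewrite e_irr.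
- exact: mem_head.
- by rewrite mem_tail // mem_head.
- by apply: contraTneq ab => ->; rewrite e_irr.
- by rewrite e_sym.
Qed.

Lemma connect_in (X : pred T) a b : X a -> connect (restr e X) a b -> X b.
Proof.
move=> Xa /connectP [p pp ->]; elim: p a Xa pp => //= c p IH a _ /andP [/and3P [_ _ Xc]].
exact: IH.
Qed.

(** In the application [x0] is the center, isolated in [e], so the condition for [p = x0] says that
    [y] and [z] are connected at all. Other vertices are tested only if they lie on an edge, as the
    algorithm visits edges. Removing [x0], then the first attachment, then the first two produces
    three attachments. *)
Theorem common_hole y z x0 : y != z -> ~~ e y z -> x0 != y -> x0 != z ->
  (forall p, p != y -> p != z -> p = x0 \/ (exists q, e p q) ->
     connect (restr e (predC1 p)) y z) ->
  (forall p q, e p q -> p != y -> p != z -> q != y -> q != z ->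
     connect (restr e (predC (pred2 p q))) y z) ->
  exists2 s, hole e y s & z \in s.
Proof.
move=> yz nyz x0y x0z U1 U2.
(* A hole has at most as many vertices as the type, so sharing a hole with [y] is decidable. *)
pose B v := [exists n : 'I_#|T|.+1, [exists t : n.-tuple T, hole e y t && (v \in tval t)]].
have BP v : reflect (exists2 s, hole e y s & v \in s) (B v).
  apply: (iffP existsP) => [[n /existsP [t /andP [h vt]]]|[s h vs]]; first by exists t.
  have sz : size s < #|T|.+1.
    by rewrite ltnS -(card_uniqP (ipath_uniq (hole_ipath h))) max_card.
  by exists (Ordinal sz); apply/existsP; exists (in_tuple s); rewrite h.
case: (boolP (B z)) => [/BP //|nBz]; exfalso.
pose F v := (v != y) && ~~ B v.
pose Z v := connect (restr e F) z v.
have Fz : F z by apply/andP; split; rewrite // eq_sym.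
have Zz : Z z by apply: connect0.
have ZF v : Z v -> F v by apply: connect_in.
have ZS u v : Z u -> F v -> e u v -> Z v.
  move=> Zu Fv uv; apply: (connect_trans (y := u)) => //; apply: connect1.
  by rewrite /restr uv (ZF _ Zu).
have Z_path a p : Z a -> path (restr e F) a p -> connect (restr e Z) a (last a p).
  elim: p a => [|b p IH] a Za /=; first by rewrite connect0.
  case/andP => /and3P [ab _ Fb] pp; have Zb := ZS _ _ Za Fb ab.
  apply: (connect_trans (y := b)); last exact: IH.
  by apply: connect1; rewrite /restr ab Za.
have Z_z v : Z v -> connect (restr e Z) z v.
  by move=> /connectP [p pp ->]; apply: Z_path.
have Z_linked : linked_set e Z.
  move=> u v Zu Zv; apply: (connect_trans (y := z)); last exact: Z_z.
  by rewrite restr_sym // Z_z.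
(* If [v] were a neighbor of [y], a path from [y] to [z] avoiding [v], continued through [Z] to [v],
   would give a hole through [y] and [v]. *)
have Z_y v : Z v -> ~~ e y v.
  move=> Zv; apply/negP => yv.
  have vz : v != z by apply: contraNneq nyz => <-.
  have vy : v != y by case/andP: (ZF _ Zv).
  have [] := connectP (U1 v vy vz _); first by right; exists y; rewrite e_sym.
  move=> p0 pp0 ez; case/shortenP: pp0 ez => p pp up _ ez.
  case: p pp up ez => [|w p] /=; first by move=> _ _ ez; rewrite ez eqxx in yz.
  case/andP => /and3P [yw _ wv] pp /andP [yp _] ez.
  have [|||||||x [s [h _ /eqP ex _]]] := @hole_through _ e y (predC1 y) (pred1 v)
    [pred u | e y u && (u != v)] v w.
  - by rewrite /= eqxx.
  - by move=> u _; rewrite /=; case: (u =P v) => [->|]; rewrite ?yv ?andbT.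
  - by move=> u /eqP ->; rewrite /= eqxx andbF.
  - exact: eqxx.
  - by rewrite /= yw.
  - by [].
  - apply: (connect_trans (y := z)).
      apply: (connect_restr (X := Z)); last exact: Z_linked.
      by move=> u /ZF /andP [].
    apply: (connect_sorted e_sym (s := w :: p)); rewrite ?mem_head ?ez ?mem_last //.
      by move: pp => /=; apply: sub_path => a b /and3P [].
    by move=> u up; rewrite inE; apply: contraNneq yp => <-.
  have /andP [_ /BP []] := ZF _ Zv; exists (x :: s) => //.
  by rewrite ex mem_head.
have y_Z : ~~ Z y by apply/negP => /ZF; rewrite /F eqxx.
have Z_hole s v : hole e y s -> v \in s -> ~~ Z v.
  by move=> h vs; apply/negP => /ZF /andP [_ /BP []]; exists s.
have AB v : attach Z v -> ~~ Z v -> B v /\ v != y.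
  move=> Av nZv; have vy : v != y by apply: contraTneq Av => ->; apply: attach_y Z_y.
  split=> //; apply: contraNT nZv => nB; case/existsP: Av => u /andP [Zu vu].
  by apply: (ZS u); rewrite // ?/F ?vy // e_sym.
(* Any connection from [y] to [z] within [K] enters [Z] from an attachment, which therefore survives
   in [K]. *)
have sep K : connect (restr e K) y z -> exists v, [/\ K v, attach Z v, B v, v != y & v != z].
  move=> cn; have [||u [v [Ku _ nZu Zv uv]]] := exit_connect (X := predC Z) cn.
  - exact: y_Z.
  - by rewrite /= Zz.
  have Au : attach Z u by apply/existsP; exists v; rewrite -[Z v]negbK Zv.
  have [Bu uy] := AB u Au nZu; exists u; split=> //.
  by apply: contraNneq nZu => ->.
have two u v : attach Z u -> B u -> attach Z v -> B v -> u != v -> e u v.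
  move=> Au /BP [s1 h1 us1] Av /BP [s2 h2 vs2] uv.
  exact: (attach_two Z_linked Z_y y_Z Z_hole h1 h2 us1 vs2 Au Av uv).
have [a [_ Aa Ba ay az]] := sep _ (U1 x0 x0y x0z (or_introl erefl)).
have a_nb : exists q, e a q by case/existsP: Aa => q /andP [_]; exists q.
have [b [ba Ab Bb by_ bz]] := sep _ (U1 a ay az (or_intror a_nb)).
have ab : e a b by apply: two => //; rewrite eq_sym.
have [c [/norP [ca cb] Ac Bc cy cz]] := sep _ (U2 a b ab ay az by_ bz).
have [s1 h1 as1] := BP _ Ba; have [s2 h2 bs2] := BP _ Bb.
apply: (triangle_holes h1 h2 as1 bs2 (BP _ Bc) ab).
- by apply: two => //; rewrite eq_sym.
- by apply: two => //; rewrite eq_sym.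
Qed.

End NoPropeller.

(** * Separation criterion for propellers *)

Section Usable.
Variables (T : eqType) (x p q : T) (f : bool).
(** Over an [eqType], to serve both for vertices and for their numbers in the machine. *)
Definition alive v := (v != x) && (f || (v != p) && (v != q)).
Definition usable u v :=
  [&& alive u, alive v & ~~ (f && ((u == p) && (v == q) || (u == q) && (v == p)))].

Lemma usable_sym : symmetric usable.
Proof.
move=> u v; rewrite /usable andbCA; congr [&& _, _ & ~~ (f && _)].
by rewrite orbC andbC [in X in _ || X]andbC.
Qed.
End Usable.

Lemma ipath_nth (T : finType) (e : rel T) x0 s : uniq s -> sorted e s ->
  (forall i j, i < j < size s -> e (nth x0 s i) (nth x0 s j) -> j = i.+1) -> ipath e s.
Proof.
elim: s => // x s IH /= /andP [xs us] ps H; apply/and3P; split=> //.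
  case: s {IH} xs us ps H => //= y s _ _ /andP [-> _] H /=.
  apply/(all_nthP x0) => i si; apply/negP => ex.
  by have := H 0 i.+2 _ ex; rewrite /= !ltnS si => /(_ isT).
apply: IH => //; first exact: path_sorted ps.
by move=> i j ij eij; have := H i.+1 j.+1; rewrite /= !ltnS ij eij => /(_ isT isT) [].
Qed.

Lemma nth_ipath (T : finType) (e : rel T) x0 s i j : ipath e s -> i < j < size s ->
  e (nth x0 s i) (nth x0 s j) -> j = i.+1.
Proof.
elim: s i j => [|x s IH] i j //=; first by rewrite ltn0 andbF.
case/and3P => H1 _ ips; case: j => // j; case: i => [|i] /= ij; last first.
  by move/(IH i j ips _) => -> //.
case: s H1 ij {IH ips} => [|y s] //= /andP [_ H]; case: j => //= j; rewrite ltnS => js.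
by rewrite (negPf (all_nthP x0 H _ _)).
Qed.

(** * Chordless cycles as rooted holes *)

Section Graph.
Variable G : sgraph.
Implicit Types (x y z u v p q : G).
Let asym := @adj_sym G.
Let airr := @adj_irr G.

Lemma chordless_hole y (s : seq G) : chordless_cycle (y :: s) <-> hole (@adj G) y s.
Proof.
(* The default value [y] of [nth] makes this true for the last vertex of [s], whose successor on the
   cycle is the root. *)
have nxt i : uniq (y :: s) -> i < size s -> next (y :: s) (nth y s i) = nth y s i.+1.
  move=> us si; rewrite next_nth.
  have -> : nth y s i = nth y (y :: s) i.+1 by [].
  by rewrite mem_nth // index_uniq.
have nxt0 : next (y :: s) y = nth y s 0 by rewrite next_nth mem_head /= eqxx.
split=> [[sz us cyc chord]|h].
- have /andP [ys us'] : (y \notin s) && uniq s := us.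
  have ps : path (@adj G) y (rcons s y) := cyc.
  have nthy i : i < size s -> nth y s i <> y.
    by move=> si e; move: ys; rewrite -e mem_nth.
  apply/and4P; split=> //.
    apply: (ipath_nth (x0 := y)) => //.
      by move: ps; rewrite rcons_path => /andP [/path_sorted].
    move=> i j /andP [ij js] aij; have is_ := ltn_trans ij js.
    have ins k : k < size s -> nth y s k \in y :: s by move=> ?; rewrite mem_tail ?mem_nth.
    case: (chord _ _ (ins _ is_) (ins _ js) aij); rewrite nxt // => E.
      have si1 : i.+1 < size s by apply: leq_ltn_trans ij js.
      by apply/eqP; rewrite -(nth_uniq y js si1 us') E.
    case: (ltnP j.+1 (size s)) => sj; last by rewrite [RHS]nth_default // in E; case: (nthy i).
    by move/eqP: E; rewrite nth_uniq // => /eqP; lia.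
  apply/allP => v vs; apply/eqP; apply/idP/orP => [ayv|[]/eqP ->].
  + have vj : v = nth y s (index v s) by rewrite nth_index.
    have js : index v s < size s by rewrite index_mem.
    case: (chord y v (mem_head _ _) (mem_tail _ vs) ayv) => [->|].
      by left; rewrite nxt0 nth0.
    rewrite vj nxt // => E; right; case: (ltnP (index v s).+1 (size s)) => sj.
      by case: (nthy _ sj).
    have -> : last y s = nth y s (size s).-1 by rewrite nth_last.
    by have /eqP <- : (index v s).+1 == size s by rewrite eqn_leq js sj.
  + by case: (s) ps sz => //= a t /andP [].
  + by move: ps; rewrite rcons_path asym => /andP [].
have [ips ys sz us] := And4 (hole_ipath h) (hole_root h) (hole_size h) (ipath_uniq (hole_ipath h)).
have uys : uniq (y :: s) by rewrite /= ys us.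
split=> //.
- by have := hole_sorted h; rewrite /= rcons_path asym (hole_last h) => ->.
have Hy v : v \in s -> adj y v -> v = next (y :: s) y \/ y = next (y :: s) v.
  move=> vs; rewrite (holeE h vs) => /orP [/eqP vh|/eqP vl].
    by left; rewrite nxt0 nth0.
  right; rewrite vl -nth_last nxt //; last by rewrite ltn_predL ltnW.
  by rewrite nth_default ?leqSpred.
move=> u v; rewrite !inE => /orP [/eqP ->|us'] /orP [/eqP ->|vs].
- by rewrite airr.
- exact: Hy.
- by rewrite asym => /(Hy _ us') [H|H]; [right|left].
have [ui vi] : u = nth y s (index u s) /\ v = nth y s (index v s) by rewrite !nth_index.
have [us1 vs1] : index u s < size s /\ index v s < size s by rewrite !index_mem.
rewrite ui vi !nxt //; case: (ltngtP (index u s) (index v s)) => [lt|lt|->].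
- by move=> auv; left; rewrite -(nth_ipath ips _ auv) ?lt.
- by rewrite asym => auv; right; rewrite -(nth_ipath ips _ auv) ?lt.
- by rewrite airr.
Qed.

End Graph.

Lemma chordless_map (H G : sgraph) (f : H -> G) (c : seq H) : injective f ->
  (forall u v, adj (f u) (f v) = adj u v) ->
  chordless_cycle (map f c) <-> chordless_cycle c.
Proof.
move=> fi fa; rewrite /chordless_cycle size_map map_inj_uniq //.
have -> : cycle (@adj G) (map f c) = cycle (@adj H) c.
  by rewrite cycle_map; apply: eq_cycle => u v; rewrite /= fa.
split=> -[H1 H2 H3 H4]; split=> //.
- move=> u v uc vc auv; have := H4 (f u) (f v); rewrite !mem_map // fa !next_map // .
  by case/(_ uc vc auv) => /fi nx; [left|right].
- move=> _ _ /mapP [u uc ->] /mapP [v vc ->]; rewrite fa !next_map // => auv.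
  by case: (H4 u v uc vc auv) => nx; [left|right]; congr (f _).
Qed.

Lemma chordless_rot (G : sgraph) n (c : seq G) :
  chordless_cycle c -> chordless_cycle (rot n c).
Proof.
case=> H1 H2 H3 H4; split; rewrite ?size_rot ?rot_uniq ?rot_cycle //.
by move=> u v; rewrite !mem_rot !next_rot //; apply: H4.
Qed.

Section Propellers.
Variable G : sgraph.
Implicit Types (x y z u v p q : G) (s : seq G).
Let asym := @adj_sym G.
Let airr := @adj_irr G.

Lemma contains_of_hole y s x u v : hole (@adj G) y s -> x \notin y :: s ->
  u \in y :: s -> v \in y :: s -> u != v -> adj x u -> adj x v -> contains_propeller G.
Proof.
move=> h xs us vs uv xu xv; pose S := [set w in x :: y :: s]; exists S.
pose lift l : seq (induced S) := pmap insub l.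
have liftK l : {subset l <= x :: y :: s} -> map val (lift l) = l.
  move=> lS; rewrite /lift (pmap_filter (@insubK _ _ _)); apply/all_filterP.
  by apply/allP => w wl /=; rewrite insubT // inE lS.
have xS : x \in S by rewrite inE mem_head.
have ysS : {subset y :: s <= x :: y :: s} by move=> w ws; apply: mem_tail.
have mv (w : induced S) l : {subset l <= x :: y :: s} -> (w \in lift l) = (val w \in l).
  by move=> lS; rewrite -[in RHS](liftK l lS) (mem_map val_inj).
exists (lift (y :: s)), (Sub x xS : induced S); split.
- apply/(@chordless_map (induced S) G val) => //; first exact: val_inj.
  by rewrite liftK //; apply/chordless_hole.
- by rewrite mv.
- have -> : count (adj (Sub x xS : induced S)) (lift (y :: s)) = count (adj x) (y :: s).
    by rewrite -[in RHS](liftK (y :: s) ysS) count_map; apply: eq_count.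
  have uys : uniq (y :: s) by case/chordless_hole: h.
  rewrite -size_filter; have sub2 : {subset [:: u; v] <= filter (adj x) (y :: s)}.
    by move=> w; rewrite !inE => /orP [] /eqP ->; rewrite mem_filter ?xu ?xv.
  by apply: (uniq_leq_size _ sub2); rewrite /= inE uv.
- move=> w; have := valP w; rewrite inE [_ \in x :: _]inE => /orP [/eqP wx|ws].
    by left; apply: val_inj.
  by right; rewrite mv.
Qed.

Lemma hole_of_contains : contains_propeller G -> exists x y s z,
  [/\ hole (@adj G) y s, x \notin y :: s, z \in s, adj x y & adj x z].
Proof.
case=> S [c [x [cc xc cnt _]]].
have uc : uniq c by case: cc.
have : uniq (filter (adj x) c) by rewrite filter_uniq.
move: cnt; rewrite -size_filter.
case E : (filter (adj x) c) => [|y [|z t]] //= _; rewrite inE negb_or => /andP [/andP [yz _] _].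
have : y \in filter (adj x) c by rewrite E mem_head.
rewrite mem_filter => /andP [xy yc].
have : z \in filter (adj x) c by rewrite E !inE eqxx orbT.
rewrite mem_filter => /andP [xz zc].
(* The rim is rotated so that a neighbor of the center becomes the root. *)
have [i s es] := rot_to yc.
have : chordless_cycle (map val (y :: s)).
  apply/(@chordless_map (induced S) G val) => //; first exact: val_inj.
  by rewrite -es; apply: chordless_rot.
move/chordless_hole => h; exists (val x), (val y), (map val s), (val z); split=> //.
- by rewrite -[_ :: _]/(map val (y :: s)) (mem_map val_inj) -es mem_rot.
- rewrite (mem_map val_inj); have : z \in rot i c by rewrite mem_rot.
  by rewrite es inE eq_sym (negPf yz).
Qed.

(** With [f] the edge [pq] is removed and with [~~ f] the vertices [p] and [q];
    [p = q] stands for removing one vertex. *)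
Definition config p q (f : bool) :=
  adj p q \/ [/\ f = false, p = q & exists r, adj p r].

Definition cut_rel x p q f : rel G := [rel u v | adj u v && usable x p q f u v].

Lemma cut_sym x p q f : connect_sym (cut_rel x p q f).
Proof. by apply: sym_connect_sym => u v; rewrite /cut_rel /= asym usable_sym. Qed.

Definition unseparated x y z := forall p q f, config p q f ->
  alive x p q f y -> alive x p q f z -> connect (cut_rel x p q f) y z.

Lemma path_cut x p q f (P : pred G) y s :
  (forall u v, P u -> P v -> adj u v -> usable x p q f u v) ->
  path (@adj G) y s -> all P (y :: s) -> connect (cut_rel x p q f) y (last y s).
Proof.
move=> H ps al; apply/connectP; exists s => //.
elim: s y ps al => //= z s IH y /andP [yz ps] /and3P [Py Pz al].
by rewrite {1}/cut_rel /= yz H //= IH //= Pz.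
Qed.

(** [y] and [z] cut the rim into two arcs. Vertices inside different arcs are distinct and
    non-adjacent, so removing a vertex or both ends of an edge spares an arc. A removed edge is
    bypassed on an arc avoiding one of its ends, unless it is [yz] itself. *)
Lemma hole_unseparated x y s z : hole (@adj G) y s -> x \notin y :: s -> z \in s ->
  unseparated x y z.
Proof.
move=> h xs zs p q f cf ay az.
(* Needed for the edge [yz] only: one arc is then that edge, and the way around starts from [z] over
   [b]. *)
wlog pick : s h xs zs / (f -> [\/ p = y /\ q = z | p = z /\ q = y] ->
    exists b t, s = z :: b :: t).
  move=> W; have [p1 [p2 es]] := split_mem zs; case: p1 es => [|a p1] es.
    by apply: (W s) => // _ _; case: p2 es => [|b t] es;
      [have := hole_size h; rewrite es | exists b, t].
  case: (boolP (adj y z)) => ayz; last first.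
    apply: (W s) => // ef [[py qz]|[pz qy]]; case: cf => [apq|[f0]]; try by rewrite f0 in ef.
      by rewrite -py -qz apq in ayz.
    by rewrite -pz -qy asym apq in ayz.
  apply: (W (rev s)); rewrite ?mem_rev //.
  - exact: hole_rev.
  - by move: xs; rewrite !inE mem_rev.
  move=> _ _; have := holeE h zs; rewrite ayz es /= => /esym /orP [/eqP za|/eqP zl].
    have := ipath_uniq (hole_ipath h); rewrite es za => /uniq_mid [].
    by rewrite mem_head.
  have p20 : p2 = [::].
    case/lastP: p2 es zl => // p2 w es; rewrite last_cat /= last_rcons => zw.
    have := ipath_uniq (hole_ipath h); rewrite es => /uniq_mid [_].
    by rewrite -zw mem_rcons mem_head.
  rewrite p20 -cat_cons rev_cat (rev_cons a) (rev_cons z) /=.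
  by case: (rev p1) => [|b t]; [exists a, [::] | exists b, (rcons t a)].
have [p1 [p2 es]] := split_mem zs.
have ip := hole_ipath h; have uq := ipath_uniq ip; have ys := hole_root h.
have P1 : path (@adj G) y (rcons p1 z).
  by have := hole_sorted h; rewrite es -cat_rcons /= cat_path => /andP [].
have P2 : path (@adj G) z (rcons p2 y).
  have := hole_sorted_rcons asym h; rewrite es rcons_cat => /cat_sorted2 [_] //.
have go1 (P : pred G) : (forall u v, P u -> P v -> adj u v -> usable x p q f u v) ->
    P y -> P z -> all P p1 -> connect (cut_rel x p q f) y z.
  move=> H Py Pz al; have := path_cut H P1; rewrite last_rcons; apply.
  by rewrite /= Py all_rcons Pz.
have go2 (P : pred G) : (forall u v, P u -> P v -> adj u v -> usable x p q f u v) ->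
    P y -> P z -> all P p2 -> connect (cut_rel x p q f) y z.
  move=> H Py Pz al; rewrite cut_sym; have := path_cut H P2; rewrite last_rcons; apply.
  by rewrite /= Pz all_rcons Py.
have in1 v : v \in p1 -> v \in s by rewrite es mem_cat => ->.
have in2 v : v \in p2 -> v \in s by rewrite es -cat_rcons mem_cat orbC => ->.
have nx v : v \in s -> v != x by move=> vs; apply: contraNneq xs => <-; rewrite mem_tail.
have dis v : v \in p1 -> v \in p2 -> False.
  move=> v1 v2; move: uq; rewrite es cat_uniq => /and3P [_ /hasPn H _].
  by have := H v; rewrite mem_tail // v1 => /(_ isT).
have yx : y != x by apply: contraNneq xs => <-; rewrite mem_head.
have zx : z != x by exact: nx.
case: f cf ay az pick go1 go2 => [|] cf ay az pick go1 go2; last first.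
  have Us u v : alive x p q false u -> alive x p q false v -> adj u v ->
    usable x p q false u v by move=> au av _; rewrite /usable au av.
  case: (boolP (all (alive x p q false) p1)) => [/(go1 _ Us ay az) //|/allPn [k1 k1p d1]].
  case: (boolP (all (alive x p q false) p2)) => [/(go2 _ Us ay az) //|/allPn [k2 k2p d2]].
  have kE k : k \in s -> ~~ alive x p q false k -> k = p \/ k = q.
    by move=> ks; rewrite /alive nx //= negb_and !negbK => /orP [] /eqP; [left|right].
  have nk : ~~ adj k1 k2.
    by apply: (ipath_far (s1 := p1) (s2 := [:: z]) (s3 := p2)) => //; rewrite -es.
  have k12 : k1 <> k2 by move=> E; apply: (dis k1); rewrite // E.
  case: cf => [apq|[_ pq _]].
    case: (kE _ (in1 _ k1p) d1) => E1; case: (kE _ (in2 _ k2p) d2) => E2; rewrite E1 E2 in nk k12 => //.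
      by rewrite apq in nk.
    by rewrite asym apq in nk.
  by case: (kE _ (in1 _ k1p) d1) => E1; case: (kE _ (in2 _ k2p) d2) => E2; case: k12;
    rewrite E1 E2 ?pq.
have {cf} apq : adj p q by case: cf => // -[].
have key k : k = p \/ k = q -> k != y -> k != z -> connect (cut_rel x p q true) y z.
  move=> kpq ky kz; pose P v := (v != x) && (v != k).
  have HP u v : P u -> P v -> adj u v -> usable x p q true u v.
    move=> /andP [ux uk] /andP [vx vk] _; rewrite /usable /alive ux vx /=.
    by case: kpq => <-; rewrite (negPf uk) (negPf vk) ?andbF.
  have Py : P y by rewrite /P yx eq_sym.
  have Pz : P z by rewrite /P zx eq_sym.
  have al t : {subset t <= s} -> k \notin t -> all P t.
    move=> ts kt; apply/allP => v vt; rewrite /P nx ?ts //.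
    by apply: contraNneq kt => <-.
  case: (boolP (k \in p1)) => k1; last by apply: go1 HP Py Pz (al _ in1 k1).
  by apply: go2 HP Py Pz (al _ in2 _); apply/negP => /dis; apply.
have last_case : p = y /\ q = z \/ p = z /\ q = y -> connect (cut_rel x p q true) y z.
  move=> pq; have [//||b [t e2]] := pick.
    by case: pq; [constructor 1 | constructor 2].
  have := hole_sorted_rcons asym h; rewrite e2 => /= /andP [zb pbt].
  have bs : b \in s by rewrite e2 !inE eqxx orbT.
  have yb : b != y by apply: contraNneq ys => <-.
  have zbt : z \notin b :: t by move: uq; rewrite e2 => /andP [].
  have bz : b != z by apply: contraNneq zbt => <-; rewrite mem_head.
  pose P v := (v != x) && (v != z).
  have HP u v : P u -> P v -> adj u v -> usable x p q true u v.
    move=> /andP [ux uk] /andP [vx vk] _; rewrite /usable /alive ux vx /=.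
    by case: pq => -[-> ->]; rewrite (negPf uk) (negPf vk) ?andbF.
  (* The step from [z] to [b] is taken separately, because the rest of the walk is confined to [P],
     which excludes [z]. *)
  rewrite cut_sym; apply: (connect_trans (y := b)); last first.
    have := path_cut HP pbt; rewrite last_rcons; apply.
    rewrite -rcons_cons all_rcons /P yx; apply/andP; split.
      by apply: contraNneq ys => ->.
    apply/allP => v vb; rewrite nx; last by rewrite e2 mem_tail.
    by apply: contraNneq zbt => <-.
  apply: connect1; rewrite /cut_rel /= zb /usable /alive zx nx //=.
  by case: pq => -[-> ->]; rewrite (negPf bz) (negPf yb) ?andbF.
have nyz : y != z by apply: contraNneq ys => ->.
case: (eqVneq p y) => [py|npy].
  case: (eqVneq q z) => [qz|nqz]; first by apply: last_case; left.
  apply: (key q) => //; first by right.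
  by apply: contraTneq apq => ->; rewrite py airr.
case: (eqVneq p z) => [pz|npz]; last by apply: (key p) => //; left.
case: (eqVneq q y) => [qy|nqy]; first by apply: last_case; right.
apply: (key q) => //; first by right.
by apply: contraTneq apq => ->; rewrite pz airr.
Qed.

Lemma contains_of_unseparated x y z : y != z -> adj x y -> adj x z ->
  unseparated x y z -> contains_propeller G.
Proof.
move=> yz xy xz un.
have yx : y != x by apply: contraTneq xy => ->; rewrite airr.
have zx : z != x by apply: contraTneq xz => ->; rewrite airr.
case: (boolP (adj y z)) => ayz.
  have := un y z true (or_introl ayz); rewrite /alive yx zx => /(_ isT isT) /connectP [p0 pp0 ez].
  case/shortenP: pp0 ez => p pp up _ ez.
  case: p pp up ez => [|w p] /=; first by move=> _ _ ez; rewrite ez eqxx in yz.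
  case/andP => /andP [yw uw] pp /andP [yp _] ez.
  have [wx wz] : w != x /\ w != z.
    split; first by case/and3P: uw => _ /andP [].
    by apply: contraTneq uw => ->; rewrite /usable !eqxx /= !andbF.
  pose U v := (v != x) && (v != y).
  have zwp : z \in w :: p by rewrite ez mem_last.
  have [|||||||a [s [h sU /eqP ea _]]] := @hole_through _ (@adj G) y U (pred1 z)
    [pred u | adj y u && (u != z)] z w.
  - by rewrite /U eqxx andbF.
  - by move=> u _; rewrite /=; case: (u =P z) => [->|]; rewrite ?ayz ?andbT.
  - by move=> u /eqP ->; rewrite /= eqxx andbF.
  - exact: eqxx.
  - by rewrite /= yw.
  - by rewrite /U zx eq_sym.
  - apply: (connect_sorted asym (s := w :: p)); rewrite ?mem_head //.
      by move: pp => /=; apply: sub_path => a b /andP [].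
    move=> u up; apply/andP; split; last by apply: contraNneq yp => <-.
    move: up pp wx; elim: p w {uw yw yp ez zwp wz} => [|b p IH] w /=; first by rewrite inE => /eqP ->.
    rewrite inE => /orP [/eqP -> //|ubp] /andP [/andP [_ /and3P [_ /andP [bx _] _]] pp] _.
    exact: IH pp bx.
  subst a; apply: (contains_of_hole h (x := x) (u := y) (v := z)) => //.
  - rewrite inE negb_or eq_sym yx; apply/negP => /sU /andP []; by rewrite eqxx.
  - exact: mem_head.
  - by rewrite mem_tail // mem_head.
pose e : rel G := fun u v => [&& adj u v, u != x & v != x].
have esym : symmetric e by move=> u v; rewrite /e asym [(u != x) && _]andbC.
have eirr : irreflexive e by move=> u; rewrite /e airr.
have subp s : {in s, forall v, v != x} -> ipath e s = ipath (@adj G) s.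
  elim: s => //= a s IH nx; rewrite IH; last by move=> v vs; apply: nx; rewrite mem_tail.
  congr (_ && _); case: s nx {IH} => // b s nx.
  have ax : a != x by apply: nx; rewrite mem_head.
  rewrite /e ax nx ?inE ?eqxx ?orbT //= andbT; congr (_ && _).
  by apply: eq_in_all => v vs; rewrite nx ?andbT // !inE vs !orbT.
have holeG w s : hole e w s -> hole (@adj G) w s /\ x \notin w :: s.
  move=> h; have nx : {in w :: s, forall v, v != x}.
    move=> v; rewrite inE => /orP [/eqP ->|vs]; first by case/and3P: (hole_head h).
    have := hole_sorted h; have [s1 [s2 ->]] := split_mem vs.
    by rewrite /= cat_path /= => /and3P [_ /and3P []].
  split; last by apply/negP => /nx; rewrite eqxx.
  have wx : w != x by apply: nx; rewrite mem_head.
  case/and4P: h => H1 H2 H3 /allP H4; apply/and4P; split=> //.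
    by rewrite -subp // => v vs; apply: nx; rewrite mem_tail.
  apply/allP => v vs; rewrite -(eqP (H4 v vs)) /e wx nx ?andbT //.
  exact: mem_tail.
(* The bounded search only serves to decide whether there is a propeller. *)
pose hp := [exists n : 'I_#|G|.+1, [exists s : n.-tuple G, [exists w, [exists c,
  [exists u, [exists v, [&& hole e w s, c \notin w :: s, u \in w :: s, v \in w :: s,
    u != v, e c u & e c v]]]]]]].
case: (boolP hp) => [|nhp].
  case/existsP => n /existsP [s /existsP [w /existsP [c /existsP [u /existsP [v]]]]].
  case/and5P => /holeG [h _] cw uw vw /and3P [uv /and3P [cu _ _] /and3P [cv _ _]].
  exact: contains_of_hole h cw uw vw uv cu cv.
have noprop w s c u v : hole e w s -> c \notin w :: s -> u \in w :: s -> v \in w :: s ->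
    u != v -> e c u -> e c v -> False.
  move=> h cw uw vw uv cu cv; case/negP: nhp.
  have sz : size s < #|G|.+1.
    by rewrite ltnS -(card_uniqP (ipath_uniq (hole_ipath h))) max_card.
  apply/existsP; exists (Ordinal sz); apply/existsP; exists (in_tuple s).
  do 4![apply/existsP; eexists]; apply/and5P; split; [exact: h|exact: cw|exact: uw|exact: vw|].
  by rewrite uv cu cv.
have toe p q f : subrel (cut_rel x p q f) (restr e (fun v => f || (v != p) && (v != q))).
  move=> u v /andP [uv /and3P [/andP [ux u'] /andP [vx v'] _]].
  by rewrite /restr /e uv ux vx u'.
have xy' : x != y by rewrite eq_sym.
have xz' : x != z by rewrite eq_sym.
have [|p|p q|s h zs] := common_hole esym eirr noprop yz _ xy' xz'.
- by rewrite /e (negPf ayz).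
(* Removing one vertex is the configuration with [p] twice and requires an edge at [p]; for [p = x]
   this is the edge to [y]. *)
- move=> py pz pn; have [r pr] : exists r, adj p r.
    by case: pn => [->|[r /and3P [pr _ _]]]; [exists y | exists r].
  have := un p p false; rewrite /config /alive !(eq_sym _ p) py pz yx zx /= => /(_ _ isT isT) H.
  have : connect (cut_rel x p p false) y z by apply: H; right; split=> //; exists r.
  apply: connect_sub => u v /(toe p p false) uv; apply: connect1; move: uv.
  by rewrite /restr /= !andbb.
- move=> /and3P [pq _ _] py pz qy qz.
  have := un p q false (or_introl pq); rewrite /alive !(eq_sym _ p) !(eq_sym _ q) py pz qy qz yx zx.
  move=> /(_ isT isT); apply: connect_sub => u v /(toe p q false) uv; apply: connect1; move: uv.
  by rewrite /restr /= !negb_or.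
have [hG xs] := holeG _ _ h.
apply: (contains_of_hole hG xs (u := y) (v := z)) => //; first exact: mem_head.
exact: mem_tail.
Qed.

Theorem contains_propellerE : contains_propeller G <->
  exists x y z, [/\ y != z, adj x y, adj x z & unseparated x y z].
Proof.
split=> [/hole_of_contains [x [y [s [z [h xs zs xy xz]]]]]|[x [y [z [yz xy xz un]]]]].
  exists x, y, z; split=> //; last exact: hole_unseparated h xs zs.
  by apply: contraNneq (hole_root h) => ->.
exact: contains_of_unseparated yz xy xz un.
Qed.

End Propellers.

(** * Cost of word RAM programs *)

Local Notation cell := Defs.mem.

Section RunRules.
Variable W : nat.

(** A total correctness triple with an upper bound on the time, in weakest-precondition form so that
    proofs follow the program text. *)
Definition run (c : cmd) (s : state) (t : nat) (Q : state -> Prop) : Prop :=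
  exists t' s', [/\ exec W c s t' s', t' <= t & Q s'].

(** The value and the overflow check of [eval] are split: [den] computes without a word bound,
    [fits] collects the bounds on all intermediate values. *)
Fixpoint den (s : state) (e : expr) : nat :=
  match e with
  | Lit v => v
  | Reg r => reg s r
  | Read e1 => cell s (den s e1)
  | Op o e1 e2 => binop_sem o (den s e1) (den s e2)
  end.

Fixpoint fits (s : state) (e : expr) : bool :=
  match e with
  | Lit v => v < W
  | Reg r => reg s r < W
  | Read e1 => fits s e1 && (cell s (den s e1) < W)
  | Op o e1 e2 => [&& fits s e1, fits s e2 & binop_sem o (den s e1) (den s e2) < W]
  end.

Lemma eval_fits s e : fits s e -> eval W s e = Some (den s e).
Proof.
elim: e => [v|r|e IH|o e1 IH1 e2 IH2] /=; rewrite /word.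
- by move=> ->.
- by move=> ->.
- by case/andP => /IH -> /= ->.
- by case/and3P => /IH1 -> /IH2 -> /= ->.
Qed.

Definition set_reg (s : state) r v := State (upd (reg s) r v) (cell s).
Definition set_mem (s : state) a v := State (reg s) (upd (cell s) a v).

Lemma run_weaken c s t t' (Q Q' : state -> Prop) : run c s t Q -> t <= t' ->
  (forall s', Q s' -> Q' s') -> run c s t' Q'.
Proof.
move=> [t1 [s1 [ex tt Qs]]] le H; exists t1, s1; split=> //; last exact: H.
exact: leq_trans le.
Qed.

Lemma run_skip s t (Q : state -> Prop) : 0 < t -> Q s -> run Skip s t Q.
Proof. by move=> t0 Qs; exists 1, s; split=> //; constructor. Qed.

Lemma run_assign r e s t (Q : state -> Prop) : fits s e -> cost e < t ->
  Q (set_reg s r (den s e)) -> run (Assign r e) s t Q.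
Proof.
move=> fe ce Qs; exists (cost e).+1, (set_reg s r (den s e)); split=> //.
by constructor; apply: eval_fits.
Qed.

Lemma run_write e1 e2 s t (Q : state -> Prop) : fits s e1 -> fits s e2 ->
  cost e1 + cost e2 < t -> Q (set_mem s (den s e1) (den s e2)) -> run (Write e1 e2) s t Q.
Proof.
move=> f1 f2 ce Qs; exists (cost e1 + cost e2).+1, (set_mem s (den s e1) (den s e2)).
by split=> //; constructor; apply: eval_fits.
Qed.

Lemma run_seq t1 t2 p q s t (Q : state -> Prop) :
  run p s t1 (fun s1 => run q s1 t2 Q) -> t1 + t2 <= t -> run (Seq p q) s t Q.
Proof.
move=> [t1' [s1 [ex1 l1 [t2' [s2 [ex2 l2 Qs]]]]]] le; exists (t1' + t2'), s2; split=> //.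
  exact: ExecSeq ex1 ex2.
by apply: leq_trans le; apply: leq_add.
Qed.

Lemma run_if t1 e p q s t (Q : state -> Prop) : fits s e ->
  (den s e != 0 -> run p s t1 Q) -> (den s e = 0 -> run q s t1 Q) ->
  (cost e).+1 + t1 <= t -> run (If e p q) s t Q.
Proof.
move=> fe Hp Hq le.
have [t' [s' [ex l Qs]]] : run (if den s e != 0 then p else q) s t1 Q.
  by case: (den s e =P 0) => [/Hq|/eqP /Hp].
exists ((cost e).+1 + t'), s'; split=> //.
  by apply: ExecIf ex; apply: eval_fits.
by apply: leq_trans le; rewrite leq_add2l.
Qed.

Definition For r bnd body :=
  Seq (Assign r (Lit 0))
      (While (Op OpLt (Reg r) bnd) (Seq body (Assign r (Op OpAdd (Reg r) (Lit 1))))).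

(** [Inv] must be stable under assignments to the counter, which [For] itself overwrites; the body
    learns the counter from [reg s r = i]. *)
Lemma run_for (Inv : nat -> state -> Prop) N tb r bnd body s t (Q : state -> Prop) :
  N.+1 < W -> (forall i s v, Inv i s -> Inv i (set_reg s r v)) ->
  (forall i s, Inv i s -> fits s bnd /\ den s bnd = N) ->
  (forall i s, i < N -> reg s r = i -> Inv i s ->
     run body s tb (fun s' => reg s' r = i /\ Inv i.+1 s')) ->
  Inv 0 s -> (forall s', Inv N s' -> Q s') ->
  N.+1 * (tb + cost bnd + 10) <= t -> run (For r bnd body) s t Q.
Proof.
move=> NW Ireg Ibnd Ibody I0 IQ le.
(* Beyond the body, an iteration spends [cost bnd + 3] on the test and 4 on the increment. *)
pose body' := Seq body (Assign r (Op OpAdd (Reg r) (Lit 1))); pose C := tb + cost bnd + 7.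
have loop k : forall i s1, i + k = N -> reg s1 r = i -> Inv i s1 ->
    run (While (Op OpLt (Reg r) bnd) body') s1 (k * C + cost bnd + 3) Q.
  elim: k => [|k IH] i s1 ik ri Ii; have [fb db] := Ibnd i s1 Ii.
    rewrite addn0 in ik; exists (cost (Op OpLt (Reg r) bnd)).+1, s1; split=> /=; [|lia|].
      by apply: ExecWhileFalse; rewrite eval_fits /= ?fb ri db ik ?ltnn //= (ltn_trans _ NW) //=; lia.
    by apply: IQ; rewrite -ik.
  have iN : i < N by lia.
  have [t1 [s2 [ex1 l1 [r2 I2]]]] := Ibody i s1 iN ri Ii.
  pose s3 := set_reg s2 r i.+1.
  have [] := IH i.+1 s3 _ _ _; [lia|by rewrite /s3 /= /upd eqxx|exact: Ireg|].
  move=> t3 [s4 [ex3 l3 Qs]].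
  exists ((cost (Op OpLt (Reg r) bnd)).+1 + (t1 + 4) + t3), s4; split=> //; last first.
    by move: l1 l3; rewrite /C /=; lia.
  apply: (@ExecWhileTrue _ _ _ _ 1 _ s3) => //.
    by rewrite eval_fits /= ?fb ri db iN //=; apply/andP; split; lia.
  apply: ExecSeq ex1 _; rewrite /s3 /set_reg.
  have E : eval W s2 (Op OpAdd (Reg r) (Lit 1)) = Some i.+1.
    by rewrite eval_fits /= r2 ?addn1 //; apply/and3P; split; lia.
  exact: ExecAssign E.
have r0 : reg (set_reg s r 0) r = 0 by rewrite /= /upd eqxx.
have [t1 [s1 [ex l Qs]]] := loop N 0 (set_reg s r 0) (add0n N) r0 (Ireg 0 s 0 I0).
exists (2 + t1), s1; split=> //; last by move: l; rewrite /C; lia.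
apply: (@ExecSeq _ _ _ _ _ (set_reg s r 0)) ex.
by apply: ExecAssign; rewrite /= /word; case: ifP => //; lia.
Qed.

End RunRules.

(** * The program *)

Notation "a |+| b" := (Op OpAdd a b) (at level 50, left associativity).
Notation "a |*| b" := (Op OpMul a b) (at level 40, left associativity).
Notation "a |-| b" := (Op OpSub a b) (at level 50, left associativity).
Notation "a |=| b" := (Op OpEq a b) (at level 70, no associativity).

(** Each edge of the input gives two darts, one per orientation: dart [d] has its
    tail in cell [2 + d], and the other dart of the same edge is [d + 1] or
    [d - 1].

    Registers: 0 answer, 1 [n], 2 [m], 3 and 4 the base addresses of the component
    labels and of the table of separated pairs, 5 [x], 6 current dart, 7 [p],
    8 [q], 9 removal of the edge [pq] (1) or of the vertices [p], [q] (0). *)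
Definition e_tl d := Read (Lit 2 |+| d).
(** [d - 2 * (d / 2)] is the parity of [d]; adding 1 first keeps the truncated subtraction exact. *)
Definition e_mate d := (d |+| Lit 1) |-| Lit 2 |*| (d |-| Lit 2 |*| Op OpDiv d (Lit 2)).
Definition e_hd d := e_tl (e_mate d).
Definition e_lab v := Read (Reg 3 |+| v).
(** Row-major, with [2 * m * n] cells in place of one for each triple of vertices. *)
Definition e_cell d w := Reg 4 |+| (d |*| Reg 1 |+| w).
Definition e_neq a b := (a |=| b) |=| Lit 0.
(** Conjunction is a product and disjunction a sum, so the value may be 2 and only its being nonzero
    counts. *)
Definition e_alive v :=
  e_neq v (Reg 5) |*| (Reg 9 |+| e_neq v (Reg 7) |*| e_neq v (Reg 8)).
Definition e_kept u v :=
  Reg 9 |*| ((u |=| Reg 7) |*| (v |=| Reg 8) |+| (u |=| Reg 8) |*| (v |=| Reg 7)) |=| Lit 0.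
Definition e_usable u v := e_alive u |*| (e_alive v |*| e_kept u v).

(** Both labels are saved in registers, because the loop overwrites the label of the vertex in
    register 11. *)
Definition relabel :=
  Seq (Assign 13 (e_lab (Reg 11))) (Seq (Assign 14 (e_lab (Reg 12)))
  (For 15 (Reg 1) (If (e_lab (Reg 15) |=| Reg 13)
     (Write (Reg 3 |+| Reg 15) (Reg 14)) Skip))).

Definition components :=
  Seq (For 10 (Reg 1) (Write (Reg 3 |+| Reg 10) (Reg 10)))
  (For 10 (Lit 2 |*| Reg 2)
     (Seq (Assign 11 (e_tl (Reg 10))) (Seq (Assign 12 (e_hd (Reg 10)))
     (If (e_usable (Reg 11) (Reg 12)) relabel Skip)))).

(** The head of a dart with tail [x] is compared with every vertex, not only with neighbors of [x]:
    this still takes [O(nm)], and columns are addressed by vertices. *)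
Definition mark :=
  For 10 (Lit 2 |*| Reg 2)
    (Seq (Assign 11 (e_hd (Reg 10)))
    (For 12 (Reg 1)
      (If ((e_tl (Reg 10) |=| Reg 5) |*| (e_alive (Reg 11) |*| (e_alive (Reg 12) |*|
             e_neq (e_lab (Reg 11)) (e_lab (Reg 12)))))
        (Write (e_cell (Reg 10) (Reg 12)) (Lit 1)) Skip))).

Definition separate := Seq components mark.

(** Darts and not edges are visited, so that removing the tail alone covers both ends of each
    edge. *)
Definition separate_all :=
  For 5 (Reg 1) (For 6 (Lit 2 |*| Reg 2)
    (Seq (Assign 7 (e_tl (Reg 6))) (Seq (Assign 8 (e_hd (Reg 6)))
    (Seq (Assign 9 (Lit 0)) (Seq separate
    (Seq (Assign 9 (Lit 1)) (Seq separate
    (Seq (Assign 8 (Reg 7)) (Seq (Assign 9 (Lit 0)) separate))))))))).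

Definition answer :=
  For 5 (Lit 2 |*| Reg 2) (For 6 (Lit 2 |*| Reg 2)
    (If ((e_tl (Reg 5) |=| e_tl (Reg 6)) |*| (e_neq (Reg 5) (Reg 6) |*|
           (Read (e_cell (Reg 5) (e_hd (Reg 6))) |=| Lit 0)))
      (Assign 0 (Lit 0)) Skip)).

(** The test of [m] serves the time bound: without edges the loop over [x] would still take time
    linear in [n], while [n^2 m^2] is 0. *)
Definition propeller_free_prog :=
  Seq (Assign 1 (Read (Lit 0))) (Seq (Assign 2 (Read (Lit 1))) (Seq (Assign 0 (Lit 1))
  (Seq (Assign 3 (Lit 2 |+| Lit 2 |*| Reg 2)) (Seq (Assign 4 (Reg 3 |+| Reg 1))
  (If (Reg 2) (Seq separate_all answer) Skip))))).

(** * Behavior of the program on an abstract input *)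

Section Spec.
Variables (n m W : nat) (I : nat -> nat).
(** The word bound has to cover all addresses, which stay below [2 + 2 * m + n + 2 * m * n], and the
    small constants of the program. *)
Hypotheses (hI : forall d, d < 2 * m -> I (2 + d) < n) (hI0 : I 0 = n) (hI1 : I 1 = m)
  (hW : 8 * (n + 2) * (m + 2) <= W).

Definition mate d := (d + 1) - 2 * (d - 2 * (d %/ 2)).
Definition tl d := I (2 + d).
Definition hd d := I (2 + mate d).
Definition lb := 2 + 2 * m.
Definition tb := lb + n.

Lemma mate_lt d : d < 2 * m -> mate d < 2 * m.
Proof. by rewrite /mate; lia. Qed.

Lemma hd_lt d : d < 2 * m -> hd d < n.
Proof. by move=> dm; apply: hI; apply: mate_lt. Qed.

Lemma W_lin : 2 * m + n + 32 <= W.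
Proof. by move: hW; nia. Qed.

Lemma dw_lt d w : d < 2 * m -> w < n -> d * n + w < 2 * m * n.
Proof. by nia. Qed.

Lemma tb_lt k : k < 2 * m * n -> tb + k < W.
Proof. by move: hW; rewrite /tb /lb; nia. Qed.

Lemma dw_inj d w d' w' : w < n -> w' < n -> d * n + w = d' * n + w' -> d = d' /\ w = w'.
Proof.
move=> wn wn' E; have n0 : 0 < n by lia.
have := congr1 (divn^~ n) E; rewrite !divnMDl // !divn_small // !addn0 => dd.
by split=> //; move: E; rewrite dd; lia.
Qed.

Record base (s : state) : Prop := Base {
  base1 : reg s 1 = n; base2 : reg s 2 = m; base3 : reg s 3 = lb; base4 : reg s 4 = tb;
  base_in : forall a, a < lb -> cell s a = I a }.

Lemma base_den_tl s e : base s -> den s e < 2 * m -> den s (e_tl e) = tl (den s e).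
Proof. by move=> b em; rewrite /= (base_in b) // /lb; lia. Qed.

Lemma base_fits_tl s e : base s -> den s e < 2 * m -> fits W s e -> fits W s (e_tl e).
Proof.
move=> b em fe; have E := base_den_tl b em; rewrite /= in E *; rewrite fe E.
have tn := hI em; have Wl := W_lin; rewrite /tl; lia.
Qed.

Lemma den_mate s e : den s (e_mate e) = mate (den s e).
Proof. by []. Qed.

Lemma fits_mate s e : den s e < 2 * m -> fits W s e -> fits W s (e_mate e).
Proof. by move=> em fe; have Wl := W_lin; rewrite /= fe /=; lia. Qed.

Lemma base_den_hd s e : base s -> den s e < 2 * m -> den s (e_hd e) = hd (den s e).
Proof. by move=> b em; rewrite /e_hd base_den_tl ?den_mate ?mate_lt. Qed.

Lemma base_fits_hd s e : base s -> den s e < 2 * m -> fits W s e -> fits W s (e_hd e).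
Proof.
by move=> b em fe; apply: base_fits_tl; rewrite ?den_mate ?mate_lt //; apply: fits_mate.
Qed.

Lemma fits_mul s a b : fits W s a -> fits W s b -> den s a <= 2 -> den s b <= 2 ->
  fits W s (a |*| b).
Proof. by move=> fa fb; have Wl := W_lin; rewrite /= fa fb /=; nia. Qed.

Record params (s : state) (x p q : nat) (f : bool) : Prop := Params {
  par5 : reg s 5 = x; par7 : reg s 7 = p; par8 : reg s 8 = q; par9 : reg s 9 = f }.

Section Params.
Variables (x p q : nat) (f : bool).
Hypotheses (xn : x < n) (pn : p < n) (qn : q < n).

Lemma den_alive s v : params s x p q f ->
  (den s (e_alive v) != 0) = alive x p q f (den s v) /\ den s (e_alive v) <= 2.
Proof.
case=> r5 r7 r8 r9; rewrite /= r5 r7 r8 r9 /alive.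
by case: (_ == x); case: (_ == p); case: (_ == q); case: f.
Qed.

Lemma fits_alive s v : params s x p q f -> fits W s v -> fits W s (e_alive v).
Proof.
case=> r5 r7 r8 r9 fv; have Wl := W_lin; rewrite /= r5 r7 r8 r9 fv /=.
by case: (_ == x); case: (_ == p); case: (_ == q); case: f; rewrite /=; lia.
Qed.

Lemma den_kept s u v : params s x p q f -> den s (e_kept u v) =
  ~~ (f && ((den s u == p) && (den s v == q) || (den s u == q) && (den s v == p))).
Proof.
move=> P; rewrite /= (par7 P) (par8 P) (par9 P).
by case: (_ == p); case: (_ == p); case: (_ == q); case: (_ == q); case: f.
Qed.

Lemma fits_kept s u v : params s x p q f -> fits W s u -> fits W s v -> fits W s (e_kept u v).
Proof.
move=> P fu fv; have Wl := W_lin; rewrite /= fu fv (par7 P) (par8 P) (par9 P).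
by case: (_ == p); case: (_ == p); case: (_ == q); case: (_ == q); case: f => /=; lia.
Qed.

Lemma den_usable s u v : params s x p q f ->
  (den s (e_usable u v) != 0) = usable x p q f (den s u) (den s v).
Proof.
move=> P; have [Au _] := den_alive u P; have [Av _] := den_alive v P.
have -> : den s (e_usable u v) = den s (e_alive u) * (den s (e_alive v) * den s (e_kept u v)).
  by [].
by rewrite den_kept // /usable -Au -Av !muln_eq0 !negb_or; case: (~~ (f && _)).
Qed.

Lemma fits_usable s u v : params s x p q f -> fits W s u -> fits W s v ->
  fits W s (e_usable u v).
Proof.
move=> P fu fv; have [_ Au] := den_alive u P; have [_ Av] := den_alive v P.
have kl : den s (e_kept u v) <= 1 by rewrite den_kept // leq_b1.
apply: fits_mul; rewrite ?fits_alive //.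
  by apply: fits_mul; rewrite ?fits_alive ?fits_kept // ltnW.
rewrite -[den _ _]/(den s (e_alive v) * den s (e_kept u v)).
by move: kl Av; move: (den _ _) (den _ _) => A B; nia.
Qed.

Definition equivalence (E : nat -> nat -> Prop) :=
  [/\ forall a, E a a, forall a b, E a b -> E b a & forall a b c, E a b -> E b c -> E a c].

(** The least equivalence containing the usable edges, i.e. connectedness. *)
Definition linked a b := forall E : nat -> nat -> Prop, equivalence E ->
  (forall d, d < 2 * m -> usable x p q f (tl d) (hd d) -> E (tl d) (hd d)) -> E a b.

Definition lab (s : state) v := cell s (lb + v).

(** Frame condition of the component phase; the weaker [same_out] also gives up the table and serves
    for a whole round. *)
Definition same (s0 s : state) := (forall r, r < 10 -> reg s r = reg s0 r) /\
  (forall a, (a < lb) || (tb <= a) -> cell s a = cell s0 a).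

Lemma same_base s0 s : base s0 -> same s0 s -> base s.
Proof.
case=> b1 b2 b3 b4 b5 [sr sm]; split; rewrite ?sr //.
by move=> a al; rewrite sm ?al // b5.
Qed.

Lemma same_params s0 s : params s0 x p q f -> same s0 s -> params s x p q f.
Proof. by case=> r5 r7 r8 r9 [sr _]; split; rewrite sr. Qed.

Lemma same_reg s0 s r v : 10 <= r -> same s0 s -> same s0 (set_reg s r v).
Proof.
move=> r10 [sr sm]; split=> // r' r'10; rewrite /= /upd.
by case: eqP => [e|_]; [lia | apply: sr].
Qed.

Lemma same_lab s0 s v w : v < n -> same s0 s -> same s0 (set_mem s (lb + v) w).
Proof.
move=> vn [sr sm]; split=> // a al; rewrite /= /upd.
by case: eqP => [e|_]; [move: al; rewrite e /tb; lia | apply: sm].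
Qed.

(** In 21, the body counts 10, the loop bound 1 and the overhead of [run_for] 10; later time
    constants are composed likewise. *)
Lemma run_init s0 s : base s0 -> same s0 s ->
  run W (For 10 (Reg 1) (Write (Reg 3 |+| Reg 10) (Reg 10))) s (n.+1 * 21)
    (fun s' => same s0 s' /\ forall v, v < n -> lab s' v = v).
Proof.
move=> b0 S; apply: (run_for (N := n) (tb := 10)
  (Inv := fun i s => same s0 s /\ forall v, v < i -> lab s v = v)) => //.
- by have Wl := W_lin; lia.
- by move=> i s1 v [S1 L]; split=> //; apply: same_reg.
- move=> i s1 [S1 _]; have b := same_base b0 S1.
  by have Wl := W_lin; rewrite /= (base1 b); split=> //; lia.
- move=> i s1 iN ri [S1 L]; have b := same_base b0 S1.
  apply: run_write; rewrite /= ?ri ?(base3 b) //.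
  + by have Wl := W_lin; rewrite /lb; lia.
  + by have Wl := W_lin; lia.
  split=> //; split; first exact: same_lab.
  move=> v vi; rewrite /lab /= /upd eqn_add2l; case: eqP => [//|ne].
  by apply: L; lia.
Qed.

Lemma run_relabel s0 s u w : base s0 -> same s0 s -> u < n -> w < n ->
  (forall v, v < n -> lab s v < n) -> reg s 11 = u -> reg s 12 = w ->
  run W relabel s (n.+1 * 31 + 20)
    (fun s' => [/\ same s0 s', reg s' 10 = reg s 10 &
      forall v, v < n -> lab s' v = if lab s v == lab s u then lab s w else lab s v]).
Proof.
move=> b0 S un wn L r11 r12; have b := same_base b0 S; have Wl := W_lin.
have L11 := L u un; have L12 := L w wn.
have fl s1 r v : reg s1 3 = lb -> reg s1 r = v -> v < n -> lab s1 v < n ->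
    fits W s1 (e_lab (Reg r)).
  by move=> r3 rv vn ln; rewrite /= r3 rv -/(lab s1 v) /lb; lia.
apply: (run_seq (t1 := 5) (t2 := n.+1 * 31 + 15)); last by lia.
apply: run_assign => //; first exact: fl (base3 b) r11 un L11.
apply: (run_seq (t1 := 5) (t2 := n.+1 * 31)); last by lia.
set s1 := set_reg _ _ _; apply: run_assign => //.
  by apply: (fl s1 12 w) => //; apply: (base3 b).
set s2 := set_reg _ _ _.
have r13 : reg s2 13 = lab s u by rewrite /s2 /s1 /= /upd /= r11 (base3 b).
have r14 : reg s2 14 = lab s w by rewrite /s2 /s1 /= /upd /= r12 (base3 b).
have S2 : same s0 s2 by apply: same_reg => //; apply: same_reg.
apply: (run_for (N := n) (tb := 20) (Inv := fun i s' => [/\ same s0 s',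
    forall r, r < 15 -> reg s' r = reg s2 r & forall v, v < n ->
      lab s' v = if (v < i) && (lab s v == lab s u) then lab s w else lab s v])) => //.
- by lia.
- move=> i s' v [S' R' L']; split=> // [|r r15]; first exact: same_reg.
  by rewrite /= /upd; case: eqP => [e|_]; [lia | apply: R'].
- move=> i s' [S' _ _]; have b' := same_base b0 S'.
  by rewrite /= (base1 b'); split=> //; lia.
- move=> i s' iN ri [S' R' L']; have b' := same_base b0 S'.
  (* Label [i] is still the old one when it is compared. *)
  have Li := L' i iN; rewrite ltnn /= in Li.
  apply: (run_if (t1 := 12)) => //.
  + have := fl s' 15 i (base3 b') ri iN; rewrite Li => /(_ (L i iN)) F.
    rewrite -[fits _ _ _]/[&& fits W s' (e_lab (Reg 15)), reg s' 13 < W & _ < W] F R' // r13.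
    by rewrite /=; case: (_ == _); rewrite /=; lia.
  + rewrite /= ri (base3 b') -/(lab s' i) Li R' // r13 => E.
    have {}E : lab s i == lab s u by move: E; rewrite eqb0 negbK.
    apply: run_write => //.
    * by rewrite /= ri (base3 b') /lb; lia.
    * by rewrite /= R' // r14; lia.
    rewrite /= ri (base3 b') R' // r14; split=> //; split=> //; first exact: same_lab.
    move=> v vn; rewrite /lab /= /upd eqn_add2l; case: eqP => [->|ne].
      by rewrite ltnS leqnn -/(lab s i) E.
    by rewrite -/(lab s' v) L' // -/(lab s v); congr (if _ && _ then _ else _); lia.
  + rewrite /= ri (base3 b') -/(lab s' i) Li R' // r13 => E.
    have {}E : (lab s i == lab s u) = false by move/eqP: E; rewrite eqb0 => /negbTE.
    apply: run_skip => //; split=> //; split=> // v vn; rewrite L' //.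
    case: (v =P i) => [->|ne]; first by rewrite E !andbF.
    by congr (if _ && _ then _ else _); lia.
- move=> s' [S' R' L']; split=> //; first by rewrite R'.
  by move=> v vn; rewrite L' // vn.
Qed.

Lemma linked_equiv : equivalence linked.
Proof.
split=> [a E [r _ _] _|a b H E eE HE|a b c H1 H2 E eE HE]; first exact: r.
  by case: (eE) => _ sy _; apply: sy; apply: H.
by case: (eE) => _ _ tr; exact: tr (H1 E eE HE) (H2 E eE HE).
Qed.

Lemma run_components s0 s : base s0 -> params s0 x p q f -> same s0 s ->
  run W components s (n.+1 * 21 + (2 * m).+1 * (n.+1 * 31 + 160))
    (fun s' => [/\ same s0 s', forall v, v < n -> lab s' v < n &
       forall v w, v < n -> w < n -> (lab s' v = lab s' w <-> linked v w)]).
Proof.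
move=> b0 P0 S; have Wl := W_lin.
apply: (run_seq (t1 := n.+1 * 21) (t2 := (2 * m).+1 * (n.+1 * 31 + 160))); last by lia.
apply: run_weaken (run_init b0 S) (leqnn _) _ => s1 [S1 L1].
(* Half of the invariant says that labels agree across the usable darts handled so far, the other
   half that only linked vertices share a label. *)
apply: (run_for (N := 2 * m) (tb := n.+1 * 31 + 140) (Inv := fun i s' => [/\ same s0 s',
    forall v, v < n -> lab s' v < n,
    forall d, d < i -> usable x p q f (tl d) (hd d) -> lab s' (tl d) = lab s' (hd d) &
    forall v w, v < n -> w < n -> lab s' v = lab s' w -> linked v w])) => //.
- by lia.
- by move=> i s' v [S' H1 H2 H3]; split=> //; apply: same_reg.
- move=> i s' [S' _ _ _]; have b' := same_base b0 S'.
  by rewrite /= (base2 b'); split=> //; lia.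
- move=> i s2 im ri [S2 Ln Le Ls]; have b2 := same_base b0 S2.
  have tn : tl i < n by apply: hI.
  have hn : hd i < n by apply: hd_lt.
  have Fi : fits W s2 (Reg 10) by rewrite /= ri; lia.
  have im' : den s2 (Reg 10) < 2 * m by rewrite /= ri.
  apply: (run_seq (t1 := 10) (t2 := n.+1 * 31 + 130)); last by lia.
  apply: run_assign => //; first exact: base_fits_tl.
  rewrite (base_den_tl b2 im'); set s3 := set_reg _ _ _.
  have S3 : same s0 s3 by apply: same_reg.
  have b3 := same_base b0 S3; have ri3 : reg s3 10 = i by rewrite /= /upd.
  have im3 : den s3 (Reg 10) < 2 * m by rewrite [den _ _]ri3.
  apply: (run_seq (t1 := 30) (t2 := n.+1 * 31 + 100)); last by lia.
  apply: run_assign => //; first by apply: base_fits_hd => //; rewrite /= ri3; lia.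
  rewrite (base_den_hd b3 im3); set s4 := set_reg _ _ _.
  have S4 : same s0 s4 by apply: same_reg.
  have P4 := same_params P0 S4; have b4 := same_base b0 S4.
  have r11 : reg s4 11 = tl i by rewrite /= /upd /= ri.
  have r12 : reg s4 12 = hd i by rewrite /= /upd /= ri.
  have r10 : reg s4 10 = i by [].
  have Du : (den s4 (e_usable (Reg 11) (Reg 12)) != 0) = usable x p q f (tl i) (hd i).
    by rewrite den_usable // -r11 -r12.
  apply: (run_if (t1 := n.+1 * 31 + 20)); last by rewrite /=; lia.
  + apply: fits_usable => //.
      by rewrite -[fits _ _ _]/(reg s4 11 < W) r11; lia.
    by rewrite -[fits _ _ _]/(reg s4 12 < W) r12; lia.
  + rewrite Du => Ui.
    apply: run_weaken (run_relabel b0 S4 tn hn Ln r11 r12) (leqnn _) _ => s5 [S5 r5 L5].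
    have {}L5 v : v < n -> lab s5 v = if lab s2 v == lab s2 (tl i) then lab s2 (hd i) else lab s2 v.
      exact: L5.
    split; first by rewrite r5.
    split=> //.
    * by move=> v vn; rewrite L5 //; case: ifP => _; apply: Ln.
    * move=> d di Ud; have dm : d < 2 * m by lia.
      have tdn : tl d < n by apply: hI.
      rewrite !L5 ?hd_lt //; case: (d =P i) => [->|ne]; last by rewrite (Le d) //; lia.
      by rewrite eqxx; case: ifP.
    * have [lr lsy lt] := linked_equiv.
      have lth : linked (tl i) (hd i) by move=> E eE HE; apply: HE.
      have lht : linked (hd i) (tl i) by apply: lsy.
      move=> v w vn wn; rewrite !L5 //.
      case: eqP => [Ev|_]; case: eqP => [Ew|_] E.
      - by apply: Ls; rewrite // Ev Ew.
      - by apply: (lt _ (tl i)); [apply: Ls | apply: (lt _ (hd i)) => //; apply: Ls].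
      - by apply: (lt _ (hd i)); [apply: Ls | apply: (lt _ (tl i)) => //; apply: Ls].
      - exact: Ls.
  + move=> /eqP D0; have nU : ~~ usable x p q f (tl i) (hd i) by rewrite -Du negbK.
    apply: run_skip => //.
    split=> //; split=> // d di Ud; apply: Le => //.
    by case: (d =P i) Ud nU => [-> -> //|ne _ _]; lia.
- split=> //; first by move=> v vn; rewrite L1.
  by move=> v w vn wn; rewrite !L1 // => ->; case: linked_equiv.
- move=> s' [S' Ln Le Ls]; split=> // v w vn wn; split; first exact: Ls.
  (* Equality of labels is an equivalence containing all usable darts, hence contains the least
     one. *)
  have E : equivalence (fun a b => lab s' a = lab s' b) by split=> // a b c -> ->.
  by move=> H; apply: (H _ E Le).
- by rewrite /=; lia.
Qed.

(** * The table of separated pairs *)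

Definition table (s : state) d w := cell s (tb + (d * n + w)).

Definition separates d w := [/\ tl d = x, alive x p q f (hd d), alive x p q f w & ~ linked (hd d) w].

Definition same_out (s0 s : state) := (forall r, r < 10 -> reg s r = reg s0 r) /\
  (forall a, a < lb -> cell s a = cell s0 a).

Lemma same_out_base s0 s : base s0 -> same_out s0 s -> base s.
Proof.
case=> b1 b2 b3 b4 b5 [sr sm]; split; rewrite ?sr //.
by move=> a al; rewrite sm // b5.
Qed.

Lemma same_out_params s0 s : params s0 x p q f -> same_out s0 s -> params s x p q f.
Proof. by case=> r5 r7 r8 r9 [sr _]; split; rewrite sr. Qed.

Definition separatesb (l : nat -> nat) d w :=
  [&& tl d == x, alive x p q f (hd d), alive x p q f w & l (hd d) != l w].

Lemma run_mark s0 : base s0 -> params s0 x p q f ->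
  (forall v, v < n -> lab s0 v < n) ->
  run W mark s0 ((2 * m).+1 * (n.+1 * 131 + 63))
    (fun s => same_out s0 s /\ forall d w, d < 2 * m -> w < n ->
       table s d w = if separatesb (lab s0) d w then 1 else table s0 d w).
Proof.
move=> b0 P0 Ln; have Wl := W_lin; have W5 : 4 < W by lia.
(* [g] is the set of cells visited so far; as a parameter it lets both loops share one invariant. *)
pose Inv (g : nat -> nat -> bool) s := [/\ same_out s0 s,
  forall v, v < n -> lab s v = lab s0 v & forall d w, d < 2 * m -> w < n ->
    table s d w = if g d w && separatesb (lab s0) d w then 1 else table s0 d w].
have Ireg g s r v : 10 <= r -> Inv g s -> Inv g (set_reg s r v).
  move=> r10 [[S1 S2] L T]; split=> //; split=> // r' r'10; rewrite /= /upd.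
  by case: eqP => [e|_]; [lia | apply: S1].
have Ibase g s : Inv g s -> base s by case=> S _ _; apply: same_out_base S.
apply: (run_for (N := 2 * m) (tb := n.+1 * 131 + 50)
   (Inv := fun i => Inv (fun d _ => d < i))) => //.
- by lia.
- by move=> i s v; apply: Ireg.
- by move=> i s /Ibase b; rewrite /= (base2 b); split=> //; lia.
- move=> i s im ri Is; have b := Ibase _ _ Is.
  have hn : hd i < n by apply: hd_lt.
  have im' : den s (Reg 10) < 2 * m by rewrite /= ri.
  apply: (run_seq (t1 := 40) (t2 := n.+1 * 131)); last by lia.
  apply: run_assign => //; first by apply: base_fits_hd => //; rewrite /= ri; lia.
  rewrite (base_den_hd b im'); set s1 := set_reg _ _ _.
  have I1 : Inv (fun d _ => d < i) s1 by apply: Ireg.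
  have r11 : reg s1 11 = hd i by rewrite /= /upd /= ri.
  have r10 : reg s1 10 = i by rewrite /= /upd /=.
  apply: (run_for (N := n) (tb := 120) (Inv := fun j s' =>
    [/\ Inv (fun d w => (d < i) || (d == i) && (w < j)) s', reg s' 10 = i & reg s' 11 = hd i])) => //.
  + by lia.
  + by move=> j s' v [I' R1 R2]; split=> //; apply: Ireg.
  + by move=> j s' [/Ibase b' _ _]; rewrite /= (base1 b'); split=> //; lia.
  + move=> j s2 jn rj [I2 R10 R11]; have b2 := Ibase _ _ I2.
    have [S2 L2 T2] := I2; have P2 := same_out_params P0 S2.
    have im2 : den s2 (Reg 10) < 2 * m by rewrite /= R10.
    have D1 := base_den_tl b2 im2; rewrite [den s2 (Reg 10)]R10 in D1.
    have F1 : fits W s2 (e_tl (Reg 10)) by apply: base_fits_tl => //; rewrite /= R10; lia.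
    have [A1 A1'] := den_alive (Reg 11) P2; have [A2 A2'] := den_alive (Reg 12) P2.
    have Fr1 : fits W s2 (Reg 11) by rewrite /= R11; lia.
    have Fr2 : fits W s2 (Reg 12) by rewrite /= rj; lia.
    have G1 := fits_alive P2 Fr1; have G2 := fits_alive P2 Fr2.
    rewrite [den s2 (Reg 11)]R11 in A1; rewrite [den s2 (Reg 12)]rj in A2.
    pose ne := e_neq (e_lab (Reg 11)) (e_lab (Reg 12)).
    have E1 : cell s2 (lb + hd i) = lab s0 (hd i) by rewrite -(L2 _ hn).
    have E2 : cell s2 (lb + j) = lab s0 j by rewrite -(L2 _ jn).
    have l1 := Ln _ hn; have l2 := Ln _ jn.
    have Dn : den s2 ne = (lab s0 (hd i) != lab s0 j).
      by rewrite /= (base3 b2) R11 rj E1 E2 eqb0.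
    have Fn : fits W s2 ne.
      rewrite /= (base3 b2) R11 rj E1 E2 /lb.
      by case: (_ == _) => /=; clear -l1 l2 hn jn Wl; lia.
    pose te := e_tl (Reg 10) |=| Reg 5.
    have Dt : den s2 te = (tl i == x) by rewrite -(par5 P2) -D1.
    have Ft : fits W s2 te.
      rewrite -[fits _ _ _]/[&& fits W s2 (e_tl (Reg 10)), reg s2 5 < W & den s2 te < W].
      by rewrite F1 Dt (par5 P2); case: (_ == _); clear -xn Wl; lia.
    pose c2 := e_alive (Reg 12) |*| ne; pose c1 := e_alive (Reg 11) |*| c2; pose c0 := te |*| c1.
    have Dc : (den s2 c0 != 0) = separatesb (lab s0) i j.
      rewrite -[den s2 c0]/(den s2 te * (den s2 (e_alive (Reg 11)) *
        (den s2 (e_alive (Reg 12)) * den s2 ne))).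
      rewrite Dt Dn /separatesb -A1 -A2; move: (den _ _) (den _ _) => A B.
      by rewrite !muln_eq0 !negb_or !eqb0 !negbK.
    have Nn : den s2 ne <= 1 by rewrite Dn leq_b1.
    have Nt : den s2 te <= 1 by rewrite Dt leq_b1.
    have N2 : den s2 c2 <= 2.
      rewrite -[den s2 c2]/(den s2 (e_alive (Reg 12)) * den s2 ne).
      exact: (leq_mul A2' Nn).
    have N1 : den s2 c1 <= 4.
      rewrite -[den s2 c1]/(den s2 (e_alive (Reg 11)) * den s2 c2).
      exact: (leq_mul A1' N2).
    have Fc2 : fits W s2 c2 by apply: fits_mul => //; apply: leqW.
    have Fc1 : fits W s2 c1 by apply: fits_mul.
    have Fc0 : fits W s2 c0.
      rewrite -[fits _ _ _]/[&& fits W s2 te, fits W s2 c1 & den s2 te * den s2 c1 < W].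
      by rewrite Ft Fc1; apply: leq_ltn_trans (leq_mul Nt N1) W5.
    apply: (run_if (e := c0) (t1 := 14)) => //.
    * rewrite Dc => Sep; have ea : den s2 (e_cell (Reg 10) (Reg 12)) = tb + (i * n + j).
        by rewrite /= (base4 b2) (base1 b2) R10 rj.
      have dwl := dw_lt im jn; have tl_ := tb_lt dwl.
      apply: run_write => //.
      - by rewrite /= (base4 b2) (base1 b2) R10 rj; clear -tl_ im jn Wl; lia.
      - by rewrite /=; clear -W5; lia.
      rewrite ea; split=> //; split=> //; split.
      - case: S2 => S2r S2m; split=> // a al; rewrite /= /upd.
        by case: eqP => [e|_]; [move: al; rewrite e /tb; clear; lia | apply: S2m].
      - move=> v vn; rewrite -(L2 v vn) /lab /= /upd.
        by case: eqP => // e; exfalso; move: e; rewrite /tb; clear -vn; lia.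
      - move=> d w dm wn; rewrite /table /= /upd eqn_add2l; case: eqP => [e|ne'].
          by have [-> ->] := dw_inj wn jn e; rewrite eqxx ltnS leqnn Sep orbT.
        rewrite -/(table s2 d w) (T2 d w dm wn); congr (if _ && _ then _ else _).
        case: (d =P i) => [ed|//] /=; congr (_ || _).
        by case: (w =P j) => [ew|nw]; [rewrite ed ew in ne' | clear -nw; lia].
    * move=> /eqP; rewrite -[_ == 0]negbK Dc => nSep.
      apply: run_skip => //; split=> //; split=> //; split=> // d w dm wn; rewrite (T2 d w dm wn).
      case: (d =P i) => [->|//] /=; case: (w =P j) => [->|nw].
        by rewrite (negPf nSep) !andbF.
      by congr (if (_ || _) && _ then _ else _); clear -nw; lia.
  + split=> //; case: I1 => S1 L1 T1; split=> // d w dm wn; rewrite T1 //.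
    by rewrite ltn0 andbF orbF.
  + move=> s' [[S' L' T'] R1 R2]; split=> //; split=> // d w dm wn; rewrite T' // wn andbT ltnS.
    by rewrite [d <= i]leq_eqVlt orbC.
- by move=> s [S _ T]; split=> // d w dm wn; rewrite T // dm.
- by rewrite /=; lia.
Qed.

Lemma run_separate s0 : base s0 -> params s0 x p q f ->
  (forall d w, d < 2 * m -> w < n -> table s0 d w <= 1) ->
  run W separate s0 (400 * (n.+1 * (2 * m).+1))
    (fun s => [/\ same_out s0 s,
       forall d w, d < 2 * m -> w < n -> table s d w <= 1 &
       forall d w, d < 2 * m -> w < n ->
         (table s d w <> 0 <-> table s0 d w <> 0 \/ separates d w)]).
Proof.
move=> b0 P0 T0.
apply: (run_seq (t1 := n.+1 * 21 + (2 * m).+1 * (n.+1 * 31 + 160))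
  (t2 := (2 * m).+1 * (n.+1 * 131 + 63))); last by nia.
have S00 : same s0 s0 by [].
apply: run_weaken (run_components b0 P0 S00) (leqnn _) _ => s1 [S1 Ln Lk].
apply: run_weaken (run_mark (same_base b0 S1) (same_params P0 S1) Ln) (leqnn _) _.
move=> s2 [S2 T2].
have T1 d w : d < 2 * m -> w < n -> table s1 d w = table s0 d w.
  by move=> dm wn; case: S1 => _; apply; rewrite leq_addr orbT.
split.
- case: S2 => R2 M2; case: S1 => R1 M1; split=> [r r10|a al].
    by rewrite R2 // R1.
  by rewrite M2 // M1 ?al.
- by move=> d w dm wn; rewrite T2 // T1 //; case: ifP => // _; apply: T0.
move=> d w dm wn; rewrite T2 // T1 //; have hn := hd_lt dm.
case: ifP => [/and4P [/eqP tx ah aw /eqP nl]|nS].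
  by split=> // _; right; split=> // /(Lk _ _ hn wn).
split=> [|[//|[tx ah aw nl]]]; first by left.
move: nS; rewrite /separatesb tx eqxx ah aw /= => /negbFE /eqP /(Lk _ _ hn wn).
by move/nl.
Qed.

End Params.
Definition cfgs k := [:: (tl k, hd k, false); (tl k, hd k, true); (tl k, tl k, false)].

Definition sep_by x k d w := exists2 c, c \in cfgs k & separates x c.1.1 c.1.2 c.2 d w.

Lemma base_reg s r v : 4 < r -> base s -> base (set_reg s r v).
Proof.
by move=> r4 [b1 b2 b3 b4 b5]; split=> //=; rewrite /upd; case: eqP => // e; lia.
Qed.

Definition tab01 s := forall d w, d < 2 * m -> w < n -> table s d w <= 1.

Definition step_body :=
  (Seq (Assign 7 (e_tl (Reg 6))) (Seq (Assign 8 (e_hd (Reg 6)))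
    (Seq (Assign 9 (Lit 0)) (Seq separate
    (Seq (Assign 9 (Lit 1)) (Seq separate
    (Seq (Assign 8 (Reg 7)) (Seq (Assign 9 (Lit 0)) separate)))))))).

Definition NM := n.+1 * (2 * m).+1.

Lemma run_step s x k : base s -> reg s 5 = x -> reg s 6 = k -> x < n -> k < 2 * m -> tab01 s ->
  run W step_body s (1200 * NM + 200)
    (fun s' => [/\ base s', forall r, r < 7 -> reg s' r = reg s r, tab01 s' &
       forall d w, d < 2 * m -> w < n ->
         (table s' d w <> 0 <-> table s d w <> 0 \/ sep_by x k d w)]).
Proof.
move=> b r5 r6 xn km T; have Wl := W_lin.
have tn : tl k < n by apply: hI.
have hn : hd k < n by apply: hd_lt.
have km' : den s (Reg 6) < 2 * m by rewrite /= r6.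
apply: (run_seq (t1 := 10) (t2 := 1200 * NM + 190)); last by lia.
apply: run_assign => //; first by apply: base_fits_tl => //; rewrite /= r6; lia.
rewrite (base_den_tl b km') [den s _]r6; set s1 := set_reg _ _ _.
have b1 : base s1 by apply: base_reg.
have km1 : den s1 (Reg 6) < 2 * m by rewrite /= /upd /= r6.
have r61 : reg s1 6 = k by rewrite /= /upd /=.
apply: (run_seq (t1 := 40) (t2 := 1200 * NM + 150)); last by lia.
apply: run_assign => //; first by apply: base_fits_hd => //; rewrite -[fits _ _ _]/(reg s1 6 < W) r61; lia.
rewrite (base_den_hd b1 km1) [den s1 _]r61; set s2 := set_reg _ _ _.
have b2 : base s2 by apply: base_reg.
apply: (run_seq (t1 := 10) (t2 := 1200 * NM + 140)); last by lia.
apply: run_assign => //; first by rewrite /=; lia.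
set s3 := set_reg _ _ _; have b3 : base s3 by apply: base_reg.
have P3 : params s3 x (tl k) (hd k) false by split.
apply: (run_seq (t1 := 400 * NM) (t2 := 800 * NM + 140)); last by lia.
apply: run_weaken (run_separate xn tn hn b3 P3 T) (leqnn _) _ => s4 [S4 T4 E4].
have b4 := same_out_base b3 S4.
apply: (run_seq (t1 := 10) (t2 := 800 * NM + 130)); last by lia.
apply: run_assign => //; first by rewrite /=; lia.
set s5 := set_reg _ _ _; have b5 : base s5 by apply: base_reg.
have R5 r : r < 7 -> reg s5 r = reg s r.
  move=> r7; have r10 : r < 10 by lia.
  have n9 : (r == 9) = false by lia.
  have n8 : (r == 8) = false by lia.
  have n7 : (r == 7) = false by lia.
  by rewrite /= /upd n9 S4.1 //= /upd n9 n8 n7.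
have P5 : params s5 x (tl k) (hd k) true.
  by split; rewrite /= /upd //= S4.1.
apply: (run_seq (t1 := 400 * NM) (t2 := 400 * NM + 130)); last by lia.
apply: run_weaken (run_separate xn tn hn b5 P5 T4) (leqnn _) _ => s6 [S6 T6 E6].
have b6 := same_out_base b5 S6.
have r76 : reg s6 7 = tl k by rewrite S6.1 // (par7 P5).
apply: (run_seq (t1 := 10) (t2 := 400 * NM + 120)); last by lia.
apply: run_assign => //; first by rewrite /= r76; lia.
rewrite [den s6 _]r76; set s7 := set_reg _ _ _; have b7 : base s7 by apply: base_reg.
apply: (run_seq (t1 := 10) (t2 := 400 * NM)); last by lia.
apply: run_assign => //; first by rewrite /=; lia.
set s8 := set_reg _ _ _; have b8 : base s8 by apply: base_reg.
have R8 r : r < 7 -> reg s8 r = reg s r.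
  move=> r7; have r10 : r < 10 by lia.
  have n9 : (r == 9) = false by lia.
  have n8 : (r == 8) = false by lia.
  by rewrite /= /upd n9 /= /upd n8 S6.1 // R5.
have P8 : params s8 x (tl k) (tl k) false.
  by split; [rewrite R8 | rewrite /= /upd /= r76 | |].
apply: run_weaken (run_separate xn tn tn b8 P8 T6) (leqnn _) _ => s9 [S9 T9 E9].
split=> //.
- exact: same_out_base S9.
- by move=> r r7; rewrite S9.1 ?R8 //; lia.
move=> d w dm wn; rewrite E9 // E6 // E4 //; split.
  case=> [[[H|H]|H]|H]; [by left | right..].
  - by exists (tl k, hd k, false); rewrite ?inE ?eqxx.
  - by exists (tl k, hd k, true); rewrite ?inE ?eqxx ?orbT.
  - by exists (tl k, tl k, false); rewrite ?inE ?eqxx ?orbT.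
case=> [H|[c]]; first by left; left; left.
rewrite !inE => /or3P [] /eqP -> /= H.
- by left; left; right.
- by left; right.
- by right.
Qed.

Definition seps x k d w := exists x' k', [/\ x' < x, k' < k & sep_by x' k' d w].

Lemma run_separate_all s : base s -> reg s 0 = 1 ->
  (forall d w, d < 2 * m -> w < n -> table s d w = 0) ->
  run W separate_all s (n.+1 * ((2 * m).+1 * (1200 * NM + 213) + 11))
    (fun s' => [/\ base s', reg s' 0 = 1, tab01 s' &
       forall d w, d < 2 * m -> w < n -> (table s' d w <> 0 <-> seps n (2 * m) d w)]).
Proof.
move=> b r0 T0; have Wl := W_lin.
apply: (run_for (N := n) (tb := (2 * m).+1 * (1200 * NM + 213)) (Inv := fun x s' =>
  [/\ base s', reg s' 0 = 1, tab01 s' &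
       forall d w, d < 2 * m -> w < n -> (table s' d w <> 0 <-> seps x (2 * m) d w)])) => //.
- by lia.
- by move=> i s1 v [B R T E]; split=> //; apply: base_reg.
- by move=> i s1 [B _ _ _]; rewrite /= (base1 B); split=> //; lia.
- move=> x s1 xn rx [B1 R1 T1 E1].
  apply: (run_for (N := 2 * m) (tb := 1200 * NM + 200) (Inv := fun k s' =>
    [/\ base s', reg s' 0 = 1, tab01 s', reg s' 5 = x &
       forall d w, d < 2 * m -> w < n -> (table s' d w <> 0 <->
         seps x (2 * m) d w \/ exists2 k', k' < k & sep_by x k' d w)])) => //.
  + by lia.
  + by move=> i s2 v [B R T R5 E]; split=> //; apply: base_reg.
  + by move=> i s2 [B _ _ _ _]; rewrite /= (base2 B); split=> //; lia.
  + move=> k s2 km rk [B2 R2 T2 R5 E2].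
    apply: run_weaken (run_step B2 R5 rk xn km T2) (leqnn _) _ => s3 [B3 R3 T3 E3].
    split; first by rewrite R3.
    split=> //; rewrite ?R3 // => d w dm wn; rewrite E3 // E2 //; split.
      case=> [[H|[k' kk H]]|H]; first by left.
        by right; exists k' => //; lia.
      by right; exists k.
    case=> [H|[k' kk H]]; first by left; left.
    case: (k' =P k) => [e|ne]; first by right; rewrite -e.
    by left; right; exists k' => //; lia.
  + split=> // d w dm wn; rewrite E1 //; split=> [H|[//|[k' + _]]]; [by left | by rewrite ltn0].
  + move=> s2 [B2 R2 T2 R5 E2]; split=> //; split=> // d w dm wn; rewrite E2 //; split.
      case=> [[x' [k' [xx kk H]]]|[k' kk H]]; first by exists x', k'; split=> //; lia.
      by exists x, k'; split.
    case=> x' [k' [xx kk H]]; case: (x' =P x) => [e|ne].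
      by right; exists k'; rewrite // -e.
    by left; exists x', k'; split=> //; lia.
  + by rewrite /= leq_mul2l; apply/orP; right; lia.
- split=> // [d w dm wn|d w dm wn]; rewrite T0 //.
  by split=> // [[x' [k' []]]].
- by rewrite /=; lia.
Qed.

Definition bad (s : state) d d' := [&& tl d == tl d', d != d' & table s d (hd d') == 0].

Lemma run_answer s : base s -> reg s 0 = 1 -> tab01 s ->
  run W answer s ((2 * m).+1 * ((2 * m).+1 * 113 + 13))
    (fun s' => reg s' 0 = 1 /\ (forall d d', d < 2 * m -> d' < 2 * m -> ~~ bad s d d') \/
       reg s' 0 = 0 /\ exists d d', [/\ d < 2 * m, d' < 2 * m & bad s d d']).
Proof.
move=> b r0 T; have Wl := W_lin; have W5 : 4 < W by lia.
pose Bad := exists d d', [/\ d < 2 * m, d' < 2 * m & bad s d d'].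
pose Inv (g : nat -> nat -> bool) s' := [/\ base s', forall a, cell s' a = cell s a &
  reg s' 0 = 1 /\ (forall d d', d < 2 * m -> d' < 2 * m -> g d d' -> ~~ bad s d d') \/
  reg s' 0 = 0 /\ Bad].
have Ireg g s' r v : 4 < r -> Inv g s' -> Inv g (set_reg s' r v).
  move=> r4 [B C D]; split=> //; first exact: base_reg.
  by rewrite /= /upd; case: eqP => // e; lia.
apply: (run_for (N := 2 * m) (tb := (2 * m).+1 * 113)
  (Inv := fun i => Inv (fun d _ => d < i))) => //.
- by lia.
- by move=> i s1 v; apply: Ireg.
- by move=> i s1 [B _ _]; rewrite /= (base2 B); split=> //; lia.
- move=> i s1 im ri I1.
  apply: (run_for (N := 2 * m) (tb := 100) (Inv := fun j s' =>
    Inv (fun d d' => (d < i) || (d == i) && (d' < j)) s' /\ reg s' 5 = i)) => //.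
  + by lia.
  + by move=> j s2 v [I2 R2]; split=> //; apply: Ireg.
  + by move=> j s2 [[B _ _] _]; rewrite /= (base2 B); split=> //; lia.
  + move=> j s2 jm rj [[B2 C2 D2] R5].
    have hn : hd j < n by apply: hd_lt.
    have tin : tl i < n by apply: hI.
    have tjn : tl j < n by apply: hI.
    have i2 : den s2 (Reg 5) < 2 * m by rewrite /= R5.
    have j2 : den s2 (Reg 6) < 2 * m by rewrite /= rj.
    have Fi : fits W s2 (Reg 5) by rewrite /= R5; lia.
    have Fj : fits W s2 (Reg 6) by rewrite /= rj; lia.
    have F1 := base_fits_tl B2 i2 Fi; have F2 := base_fits_tl B2 j2 Fj.
    have F3 := base_fits_hd B2 j2 Fj.
    have D1 := base_den_tl B2 i2; have D2' := base_den_tl B2 j2; have D3 := base_den_hd B2 j2.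
    rewrite [den s2 (Reg 5)]R5 in D1; rewrite [den s2 (Reg 6)]rj in D2' D3.
    pose c1 := e_tl (Reg 5) |=| e_tl (Reg 6); pose c2 := e_neq (Reg 5) (Reg 6).
    pose c3 := Read (e_cell (Reg 5) (e_hd (Reg 6))) |=| Lit 0.
    have E1 : den s2 c1 = (tl i == tl j).
      by rewrite -[den s2 c1]/(den s2 (e_tl (Reg 5)) == den s2 (e_tl (Reg 6)) : nat) D1 D2'.
    have E2 : den s2 c2 = (i != j) by rewrite /= R5 rj eqb0.
    have Ea : den s2 (e_cell (Reg 5) (e_hd (Reg 6))) = tb + (i * n + hd j).
      rewrite -[den s2 _]/(reg s2 4 + (reg s2 5 * reg s2 1 + den s2 (e_hd (Reg 6)))).
      by rewrite D3 (base4 B2) (base1 B2) R5.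
    have E3 : den s2 c3 = (table s i (hd j) == 0).
      by rewrite -[den s2 c3]/(cell s2 (den s2 (e_cell (Reg 5) (e_hd (Reg 6)))) == 0 : nat) Ea C2.
    have dwl := dw_lt im hn; have tl_ := tb_lt dwl; have T1 := T i _ im hn.
    have Fc1 : fits W s2 c1.
      rewrite -[fits _ _ _]/[&& fits W s2 (e_tl (Reg 5)), fits W s2 (e_tl (Reg 6)) & den s2 c1 < W].
      by rewrite F1 F2 E1; case: (_ == _); clear -Wl; lia.
    have Fc2 : fits W s2 c2.
      by rewrite /= R5 rj; case: (_ == _) => /=; clear -Wl im jm; lia.
    have Fa : fits W s2 (e_cell (Reg 5) (e_hd (Reg 6))).
      rewrite -[fits _ _ _]/[&& reg s2 4 < W, [&& [&& reg s2 5 < W, reg s2 1 < W & reg s2 5 * reg s2 1 < W],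
        fits W s2 (e_hd (Reg 6)) & reg s2 5 * reg s2 1 + den s2 (e_hd (Reg 6)) < W] &
        den s2 (e_cell (Reg 5) (e_hd (Reg 6))) < W].
      by rewrite F3 D3 Ea (base4 B2) (base1 B2) R5; clear -tl_ im Wl; lia.
    have Fc3 : fits W s2 c3.
      rewrite -[fits _ _ _]/[&& fits W s2 (e_cell (Reg 5) (e_hd (Reg 6))) &&
        (cell s2 (den s2 (e_cell (Reg 5) (e_hd (Reg 6)))) < W), 0 < W & den s2 c3 < W].
      rewrite Fa Ea C2 E3 -/(table s i (hd j)); clear -T1 W5.
      by case: (_ == 0); lia.
    have c1l : den s2 c1 <= 1 by rewrite E1 leq_b1.
    have c2l : den s2 c2 <= 1 by rewrite E2 leq_b1.
    have c3l : den s2 c3 <= 1 by rewrite E3 leq_b1.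
    have Fc : fits W s2 (c1 |*| (c2 |*| c3)).
      have Fc23 := fits_mul Fc2 Fc3 (leqW c2l) (leqW c3l).
      exact: (fits_mul Fc1 Fc23 (leqW c1l) (leqW (leq_mul c2l c3l))).
    have Dc : (den s2 (c1 |*| (c2 |*| c3)) != 0) = bad s i j.
      rewrite -[den s2 _]/(den s2 c1 * (den s2 c2 * den s2 c3)) E1 E2 E3.
      by rewrite !muln_eq0 !negb_or !eqb0 !negbK.
    apply: (run_if (t1 := 10)) => //.
    * rewrite Dc => Hb; apply: run_assign => //; first by rewrite /=; clear -W5; lia.
      split=> //; split=> //; split=> //.
        by case: B2 => b1 b2 b3 b4 b5; split.
      by right; split=> //; exists i, j.
    * move=> /eqP; rewrite -[_ == 0]negbK Dc => nb.
      apply: run_skip => //; split=> //; split=> //; split=> //.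
      case: D2 => [[r1 H]|H]; [left|by right]; split=> // d d' dm dm'.
      case/orP => [di|/andP [/eqP di dj]]; first by apply: H; rewrite ?di.
      case: (d' =P j) => [->|ne]; first by rewrite di.
      by apply: H; rewrite // di eqxx; clear -dj ne; lia.
  + split=> //; case: I1 => B C D; split=> //; case: D => [[r1 H]|H]; [left|by right].
    by split=> // d d' dm dm'; rewrite ltn0 andbF orbF; apply: H.
  + move=> s2 [[B C D] R]; split=> //; split=> //; case: D => [[r1 H]|H]; [left|by right].
    split=> // d d' dm dm' di; apply: H => //; rewrite dm' andbT orbC -leq_eqVlt.
    by rewrite -ltnS.
- by split=> //; left; split.
- by move=> s1 [B C [[r1 H]|H]]; [left; split=> // d d' dm dm'; apply: H | right].
- by rewrite /=; lia.
Qed.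

(** * The whole program *)

Definition not_separated := exists d d', [/\ d < 2 * m, d' < 2 * m, tl d = tl d', d <> d' &
  ~ seps n (2 * m) d (hd d')].

Lemma run_prog s : (forall r, reg s r = 0) -> (forall a, cell s a = I a) ->
  (forall a, lb <= a -> I a = 0) ->
  run W propeller_free_prog s (1000 * 1000 * (n ^ 2 * m ^ 2 + 1))
    (fun s' => reg s' 0 = 1 /\ ~ not_separated \/ reg s' 0 = 0 /\ not_separated).
Proof.
move=> R0 C0 Iz; have Wl := W_lin.
set t := 1000 * 1000 * _.
(* 60 is reserved for the assignments and the test, [t'] for the two phases, which run only if there
   is an edge. Then [n] and [m] are positive, and [n + 1], [2m + 1] are at most [2n], [3m]. *)
have tt : exists t', 60 + t' = t /\ (0 < m -> (n.+1 * ((2 * m).+1 * (1200 * NM + 213) + 11)) +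
    ((2 * m).+1 * ((2 * m).+1 * 113 + 13)) <= t').
  exists (t - 60); split; first by rewrite /t; lia.
  move=> m0; have n0 : 0 < n by have := hI (d := 0) _; lia.
  have nm : 0 < n * m by rewrite muln_gt0 n0.
  have H1 : n.+1 <= 2 * n by lia.
  have H2 : (2 * m).+1 <= 3 * m by lia.
  have H3 : NM <= 6 * (n * m) by have := leq_mul H1 H2; rewrite /NM; nia.
  have H4 : (2 * m).+1 * (1200 * NM + 213) <= 3 * m * (75 * 100 * (n * m)).
    by apply: leq_mul => //; clear -H3 nm; lia.
  have P0 : 0 < m * (n * m) by rewrite muln_gt0 m0.
  have H5 : n.+1 * ((2 * m).+1 * (1200 * NM + 213) + 11) <= 2 * n * (228 * 100 * (m * (n * m))).
    by apply: leq_mul => //; move: P0 H4; clear; lia.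
  have H6 : (2 * m).+1 * ((2 * m).+1 * 113 + 13) <= 3 * m * (3 * m * 126).
    by apply: leq_mul => //; clear -m0; lia.
  have E : n ^ 2 * m ^ 2 = n * m * (n * m) by rewrite !expnS !expn0; nia.
  have H7 : m * m <= n * m * (n * m) by apply: leq_mul; rewrite leq_pmull.
  (* The phases contribute at most 45600 and 1134 times [n^2 m^2], well within the constant. *)
  apply: leq_trans (leq_add H5 H6) _; rewrite /t E.
  by move: H7; clear; lia.
case: tt => t' [<- tl'].
apply: (run_seq (t1 := 5) (t2 := 55 + t')); last by lia.
apply: run_assign => //; first by rewrite /= C0 hI0; lia.
rewrite /= C0 hI0; set s1 := set_reg _ _ _.
apply: (run_seq (t1 := 5) (t2 := 50 + t')); last by lia.
apply: run_assign => //; first by rewrite /= C0 hI1; lia.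
rewrite /= C0 hI1; set s2 := set_reg _ _ _.
apply: (run_seq (t1 := 5) (t2 := 45 + t')); last by lia.
apply: run_assign => //; first by rewrite /=; lia.
rewrite /=; set s3 := set_reg _ _ _.
apply: (run_seq (t1 := 10) (t2 := 35 + t')); last by lia.
apply: run_assign => //; first by rewrite /= /upd /=; lia.
rewrite [den _ _]/= /upd /= -/lb; set s4 := set_reg _ _ _.
apply: (run_seq (t1 := 10) (t2 := 25 + t')); last by lia.
apply: run_assign => //; first by rewrite /= /upd /= /lb; lia.
rewrite [den _ _]/= {1}/upd /= -/tb; set s5 := set_reg _ _ _.
have b5 : base s5 by split=> // a _; rewrite -C0.
have r5 : reg s5 0 = 1 by [].
have T5 d w : d < 2 * m -> w < n -> table s5 d w = 0.
  by move=> _ _; rewrite /table -[cell s5 _]/(cell s _) C0 Iz // /tb /lb; lia.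
apply: (run_if (t1 := 20 + t')); last by rewrite /=; lia.
- by rewrite -[fits _ _ _]/(reg s5 2 < W) (base2 b5); lia.
- rewrite -[den _ _]/(reg s5 2) (base2 b5) -lt0n => m0.
  apply: (run_seq _ (leq_trans (tl' m0) (leq_addl _ _))).
  apply: run_weaken (run_separate_all b5 r5 T5) (leqnn _) _ => s6 [B6 R6 T6 E6].
  apply: run_weaken (run_answer B6 R6 T6) (leqnn _) _ => s7 [[R7 H]|[R7 [d [d' [dm dm' H]]]]].
    left; split=> // -[d [d' [dm dm' tt dd ns]]].
    have := H d d' dm dm'; rewrite /bad tt eqxx; case: eqP dd => // _ _ /= /eqP nz.
    by apply: ns; apply/E6; rewrite ?hd_lt.
  right; split=> //; case/and3P: H => /eqP tt /eqP dd /eqP tz.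
  by exists d, d'; split=> // /(E6 _ _ dm (hd_lt dm')).
- rewrite -[den _ _]/(reg s5 2) (base2 b5) => m0; apply: run_skip; first by lia.
  by left; split=> // -[d [d' [+ _]]]; rewrite m0.
Qed.

End Spec.

(** * Correctness for encoded graphs *)

Lemma set2_eq (T : finType) (a b c d : T) : [set a; b] = [set c; d] ->
  (a = c /\ b = d) \/ (a = d /\ b = c).
Proof.
move=> E; have : a \in [set c; d] by rewrite -E set21.
have : b \in [set c; d] by rewrite -E set22.
have : c \in [set a; b] by rewrite E set21.
have : d \in [set a; b] by rewrite E set22.
by rewrite !inE => /orP [] /eqP ? /orP [] /eqP ? /orP [] /eqP ? /orP [] /eqP ?; subst; auto.
Qed.

Lemma nth_pairs (T : Type) (f g : T -> nat) x0 (es : seq T) i : i < size es ->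
  let s := flatten [seq [:: f e; g e] | e <- es] in
  nth 0 s (2 * i) = f (nth x0 es i) /\ nth 0 s (2 * i + 1) = g (nth x0 es i).
Proof.
elim: es i => // e es IH [|i] is_; first by rewrite muln0.
by rewrite mulnS -addnA !add2n /=; apply: IH.
Qed.

Lemma size_pairs (T : Type) (f g : T -> nat) (es : seq T) :
  size (flatten [seq [:: f e; g e] | e <- es]) = 2 * size es.
Proof. by elim: es => //= e es ->; rewrite mulnS. Qed.

Lemma mem_edges (G : sgraph) (u v : G) : ([set u; v] \in edges G) = adj u v.
Proof.
rewrite inE; apply/existsP/idP => [[a /existsP [b /andP [ab /eqP /set2_eq]]]|uv].
  by case=> -[-> ->] //; rewrite adj_sym.
by exists u; apply/existsP; exists v; rewrite uv eqxx.
Qed.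

Lemma card_edges (G : sgraph) : #|edges G| <= #|G| ^ 2.
Proof.
have sub : edges G \subset [set [set e.1; e.2] | e in [set: G * G]].
  apply/subsetP => e; rewrite inE => /existsP [u /existsP [v /andP [_ /eqP ->]]].
  by apply/imsetP; exists (u, v); rewrite ?inE.
apply: leq_trans (subset_leq_card sub) _; apply: leq_trans (leq_imset_card _ _) _.
by rewrite cardsT card_prod expnS expn1.
Qed.

Section Input.
Variables (G : sgraph) (w : seq nat) (num : G -> 'I_#|G|) (es : seq (G * G)).
Hypotheses (num_bij : bijective num)
  (es_edges : perm_eq [seq [set e.1; e.2] | e <- es] (enum (edges G)))
  (w_code : w = #|G| :: #|edges G| ::
     flatten [seq [:: val (num e.1); val (num e.2)] | e <- es]).

Let n := #|G|.
Let m := #|edges G|.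
Let I := nth 0 w.
Let code (u : G) : nat := num u.

Lemma code_inj : injective code.
Proof. by move=> u v /val_inj; apply: bij_inj. Qed.

Lemma size_es : size es = m.
Proof. by rewrite /m cardE -(perm_size es_edges) size_map. Qed.

Lemma es_adj e : e \in es -> adj e.1 e.2.
Proof.
move=> ee; rewrite -mem_edges -mem_enum -(perm_mem es_edges).
exact: (map_f (fun e => [set e.1; e.2])).
Qed.

Lemma input_end a : lb m <= a -> I a = 0.
Proof.
move=> la; rewrite /I w_code nth_default //= size_pairs size_es; exact: la.
Qed.

Lemma dart_ends i e : i < m -> nth e es i = e ->
  [/\ tl I (2 * i) = code e.1, hd I (2 * i) = code e.2,
      tl I (2 * i + 1) = code e.2 & hd I (2 * i + 1) = code e.1].
Proof.
move=> im ei; rewrite -size_es in im.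
have m0 : mate (2 * i) = 2 * i + 1 by rewrite /mate; lia.
have m1 : mate (2 * i + 1) = 2 * i by rewrite /mate; lia.
rewrite /hd m0 m1 /tl /I w_code !add2n /=.
have [-> ->] := nth_pairs (fun e => val (num e.1)) (fun e => val (num e.2)) e im.
by rewrite ei.
Qed.

Lemma dart_cases d : d < 2 * m -> exists e, [/\ e \in es, forall e0, nth e0 es (d %/ 2) = e &
  (d = 2 * (d %/ 2) /\ tl I d = code e.1 /\ hd I d = code e.2) \/
  (d = 2 * (d %/ 2) + 1 /\ tl I d = code e.2 /\ hd I d = code e.1)].
Proof.
move=> dm; have im : d %/ 2 < m by lia.
have [e0 _] : exists e0, e0 \in es.
  have : 0 < size es by rewrite size_es; lia.
  by case: (es) => // e0 t _; exists e0; rewrite mem_head.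
have ies : d %/ 2 < size es by rewrite size_es.
exists (nth e0 es (d %/ 2)); split; first exact: mem_nth.
  by move=> e1; apply: set_nth_default.
have [t1 h1 t2 h2] := dart_ends im (set_nth_default e0 (nth e0 es (d %/ 2)) ies).
have [ed|ed] : d = 2 * (d %/ 2) \/ d = 2 * (d %/ 2) + 1 by lia.
  by left; split=> //; rewrite {1 3}ed t1 h1.
by right; split=> //; rewrite {1 3}ed t2 h2.
Qed.

Lemma dart_adj d : d < 2 * m -> exists u v, [/\ adj u v, tl I d = code u & hd I d = code v].
Proof.
case/dart_cases => e [/es_adj ae _ [[_ [t h]]|[_ [t h]]]].
  by exists e.1, e.2.
by exists e.2, e.1; rewrite adj_sym.
Qed.

Lemma adj_dart u v : adj u v -> exists d, [/\ d < 2 * m, tl I d = code u & hd I d = code v].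
Proof.
rewrite -mem_edges -mem_enum -(perm_mem es_edges) => /mapP [e ees E].
have ies : index e es < size es by rewrite index_mem.
rewrite size_es in ies.
have [t1 h1 t2 h2] := dart_ends ies (nth_index e ees).
case: (set2_eq E) => -[-> ->].
  by exists (2 * index e es); split=> //; lia.
by exists (2 * index e es + 1); split=> //; lia.
Qed.

(** The input lists each edge once, so equal ends give the same edge; as there are no loops, the
    tail then decides the orientation. *)
Lemma dart_inj d d' : d < 2 * m -> d' < 2 * m -> tl I d = tl I d' -> hd I d = hd I d' -> d = d'.
Proof.
move=> dm dm'; case: (dart_cases dm) => e [ee ne H]; case: (dart_cases dm') => e' [ee' ne' H'].
move=> tt hh; have EE : [set e.1; e.2] = [set e'.1; e'.2].
  by move: (tt) (hh); case: H => -[_ [-> ->]]; case: H' => -[_ [-> ->]] /code_inj -> /code_inj ->;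
    rewrite // setUC.
have us : uniq [seq [set e.1; e.2] | e <- es] by rewrite (perm_uniq es_edges) enum_uniq.
have i1 : d %/ 2 < size es by rewrite size_es; lia.
have i2 : d' %/ 2 < size es by rewrite size_es; lia.
have ii : d %/ 2 = d' %/ 2.
  apply/eqP; rewrite -(nth_uniq (set0 : {set G}) _ _ us) ?size_map //.
  by rewrite !(nth_map e) // ne ne' EE.
have e_e : e = e' by rewrite -(ne e) ii ne'.
have ae := es_adj ee; have n12 : e.1 <> e.2 by move=> E; rewrite E adj_irr in ae.
subst e'; case: H H' => [[ed [t _]]|[ed [t _]]] [[ed' [t' _]]|[ed' [t' _]]];
  try by rewrite ed ed' ii.
- by case: n12; apply: code_inj; rewrite -t -t'.
- by case: n12; apply: code_inj; rewrite -t -t'.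
Qed.

Lemma alive_code x p q f v : alive (code x) (code p) (code q) f (code v) = alive x p q f v.
Proof. by rewrite /alive !(inj_eq code_inj). Qed.

Lemma linked_code x p q f a b :
  linked m I (code x) (code p) (code q) f (code a) (code b) <-> connect (cut_rel x p q f) a b.
Proof.
split=> [L|/connectP [s ps ->] E [r sy tr] HE].
  (* The relation must be an equivalence on all numbers, so equality is added for those that code no
     vertex. *)
  have [||/code_inj -> //|[u [v [/code_inj -> /code_inj -> //]]]] :=
      L (fun i j => i = j \/ exists u v, [/\ i = code u, j = code v & connect (cut_rel x p q f) u v]).
  - split=> [i|i j|i j k]; first by left.
      case=> [->|[u [v [-> -> c]]]]; first by left.
      by right; exists v, u; rewrite cut_sym.
    case=> [-> //|[u [v [-> -> c]]]] [<-|[u' [v' [/code_inj <- -> c']]]]; right.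
      by exists u, v.
    by exists u, v'; split=> //; apply: connect_trans c c'.
  - move=> d dm; case: (dart_adj dm) => u [v [uv -> ->]] U; right; exists u, v; split=> //.
    apply: connect1; rewrite /cut_rel /= uv; move: U.
    by rewrite /usable !alive_code !(inj_eq code_inj).
elim: s a ps => [|c s IH] a /=; first by move=> _; apply: r.
case/andP => /andP [ac U] ps; apply: (tr _ (code c)); last exact: IH.
have [d [dm td hd_]] := adj_dart ac.
rewrite -td -hd_; apply: HE => //; rewrite td hd_.
by rewrite /usable !alive_code !(inj_eq code_inj).
Qed.

Lemma cfgs_config k c : k < 2 * m -> c \in cfgs I k ->
  exists p q, config p q c.2 /\ c.1 = (code p, code q).
Proof.
move=> km; case: (dart_adj km) => u [v [uv tk hk]].
rewrite /cfgs tk hk !inE => /or3P [] /eqP -> /=.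
- by exists u, v; split=> //; left.
- by exists u, v; split=> //; left.
- by exists u, u; split=> //; right; split=> //; exists v.
Qed.

Lemma config_cfgs (p q : G) f : config p q f ->
  exists2 k, k < 2 * m & (code p, code q, f) \in cfgs I k.
Proof.
case=> [pq|[-> <- [r pr]]].
  have [k [km tk hk]] := adj_dart pq; exists k => //.
  by rewrite /cfgs tk hk !inE !xpair_eqE !eqxx; case: f.
have [k [km tk hk]] := adj_dart pr; exists k => //.
by rewrite /cfgs tk hk !inE !xpair_eqE !eqxx !orbT.
Qed.

Lemma not_separatedE : not_separated n m I <-> contains_propeller G.
Proof.
rewrite contains_propellerE; split.
  case=> d [d' [dm dm' tt dd ns]].
  have [x [y [xy td hd_]]] := dart_adj dm; have [x' [z [xz td' hd']]] := dart_adj dm'.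
  have ex : x' = x by apply: code_inj; rewrite -td -td'.
  subst x'; exists x, y, z; split=> //.
    by apply: contra_notN dd => /eqP yz; apply: dart_inj => //; rewrite hd_ hd' yz.
  move=> p q f cf ay az; apply/negPn/negP => nc; apply: ns.
  have [k km kc] := config_cfgs cf.
  exists (code x), k; split=> //; first exact: ltn_ord.
  exists (code p, code q, f) => //=; rewrite /separates td hd_ hd' !alive_code.
  by split=> // /linked_code; apply/negP.
case=> x [y [z [yz xy xz un]]].
have [d [dm td hd_]] := adj_dart xy; have [d' [dm' td' hd']] := adj_dart xz.
exists d, d'; split=> //; first by rewrite td td'.
  by move=> E; move: hd'; rewrite -E hd_ => /code_inj E'; rewrite E' eqxx in yz.
case=> x' [k [xn km [c kc []]]].
have [p [q [cf E]]] := cfgs_config km kc; rewrite E /= td hd_ hd' => <-.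
rewrite !alive_code => ay az; apply; apply/linked_code.
exact: un cf ay az.
Qed.

End Input.

(* The word length is O(log n).  The summand 1 in the time bound only matters
   for edgeless graphs, where n^2 m^2 = 0. *)
Theorem theorem4p13 :
  exists (p : cmd) (k c : nat),
    forall (G : sgraph) (w : seq nat), graph_code G w ->
      exists t ans : nat,
        [/\ runs_to (#|G|.+2 ^ k) p w t ans,
            t <= c * (#|G| ^ 2 * #|edges G| ^ 2 + 1) &
            ans = YES /\ ~ contains_propeller G \/
            ans = NO /\ contains_propeller G].
Proof.
exists propeller_free_prog, 6, (1000 * 1000) => G w [num [es [num_bij es_edges w_code]]].
have hI d : d < 2 * #|edges G| -> nth 0 w (2 + d) < #|G|.
  move=> dm; have [u [v [_ E _]]] := dart_adj es_edges w_code dm.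
  by rewrite -/(tl (nth 0 w) d) E; apply: ltn_ord.
(* The exponent 6 splits into 3 for the factor 8, 1 for [n + 2] and 2 for [m + 2], where [m <= n^2];
   the base [n + 2] keeps this true for the smallest graphs. *)
have hW : 8 * (#|G| + 2) * (#|edges G| + 2) <= #|G|.+2 ^ 6.
  have := card_edges G; move: #|G| #|edges G| => n m nm.
  have H1 : 8 <= n.+2 ^ 3 by rewrite -[8]/(2 ^ 3) leq_exp2r.
  have H2 : m + 2 <= n.+2 ^ 2 by apply: leq_trans (leq_add nm (leqnn 2)) _; rewrite !expnS !expn0; lia.
  have -> : n.+2 ^ 6 = n.+2 ^ 3 * (n + 2) * n.+2 ^ 2 by rewrite addn2 -!expnSr -expnD.
  by rewrite !leq_mul.
have I0 : nth 0 w 0 = #|G| by rewrite w_code.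
have I1 : nth 0 w 1 = #|edges G| by rewrite w_code.
have [t [s [ex tle res]]] := run_prog hI I0 I1 hW (s := initial w)
  (fun=> erefl) (fun=> erefl) (input_end es_edges w_code).
exists t, (reg s 0); split=> //; first by exists s.
have E := not_separatedE num_bij es_edges w_code.
by case: res => -[-> H]; [left|right]; split=> //; [move=> /E | apply/E].
Qed.
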